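(* Let $M$ be a simple matroid of rank $r\ge 2$ on $\binom{r+1}{2}$ elements such that for each $i\in[r-1]$ and each rank-$i$ flat $F$, either $|F|=\binom{i+1}{2}$ or $|F|\le\binom{i}{2}+1$. Call a rank-$i$ flat $F$ large if $|F|=\binom{i+1}{2}$, and call a chain of flats $F_0\subsetneq F_1\subsetneq\cdots\subsetneq F_r$ with $r(F_i)=i$ a large flag if every $F_i$ is large. Then $M$ has at most $(r+1)!/2$ large flags, and if $M$ has exactly $(r+1)!/2$ large flags, then $M$ is isomorphic to $M(K_{r+1})$. Thus $M(K_{r+1})$ is extremal.
   Context: All matroids are finite. $M(K_{r+1})$ is the cycle matroid of the complete graph on $r+1$ vertices. Note that the rank-$0$ flat (the set of loops) is empty in a simple matroid, and large for $i=0,r$ means $|F_0|=0$ and $|F_r|=\binom{r+1}{2}$. Extremal matroids: a cyclic flat of a matroid is a flat that is a union of circuits; a matroid is nested if its cyclic flats form a chain under inclusion. For a matroid $M$ on $[n]$, its base polytope $\mathcal{P}(M)\subseteq\mathbb{R}^n$ is the convex hull of the characteristic vectors of its bases. For $X\subseteq\mathbb{R}^n$ let $\mathbb{I}(X)(x_1,\ldots,x_n)=\frac{1}{n!}\sum_{\sigma\in S_n}\bar{\mathbb{I}}(X)(x_{\sigma(1)},\ldots,x_{\sigma(n)})$, where $\bar{\mathbb{I}}(X)$ is the indicator function of $X$. Up to isomorphism there are exactly $\binom{n}{r}$ nested matroids of rank $r$ on $n$ elements; fix representatives $N_1,\ldots,N_{\binom nr}$ on $[n]$. For each rank-$r$ matroid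 $M$ on $[n]$ there are unique integers $c_j$ with $\mathbb{I}(\mathcal{P}(M))=\sum_j c_j\,\mathbb{I}(\mathcal{P}(N_j))$, and the vector $(c_j)$ depends only on the isomorphism class of $M$. $\Omega_{r,n}$ is the convex hull of these vectors over all rank-$r$ matroids on $n$ elements; a matroid is extremal if its vector is a vertex of $\Omega_{r,n}$. *)

(* Defs.v *)
From mathcomp Require Import all_boot all_order all_algebra all_fingroup.
From mathcomp Require Import boolp.

Set Implicit Arguments.
Unset Strict Implicit.
Unset Printing Implicit Defensive.

Import GRing.Theory.

Record matroid (T : finType) := Matroid {
  indep : {set {set T}};
  indep0 : set0 \in indep;
  indepS : forall A B : {set T}, A \subset B -> B \in indep -> A \in indep;
  indep_aug : forall A B : {set T}, A \in indep -> B \in indep ->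
    #|A| < #|B| -> exists2 x, x \in B :\: A & x |: A \in indep
}.

Definition isomorphic (T U : finType) (M : matroid T) (M' : matroid U) : Prop :=
  exists f : T -> U, bijective f /\
    forall A : {set T}, (A \in indep M) = (f @: A \in indep M').

Section MatroidNotions.
Variables (T : finType) (M : matroid T).
Implicit Types (A B C F : {set T}) (x y : T).

Definition basis B := maxset (fun A => A \in indep M) B.

Definition circuit C := minset (fun A => A \notin indep M) C.

Definition rk A : nat := \max_(I in indep M | I \subset A) #|I|.

Definition rank : nat := rk [set: T].

Definition flat F := [forall x, (x \notin F) ==> (rk F < rk (x |: F))].

Definition loop x := circuit [set x].

Definition parallel x y := (x != y) && circuit [set x; y].

Definition simple := [forall x, ~~ loop x] && [forall x, forall y, ~~ parallel x y].

(* The empty union is allowed: the empty set is cyclic when M has no loops. *)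
Definition cyclic_flat F :=
  flat F && [exists S : {set {set T}}, (S \subset circuit) && (F == cover S)].

Definition nested :=
  [forall F, forall G : {set T}, cyclic_flat F && cyclic_flat G ==>
    (F \subset G) || (G \subset F)].

Definition large F := flat F && (#|F| == 'C((rk F).+1, 2)).

Definition large_flag r (F : {ffun 'I_r.+1 -> {set T}}) :=
  [forall i, (rk (F i) == i) && large (F i)] &&
  [forall i : 'I_r.+1, forall j : 'I_r.+1, (i < j) ==> (F i \proper F j)].

Definition large_flags r : {set {ffun 'I_r.+1 -> {set T}}} :=
  [set F | large_flag F]%SET.

End MatroidNotions.

Section CompleteGraph.
Variable V : finType.

(* The edges of the complete graph on V. *)
Definition edge := {e : {set V} | #|e| == 2}.

Definition adj (A : {set edge}) : rel V :=
  fun u v => [exists e in A, val e == [set u; v]%SET].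

Definition acyclic (A : {set edge}) : Prop :=
  forall p : seq V, 2 < size p -> ~ ucycle (adj A) p.

End CompleteGraph.

(* The matroid axioms for acyclic edge sets, via incidence vectors over F_2. *)
Section CycleMatroid.
Variable V : finType.
Local Open Scope ring_scope.
Implicit Types (A B : {set edge V}) (e : edge V) (u v w : V).

Let delta v : {ffun V -> ('F_2)^o} := [ffun w => (w == v)%:R].
Let inc e : {ffun V -> ('F_2)^o} := [ffun w => (w \in val e)%:R].

Lemma adjP A u v :
  reflect (exists2 e, e \in A & val e = [set u; v]%SET) (adj A u v).
Proof.
apply: (iffP existsP) => [[e /andP[eA /eqP]]|[e eA eE]]; first by exists e.
by exists e; rewrite eA eE eqxx.
Qed.

Lemma adjC A : symmetric (adj A).
Proof. by move=> u v; apply/adjP/adjP => -[e eA eE]; exists e; rewrite // eE setUC. Qed.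

Lemma adjS A B : A \subset B -> subrel (adj A) (adj B).
Proof. by move=> /subsetP AB u v /adjP[e /AB eB eE]; apply/adjP; exists e. Qed.

Lemma acyclicS A B : A \subset B -> acyclic B -> acyclic A.
Proof.
move=> AB acB p p2 /andP[cp up]; apply: (acB p p2).
by rewrite /ucycle up andbT (sub_cycle (adjS AB)).
Qed.

Lemma edge_ends e : exists u v, u != v /\ val e = [set u; v]%SET.
Proof. by have /cards2P[u [v [uv ->]]] := valP e; exists u, v. Qed.

Lemma edge_neq e u v : val e = [set u; v]%SET -> u != v.
Proof. by move=> eE; have := valP e; rewrite eE cards2; case: (u != v). Qed.

Lemma incE e u v : val e = [set u; v]%SET -> inc e = delta u + delta v.
Proof.
move=> eE; have uv := edge_neq eE; apply/ffunP => w.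
rewrite !ffunE eE !inE; case: (eqVneq w u) => [->|_].
  by rewrite (negPf uv) addr0.
by rewrite add0r.
Qed.

Lemma path_span A u q : path (adj A) u q ->
  delta u + delta (last u q) \in <<[seq inc e | e <- enum A]>>%VS.
Proof.
elim: q u => [|w q IHq] u /=.
  move=> _; suff -> : delta u + delta u = 0 by rewrite mem0v.
  by apply/ffunP => x; rewrite !ffunE; case: (x == u); apply/eqP.
case/andP => /adjP[e eA eE] /IHq wq.
have -> : delta u + delta (last w q) =
    inc e + (delta w + delta (last w q)).
  rewrite (incE eE); apply/ffunP => x; rewrite !ffunE.
  by case: (x == u); case: (x == w); case: (x == last w q); apply/eqP.
by rewrite memvD // memv_span // map_f // mem_enum.
Qed.

Lemma span_connect A e u v : val e = [set u; v]%SET ->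
  inc e \in <<[seq inc e | e <- enum A]>>%VS -> connect (adj A) u v.
Proof.
move=> eE eS; apply/negP => /negP nuv.
pose phi (f : {ffun V -> ('F_2)^o}) : 'F_2 := \sum_(w | connect (adj A) u w) f w.
have phiD f w1 w2 : f = delta w1 + delta w2 ->
    phi f = (connect (adj A) u w1)%:R + (connect (adj A) u w2)%:R.
  have phid w : phi (delta w) = (connect (adj A) u w)%:R.
    case: (boolP (connect (adj A) u w)) => uw; rewrite /phi.
      rewrite (bigD1 w) //= big1 => [|x /andP[_ /negPf xw]]; last by rewrite ffunE xw.
      by rewrite ffunE eqxx; apply/eqP.
    rewrite big1 // => x ux; rewrite ffunE; case: eqP => // xw.
    by rewrite -xw ux in uw.
  move=> ->; rewrite -!phid /phi -big_split /=.
  by apply: eq_bigr => x _; rewrite ffunE.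
have : phi (inc e) = 1 by rewrite (phiD _ _ _ (incE eE)) connect0 (negPf nuv); apply/eqP.
set X := [seq inc e | e <- enum A] in eS.
rewrite (coord_span (X := in_tuple X) eS) /phi.
under eq_bigr => w _ do rewrite sum_ffunE.
rewrite exchange_big /= big1 => [/esym/eqP|i _]; first by rewrite oner_eq0.
under eq_bigr => w _ do rewrite ffunE.
rewrite -mulr_sumr.
have /mapP[d dA ->] : X`_i \in X by rewrite mem_nth.
rewrite mem_enum in dA.
have [x [y [_ dE]]] := edge_ends d.
rewrite -/(phi _) (phiD _ _ _ (incE dE)).
have xy : connect (adj A) x y by apply: connect1; apply/adjP; exists d.
rewrite (same_connect_r (sym_connect_sym (@adjC A)) xy).
rewrite (_ : _ + _ = 0) ?mulr0 //.
by case: connect; apply/eqP.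
Qed.

Lemma acyclic_free (s : seq (edge V)) :
  uniq s -> acyclic [set e in s]%SET -> free [seq inc e | e <- s].
Proof.
elim: s => [|e s IHs] /=; first by rewrite nil_free.
move=> /andP[es us] ac; rewrite free_cons IHs //; last first.
  by apply: acyclicS ac; apply/subsetP => x; rewrite !inE => ->; rewrite orbT.
rewrite andbT; set B := [set x in s]%SET.
have [u [v [uv eE]]] := edge_ends e.
have -> : <<[seq inc e0 | e0 <- s]>>%VS = <<[seq inc e0 | e0 <- enum B]>>%VS.
  apply: eq_span => f; apply/mapP/mapP => -[x xs ->]; exists x => //.
    by rewrite mem_enum inE.
  by rewrite mem_enum inE in xs.
apply/negP => /(span_connect eE)/connectP[q0 q0p q0l].
case: (shortenP q0p) q0l => q qp uq _ q0l.
apply: (ac (u :: q)).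
  case: q qp uq q0l => [|w [|? ?]] //=; first by move=> _ _ vu; rewrite vu eqxx in uv.
  move=> /andP[/adjP[d]]; rewrite inE => ds dE _ _ vw.
  by case/negP: es; rewrite (_ : e = d) //; apply: val_inj; rewrite /= eE dE vw.
have BA : B \subset [set x in e :: s]%SET.
  by apply/subsetP => x; rewrite !inE => ->; rewrite orbT.
rewrite /ucycle uq andbT /= rcons_path (sub_path (adjS BA) qp) /= -q0l.
by apply/adjP; exists e; rewrite ?inE ?eqxx // eE setUC.
Qed.

Lemma acyclicU1 A e : acyclic A ->
  inc e \notin <<[seq inc e | e <- enum A]>>%VS -> acyclic (e |: A)%SET.
Proof.
move=> acA eS p p2 /andP[cp up].
case: (boolP (all (fun x => adj A x (next p x)) p)) => [/allP pA|].
  by apply: (acA p p2); rewrite /ucycle up andbT; apply: cycle_from_next.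
case/allPn => x xp nxA; case/negP: eS.
have [i q qE] := rot_to xp.
have nxE : next p x = next (x :: q) x by rewrite -qE next_rot.
have {cp} : path.cycle (adj (e |: A)%SET) (x :: q) by rewrite -qE rot_cycle.
have {up} : uniq (x :: q) by rewrite -qE rot_uniq.
have {p2} : (2 < size (x :: q))%N by rewrite -qE size_rot.
rewrite {}nxE {qE xp} in nxA.
case: q nxA => [|y [|z q]] //=; rewrite eqxx => nxA _.
rewrite !inE !negb_or => /and3P[/and3P[xy xz xq] /andP[yz yq] _].
have adjU a b : adj (e |: A)%SET a b -> ~~ adj A a b -> val e = [set a; b]%SET.
  case/adjP => d; rewrite !inE => /orP[/eqP ->|dA] dE // /adjP[].
  by exists d.
case/and3P => /adjU/(_ nxA) eE yzA zqA.
have adjA a b : a != x -> ~~ ((a == y) && (b == x)) ->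
    adj (e |: A)%SET a b -> adj A a b.
  move=> ax abyx /adjU abE; apply: contraT => /abE; rewrite eE => /setP abxy.
  have := abxy a; have := abxy x; have := edge_neq eE.
  rewrite !inE !eqxx (negPf ax) /= (eq_sym x a) (negPf ax) /=.
  move=> _ /esym/eqP xb /eqP ay; case/negP: abyx.
  by rewrite ay -xb !eqxx.
have yzx : path (adj A) y (z :: rcons q x).
  rewrite /= adjA //=; last 2 first.
  - by rewrite eq_sym.
  - by rewrite negb_and (eq_sym z x) xz orbT.
  move: xz yz xq yq zqA; clear -adjA.
  elim: q z => [|t q IHq] z /= xz yz.
    by move=> _ _ /andP[zx _]; rewrite adjA // ?(eq_sym z) // negb_and (negPf yz).
  rewrite !inE !negb_or => /andP[xt xq] /andP[yt yq] /andP[zt tq].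
  by rewrite adjA ?IHq // ?(eq_sym z) // negb_and (negPf yz).
have := path_span yzx; rewrite /= last_rcons addrC.
by rewrite (incE eE).
Qed.

Let forests : {set {set edge V}} := [set A | `[< acyclic A >]]%SET.

Lemma acyclic0 : set0 \in forests.
Proof.
rewrite inE; apply/asboolP => -[|u [|v p]] //= _ /andP[/andP[/adjP[e]]].
by rewrite inE.
Qed.

Lemma acyclic_sub A B : A \subset B -> B \in forests -> A \in forests.
Proof. by rewrite !inE => AB /asboolP acB; apply/asboolP/(acyclicS AB). Qed.

Lemma acyclic_aug A B : A \in forests -> B \in forests -> (#|A| < #|B|)%N ->
  exists2 x, x \in B :\: A & (x |: A)%SET \in forests.
Proof.
rewrite [A \in _]inE [B \in _]inE => /asboolP acA /asboolP acB ltAB.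
have frB : free [seq inc e | e <- enum B].
  by apply: acyclic_free; rewrite ?enum_uniq // set_enum.
have : ~~ all (mem <<[seq inc e | e <- enum A]>>%VS) [seq inc e | e <- enum B].
  apply/negP => /allP/span_subvP/dimvS; rewrite (eqP frB) size_map -cardE.
  move=> /leq_trans/(_ (dim_span _)); rewrite size_map -cardE.
  by rewrite leqNgt ltAB.
case/allPn => f /mapP[e]; rewrite mem_enum => eB -> neA {f}; exists e.
  rewrite inE eB andbT; apply: contra neA => eA.
  by apply: memv_span; rewrite map_f // mem_enum.
by rewrite inE; apply/asboolP/acyclicU1.
Qed.

Definition cycle_matroid_complete : matroid (edge V) :=
  Matroid acyclic0 acyclic_sub acyclic_aug.

End CycleMatroid.

(* M(K_n), on vertex set {0, ..., n - 1}. *)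
Definition MK (n : nat) : matroid (edge 'I_n) := cycle_matroid_complete 'I_n.

Lemma card_edge n : #|{: edge 'I_n}| = 'C(n, 2).
Proof.
rewrite card_sig -[n in RHS]card_ord -card_draws.
by apply: eq_card => A; rewrite !inE.
Qed.

Lemma exists_labelling (T : finType) (M : matroid T) n :
  #|T| = n -> exists K : matroid 'I_n, isomorphic K M.
Proof.
move=> <-; pose f := @enum_val T predT.
have fi : injective f by exact: enum_val_inj.
pose I := [set A : {set 'I_#|T|} | f @: A \in indep M]%SET.
have I0 : set0 \in I by rewrite inE imset0 indep0.
have IS (A B : {set 'I_#|T|}) : A \subset B -> B \in I -> A \in I.
  by rewrite !inE => AB; apply: indepS; apply: imsetS.
have Iaug (A B : {set 'I_#|T|}) : A \in I -> B \in I -> #|A| < #|B| ->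
    exists2 x, x \in B :\: A & x |: A \in I.
  rewrite [A \in _]inE [B \in _]inE => AI BI; rewrite -(card_imset _ fi) -(card_imset (mem B) fi).
  case/(indep_aug AI BI) => y /setDP[/imsetP[x xB ->] xA] xI {y}; exists x.
    by rewrite inE xB andbT; apply: contra xA => xA; apply: imset_f.
  by rewrite inE imsetU1.
exists (Matroid I0 IS Iaug), f; split; first exact: enum_val_bij.
by move=> A; rewrite inE.
Qed.

From mathcomp Require Import classical_sets reals numfun.

Local Open Scope classical_set_scope.
Local Open Scope ring_scope.

Section Polytopes.
Variable R : realType.

Definition convex_hull (V : lmodType R) (X : set V) : set V :=
  [set x | exists (m : nat) (p : 'I_m -> V) (w : 'I_m -> R),
    [/\ forall i, X (p i), forall i, 0 <= w i,
        \sum_i w i = 1 & x = \sum_i w i *: p i]].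

(* A vertex of a polytope is a face that is a single point. *)
Definition vertex d (P : set 'rV[R]_d) (v : 'rV[R]_d) : Prop :=
  P v /\ exists a : 'rV[R]_d, forall x, P x -> x != v ->
    \sum_i a 0 i * x 0 i < \sum_i a 0 i * v 0 i.

Variable n : nat.

Definition char_vec (B : {set 'I_n}) : 'rV[R]_n := \row_i (i \in B)%:R.

Definition base_polytope (M : matroid 'I_n) : set 'rV[R]_n :=
  convex_hull [set char_vec B | B in [set B | basis M B]].

Definition sym_indic (X : set 'rV[R]_n) (x : 'rV[R]_n) : R :=
  (n`!)%:R^-1 * \sum_(s : 'S_n) \1_X (\row_i x 0 (s i)).

End Polytopes.

Section Extremal.
Variables (R : realType) (r n : nat) (N : 'I_('C(n, r)) -> matroid 'I_n).

(* N lists each isomorphism class of nested rank-r matroids on n elements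
   exactly once; there are 'C(n, r) such classes. *)
Definition nested_representatives : Prop :=
  [/\ forall j, nested (N j) /\ rank (N j) = r,
      forall j k, isomorphic (N j) (N k) -> j = k
    & forall M : matroid 'I_n, nested M -> rank M = r ->
        exists j, isomorphic M (N j)].

(* c is the (unique, when N is a system of representatives) integer vector
   expressing the symmetrized indicator function of the base polytope of M. *)
Definition nested_coords (M : matroid 'I_n) (c : 'rV[int]_('C(n, r))) : Prop :=
  forall x : 'rV[R]_n, sym_indic (base_polytope M) x =
    \sum_j (c 0 j)%:~R * sym_indic (base_polytope (N j)) x.

Definition Omega : set 'rV[R]_('C(n, r)) :=
  convex_hull [set v | exists (M : matroid 'I_n) (c : 'rV[int]_('C(n, r))),
    [/\ rank M = r, nested_coords M c & v = map_mx intr c]].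

Definition extremal (M : matroid 'I_n) : Prop :=
  rank M = r /\ exists c : 'rV[int]_('C(n, r)),
    nested_coords M c /\ vertex Omega (map_mx intr c).

End Extremal.

(* Main.v *)
(* Combinatorial bound. A large flat of rank k + 1 contains at most k + 2 large
   hyperplanes: for k at least 2, apart from some sporadic cases in which there are
   at most 3 of them, any two meet in a large flat, and such a flat lies in at most
   two of them. Multiplying these bounds along flags gives (r + 1)! / 2. If the
   bound is attained there are r + 1 large hyperplanes; double counting shows that
   each element is outside exactly two of them, which labels the elements by the
   edges of a complete graph, and intersecting all but three of the hyperplanes
   shows that triangles have rank 2. This determines the rank function.

   Extremality. By Edmonds' description of base polytopes, the indicator function
   of P(M) is an integer combination of those of nested matroids, one for each
   chain of sets (the sets violated by a point form a poset with contractible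
   order complex). Slicing shows that a linear relation between indicator functions
   of compact convex sets persists for their Euler characteristics; applied to
   P(M) cut by the inequalities x(S) >= rho(S) for S in a chain, this makes the
   number of chains of sets with prescribed sizes and ranks a linear function of
   the coordinates of M. The number of large flags minus a large multiple of the
   number of flats of forbidden size is then such a function, and it is maximal
   exactly at M(K_(r+1)). *)

Require Import Defs.
From mathcomp Require Import all_boot all_order all_algebra all_fingroup.
From mathcomp Require Import boolp.
From mathcomp Require Import zify ring lra.

Set Implicit Arguments.
Unset Strict Implicit.
Unset Printing Implicit Defensive.

Import Order.TTheory GRing.Theory Num.Theory.

(** * Rank, flats and chain matroids *)

Section Rank.
Variables (T : finType) (M : matroid T).
Implicit Types (A B C D F G I J S : {set T}) (x y : T).

(** A vertex must beat every rank-[r] matroid, while the combinatorial bound concerns only matroids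
    without flats of forbidden size; hence the penalty. The linear functions available are counts of
    chains of sets with prescribed sizes and ranks, which do not see whether a set is a flat. Two
    devices get around this. Flatness becomes a signed count of pairs of nested sets of equal rank.
    And under [good] a set of rank i with C(i+1,2) elements is its own closure, so large flags can
    be counted by sizes and ranks alone. The penalty weight is the number of all sequences of r+1
    sets, crude but enough to push the value to at most 0 once a single bad flat exists. The maximum
    is attained at one point only because attaining it forces an isomorphism with M(K_{r+1}), and
    isomorphic matroids have equal coordinates; this rests on the linear independence of the
    symmetrized indicators of the nested representatives. [triangular] labellings let the extremal
    matroid and the cycle matroid share one rank formula. *)

Lemma card_le_rk I A : I \in indep M -> I \subset A -> #|I| <= rk M A.
Proof. by move=> iI IA; apply: (leq_bigmax_cond (F := fun I : {set T} => #|I|)); rewrite iI. Qed.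

Lemma rk_witness A : exists I, [/\ I \in indep M, I \subset A & #|I| = rk M A].
Proof.
have h0 : 0 < #|[pred I : {set T} | (I \in indep M) && (I \subset A)]|.
  by apply/card_gt0P; exists set0; rewrite inE indep0 sub0set.
have [I /andP[iI IA] E] := eq_bigmax_cond (fun I : {set T} => #|I|) h0.
by exists I; split => //; rewrite -E /rk.
Qed.

Lemma rkS A B : A \subset B -> rk M A <= rk M B.
Proof.
have [I [iI IA <-]] := rk_witness A; move=> AB.
by apply: card_le_rk => //; apply: subset_trans AB.
Qed.

Lemma rk_le_card A : rk M A <= #|A|.
Proof. by have [I [_ IA <-]] := rk_witness A; apply: subset_leq_card. Qed.

Lemma rk0 : rk M set0 = 0.
Proof. by apply/eqP; rewrite -leqn0 -(cards0 T) rk_le_card. Qed.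

Lemma indepE A : (A \in indep M) = (rk M A == #|A|).
Proof.
apply/idP/eqP => [iA|E].
  by apply/eqP; rewrite eqn_leq rk_le_card card_le_rk.
have [I [iI IA cI]] := rk_witness A.
by have /eqP <- : I == A by rewrite eqEcard IA cI E leqnn.
Qed.

Lemma indep_extend I A : I \in indep M -> I \subset A ->
  exists J, [/\ J \in indep M, I \subset J, J \subset A & #|J| = rk M A].
Proof.
have [m] := ubnP (rk M A - #|I|); elim: m I => // m IHm I lem iI IA.
have [E|ne] := eqVneq #|I| (rk M A); first by exists I.
have lt : #|I| < rk M A by rewrite ltn_neqAle ne card_le_rk.
have [B [iB BA cB]] := rk_witness A.
have [x /setDP[xB xI] ixI] : exists2 x, x \in B :\: I & x |: I \in indep M.
  by apply: indep_aug; rewrite // cB.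
have [||| J [iJ IJ JA cJ]] := IHm (x |: I) => //.
- by rewrite cardsU1 xI; lia.
- by rewrite subUset sub1set (subsetP BA) ?IA.
- by exists J; split => //; apply: subset_trans IJ; apply: subsetUr.
Qed.

Lemma rk_submod A B : rk M (A :|: B) + rk M (A :&: B) <= rk M A + rk M B.
Proof.
have [I [iI IAB cI]] := rk_witness (A :&: B).
have IA : I \subset A by apply: subset_trans IAB (subsetIl _ _).
have IB : I \subset B by apply: subset_trans IAB (subsetIr _ _).
have [J [iJ IJ JAB cJ]] := indep_extend iI (subset_trans IA (subsetUl A B)).
have le C : #|J :&: C| <= rk M C.
  by apply: card_le_rk; [apply: indepS iJ; apply: subsetIl|apply: subsetIr].
have lA := le A; have lB := le B.
have : #|J :&: A| + #|J :&: B| = #|J| + #|J :&: (A :&: B)|.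
  rewrite -cardsUI -setIUr (setIidPl JAB); congr (_ + #|pred_of_set _|).
  by rewrite setIACA setIid.
have : #|I| <= #|J :&: (A :&: B)| by apply: subset_leq_card; rewrite subsetI IJ.
lia.
Qed.

Lemma rkU A B : rk M (A :|: B) <= rk M A + rk M B.
Proof. by have := rk_submod A B; lia. Qed.

Lemma rk_le_rank A : rk M A <= rank M.
Proof. exact: rkS (subsetT A). Qed.

Definition cl A := [set x | rk M (x |: A) == rk M A].

Lemma clP x A : reflect (rk M (x |: A) = rk M A) (x \in cl A).
Proof. by rewrite inE; apply: eqP. Qed.

Lemma sub_cl A : A \subset cl A.
Proof. by apply/subsetP => x xA; apply/clP; rewrite setUC (setUidPl _) ?sub1set. Qed.

Lemma cl_mono A B : A \subset B -> cl A \subset cl B.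
Proof.
move=> AB; apply/subsetP => x /clP xA; apply/clP.
have [xB|xB] := boolP (x \in B); first by rewrite setUC (setUidPl _) ?sub1set.
have := rk_submod (x |: A) B.
rewrite -setUA (setUidPr AB).
have -> : (x |: A) :&: B = A.
  by rewrite setIUl (setIidPl AB) (_ : [set x] :&: B = set0) ?set0U //;
    apply/setP => y; rewrite !inE; case: eqP => // ->; rewrite (negPf xB).
have := rkS (subsetUr [set x] B); lia.
Qed.

Lemma rk_sub_cl A B : A \subset B -> B \subset cl A -> rk M B = rk M A.
Proof.
move=> AB BA; apply/eqP; rewrite eqn_leq (rkS AB) andbT.
have [I [iI IA cI]] := rk_witness A.
have [J [iJ IJ JB cJ]] := indep_extend iI (subset_trans IA AB).
rewrite -cI -cJ; apply: subset_leq_card; apply/subsetP => x xJ.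
apply: contraT => xI.
have : x |: I \in indep M by apply: indepS iJ; rewrite subUset sub1set xJ.
rewrite indepE cardsU1 xI => /eqP E.
have /(subsetP BA)/clP xA := subsetP JB _ xJ.
have := rkS (setUS [set x] IA); rewrite xA; lia.
Qed.

Lemma rk_cl A : rk M (cl A) = rk M A.
Proof. by apply: rk_sub_cl => //; apply: sub_cl. Qed.

Lemma flatP F : reflect (forall x, x \notin F -> rk M F < rk M (x |: F)) (flat M F).
Proof. by apply: (iffP forallP) => H x; [move/implyP: (H x)|apply/implyP/H]. Qed.

Lemma cl_flat A : flat M (cl A).
Proof.
apply/flatP => x xA; rewrite ltn_neqAle rkS ?subsetUr // andbT.
apply: contra xA => /eqP E; apply/clP.
have := rkS (setUS [set x] (sub_cl A)); have := rkS (subsetUr [set x] A).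
by have := rk_cl A; lia.
Qed.

Lemma flat_cl F : flat M F -> cl F = F.
Proof.
move=> /flatP fF; apply/eqP; rewrite eqEsubset sub_cl andbT.
by apply/subsetP => x /clP E; apply: contraT => /fF; rewrite E ltnn.
Qed.

Lemma cl_sub_flat A F : flat M F -> A \subset F -> cl A \subset F.
Proof. by move=> /flat_cl {2}<-; apply: cl_mono. Qed.

Lemma flatT : flat M [set: T].
Proof. by apply/flatP => x; rewrite inE. Qed.

Lemma flatI F G : flat M F -> flat M G -> flat M (F :&: G).
Proof.
move=> fF fG; rewrite (_ : F :&: G = cl (F :&: G)) ?cl_flat //.
by apply/eqP; rewrite eqEsubset sub_cl subsetI !cl_sub_flat // ?subsetIl ?subsetIr.
Qed.

Lemma flat_rk_lt F G : flat M F -> F \proper G -> rk M F < rk M G.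
Proof.
move=> /flatP fF /properP[FG [x xG /fF]] lt; apply: leq_trans lt _.
by apply: rkS; rewrite subUset sub1set xG.
Qed.

Lemma flat_eq F G : flat M F -> F \subset G -> rk M G <= rk M F -> F = G.
Proof.
move=> fF FG le; apply/eqP; rewrite eqEsubset FG /=; apply: contraT => GF.
by have := flat_rk_lt fF (introT andP (conj FG GF)); lia.
Qed.

Definition comparable_sets (P : {set {set T}}) :=
  forall A B, A \in P -> B \in P -> (A \subset B) || (B \subset A).

(** The largest member [A] of the chain contains all others, so a basis of [A] that is good for them
    comes from induction; extending it to [U] adds nothing inside any member, since the traces
    already have full rank. One basis thus realizes all ranks along a chain, which is what the
    greedy algorithm and the cuts of base polytopes need. *)
Lemma chain_basis (P : {set {set T}}) (U : {set T}) : comparable_sets P ->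
  (forall A, A \in P -> A \subset U) ->
  exists B, [/\ B \in indep M, B \subset U, #|B| = rk M U &
    forall A, A \in P -> #|B :&: A| = rk M A].
Proof.
have [m] := ubnP #|P|; elim: m P U => // m IHm P U ltm cP PU.
have [->|[A0 A0P]] := set_0Vmem P.
  have [B [iB BU cB]] := rk_witness U; exists B; split => // A.
  by rewrite inE.
have [A AP Amax] := arg_maxnP (fun A : {set T} => #|A|) A0P.
have {}AP : A \in P := AP.
have sA B : B \in P -> B \subset A.
  move=> BP; case/orP: (cP _ _ AP BP) => // AB.
  by have /eqP -> : A == B by rewrite eqEcard AB; apply: Amax.
have [|||B' [iB' B'A cB' B'P]] := IHm (P :\ A) A.
- by move: ltm; rewrite (cardsD1 A P) AP.
- by move=> B C; rewrite !inE => /andP[_ BP] /andP[_ CP]; apply: cP.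
- by move=> B; rewrite !inE => /andP[_ BP]; apply: sA.
have [B [iB B'B BU cB]] := indep_extend iB' (subset_trans B'A (PU _ AP)).
have le C : #|B :&: C| <= rk M C.
  by apply: card_le_rk; [apply: indepS iB; apply: subsetIl|apply: subsetIr].
exists B; split => // C CP; apply/eqP; rewrite eqn_leq le /=.
have [->|nCA] := eqVneq C A.
  by rewrite -cB'; apply: subset_leq_card; rewrite subsetI B'B.
rewrite -B'P ?inE ?nCA //; apply: subset_leq_card; exact: setSI.
Qed.

Lemma circuitP C : circuit M C ->
  C \notin indep M /\ forall D, D \proper C -> D \in indep M.
Proof.
case/minsetP => nC minC; split=> // D /andP[DC nCD]; apply: contraT => nD.
by have E := minC D nD DC; rewrite E subxx in nCD.
Qed.

Lemma dep_circuit A : A \notin indep M -> exists2 C, circuit M C & C \subset A.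
Proof. by move=> /(minset_exists (P := fun A => A \notin indep M)) [C ? ?]; exists C. Qed.

Lemma circuit_cl C x : circuit M C -> x \in C -> x \in cl (C :\ x).
Proof.
move=> /circuitP[nC pC] xC; apply/clP; rewrite setD1K //.
have := pC _ (properD1 xC); rewrite indepE => /eqP E.
have := rkS (subD1set C x); have := rk_le_card C; have := cardsD1 x C.
by move: nC; rewrite indepE xC; lia.
Qed.

(* A dependent set violates the inequality of the closure of any of its circuits. *)
Lemma indep_cyclic A :
  (forall F, cyclic_flat M F -> #|A :&: F| <= rk M F) -> A \in indep M.
Proof.
move=> H; apply: contraT => /dep_circuit[C cC CA].
have [nC pC] := circuitP cC.
have Cne : C != set0 by apply: contraNneq nC => ->; rewrite indep0.
have [c cinC] := set0Pn _ Cne.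
have cycF : cyclic_flat M (cl C).
  rewrite /cyclic_flat cl_flat /=; apply/existsP.
  exists [set D in circuit M | D \subset cl C]; apply/andP; split.
    by apply/subsetP => D; rewrite inE => /andP[].
  apply/eqP/setP => x; apply/idP/bigcupP => [xC|[D]]; last first.
    by rewrite inE => /andP[_ /subsetP]; apply.
  have [xinC|xnC] := boolP (x \in C).
    by exists C => //; rewrite inE sub_cl andbT.
  have iC' := pC _ (properD1 cinC).
  (* [C :\ c] is independent and spans the closure of [C], so adding [x] creates a circuit, and this
     circuit must pass through [x]. Hence the closure is a union of circuits. *)
  have dep : x |: (C :\ c) \notin indep M.
    rewrite indepE cardsU1 !inE (negPf xnC) andbF /=.
    have := rkS (setUS [set x] (subD1set C c)).
    rewrite (clP _ _ xC); have := rk_sub_cl (subD1set C c).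
    have -> : C \subset cl (C :\ c).
      apply/subsetP => y yC; have [->|ne] := eqVneq y c; first exact: circuit_cl.
      by apply: (subsetP (sub_cl _)); rewrite !inE ne.
    by move/(_ isT); have := rk_le_card (C :\ c); lia.
  have [D cD Dx] := dep_circuit dep.
  have [nD _] := circuitP cD.
  exists D.
    rewrite inE [D \in _]cD /=; apply: subset_trans Dx _.
    by rewrite subUset sub1set xC (subset_trans (subD1set _ _) (sub_cl C)).
  apply: contraT => xD; case/negP: nD; apply: indepS iC'.
  apply/subsetP => y yD; have := subsetP Dx y yD.
  by rewrite in_setU1 => /orP[/eqP yx|//]; rewrite yx (negPf xD) in yD.
have := H _ cycF; rewrite rk_cl leqNgt => /negP[].
apply: (@leq_trans #|C|); last by apply: subset_leq_card; rewrite subsetI CA sub_cl.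
by move: nC; rewrite indepE; have := rk_le_card C; lia.
Qed.

Lemma rank_indep_card A : A \in indep M -> #|A| = rank M -> basis M A.
Proof.
move=> iA cA; apply/maxsetP; split=> // B iB AB.
apply/esym/eqP; rewrite eqEcard AB cA; apply: card_le_rk => //; exact: subsetT.
Qed.

Lemma basisP A : reflect (A \in indep M /\ #|A| = rank M) (basis M A).
Proof.
apply: (iffP idP) => [/maxsetP[iA mA]|[]]; last exact: rank_indep_card.
split=> //; have [B [iB AB _ cB]] := indep_extend iA (subsetT A).
by rewrite /rank -cB (mA B iB AB).
Qed.

Lemma basis_rk_le B A : basis M B -> #|B :&: A| <= rk M A.
Proof.
move=> /basisP[iB _]; apply: card_le_rk; last exact: subsetIr.
by apply: indepS iB; apply: subsetIl.
Qed.

End Rank.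

Arguments cl {T} M A.

Lemma matroid_eq (T : finType) (M M' : matroid T) : indep M = indep M' -> M = M'.
Proof.
case: M M' => [I a b c] [I' a' b' c'] /= E; subst I'.
by rewrite (Prop_irrelevance a a') (Prop_irrelevance b b') (Prop_irrelevance c c').
Qed.

(** * Matroids defined by cardinality bounds along a chain of sets *)

Section ChainMatroid.
Variables (T : finType) (P : {set {set T}}) (rho : {set T} -> nat).
Hypothesis cP : comparable_sets P.
Implicit Types (A B D F S : {set T}).

Let I := [set A : {set T} | [forall S in P, #|A :&: S| <= rho S]].

Let IP A : reflect (forall S, S \in P -> #|A :&: S| <= rho S) (A \in I).
Proof. by rewrite inE; apply: (iffP forall_inP). Qed.

Fact chain_indep0 : set0 \in I.
Proof. by apply/IP => S _; rewrite set0I cards0. Qed.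

Fact chain_indepS A B : A \subset B -> B \in I -> A \in I.
Proof.
move=> AB /IP iB; apply/IP => S SP; apply: leq_trans (iB S SP).
by apply: subset_leq_card; apply: setSI.
Qed.

(** Only tight sets, those with [#|A :&: S| = rho S], can block an element. They form a chain, so
    all lie in the largest one; there [B] has no more elements than [A], hence it has more outside,
    and any such new element can be added. *)
Fact chain_indep_aug A B : A \in I -> B \in I -> #|A| < #|B| ->
  exists2 x, x \in B :\: A & x |: A \in I.
Proof.
move=> /IP iA /IP iB lt.
pose tight S := (S \in P) && (#|A :&: S| == rho S).
(* [S0] stands for the largest tight set, or for the empty set when no set is tight. *)
have aux S0 : #|B :&: S0| <= #|A :&: S0| ->
    (forall S, S \in P -> #|A :&: S| == rho S -> S \subset S0) ->
    exists2 x, x \in B :\: A & x |: A \in I.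
  move=> le sub.
  have /subsetPn[x /setDP[xB xS0] xA] : ~~ (B :\: S0 \subset A :\: S0).
    apply/negP => /subset_leq_card.
    by have := cardsID S0 A; have := cardsID S0 B; lia.
  have {}xA : x \notin A by move: xA; rewrite inE xS0.
  exists x; first by rewrite inE xA.
  apply/IP => S SP; rewrite setIUl.
  have [xS|xS] := boolP (x \in S); last first.
    rewrite (_ : [set x] :&: S = set0) ?set0U ?iA //.
    by apply/setP => y; rewrite !inE; case: eqP => // ->; rewrite (negPf xS).
  have : #|A :&: S| != rho S.
    by apply: contra xS0 => /(sub S SP)/subsetP; apply.
  have := iA S SP; have := cardsUI ([set x] :&: S) (A :&: S).
  have : #|[set x] :&: S| <= 1 by rewrite -(cards1 x) subset_leq_card ?subsetIl.
  lia.
have [S1 tS1|none] := pickP tight; last first.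
  by apply: (aux set0); rewrite ?setI0 ?cards0 // => S SP E; have := none S; rewrite /tight SP E.
have [S /andP[SP /eqP E] Smax] := arg_maxnP (fun S : {set T} => #|S|) tS1.
apply: (aux S); first by rewrite E iB.
move=> S' S'P E'; case/orP: (cP S'P SP) => // SS'.
by have /eqP -> : S == S' by rewrite eqEcard SS' /=; apply: Smax; rewrite /tight S'P.
Qed.

Definition chain_matroid : matroid T :=
  Matroid chain_indep0 chain_indepS chain_indep_aug.

Lemma chain_matroidP A :
  reflect (forall S, S \in P -> #|A :&: S| <= rho S) (A \in indep chain_matroid).
Proof. exact: IP. Qed.

(** A circuit breaks the bound of some [S] and, by minimality, lies inside it. Its rank [#|D|.-1] is
    then already at least [rho S], so the closure of [D] swallows [S]. Cyclic flats are therefore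
    unions of members of the chain. *)
Lemma chain_circuit D F : circuit chain_matroid D -> flat chain_matroid F ->
  D \subset F -> exists S, [/\ S \in P, D \subset S & S \subset F].
Proof.
move=> cD fF DF; have [nD pD] := circuitP cD.
have /existsP[S /andP[SP ltS]] : [exists S, (S \in P) && (rho S < #|D :&: S|)].
  apply: contraT; rewrite negb_exists => /forallP H; case/negP: nD.
  by apply/chain_matroidP => S SP; have := H S; rewrite SP -leqNgt.
have nDS : D :&: S \notin indep chain_matroid.
  apply/negP => /chain_matroidP /(_ _ SP); rewrite -setIA setIid; lia.
have DS : D \subset S.
  apply: contraT => nDsS; case/negP: nDS; apply: pD.
  by rewrite properE subsetIl subsetI subxx.
exists S; split=> //; apply/subsetP => x xS.
rewrite -(flat_cl fF); apply: (subsetP (cl_mono _ DF)); apply/clP.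
have [xD|xD] := boolP (x \in D); first by rewrite setUC (setUidPl _) ?sub1set.
have Dne : D != set0 by apply: contraNneq nD => ->; rewrite indep0.
have [d dD] := set0Pn _ Dne.
have iD' := pD _ (properD1 dD).
apply/eqP; rewrite eqn_leq (rkS _ (subsetUr _ _)) andbT.
have rkD : #|D|.-1 <= rk chain_matroid D.
  move: iD'; rewrite indepE => /eqP E.
  by rewrite (cardsD1 d D) dD add1n /= -E; apply/rkS/subD1set.
have [J [/chain_matroidP iJ JD <-]] := rk_witness chain_matroid (x |: D).
have := iJ S SP.
have -> : J :&: S = J.
  by apply/setIidPl; apply: subset_trans JD _; rewrite subUset sub1set xS.
move: ltS rkD; rewrite (setIidPl DS).
by move: #|D| #|J| (rho S) (rk _ D) => a b c d'; clear; lia.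
Qed.

Lemma chain_matroid_nested : nested chain_matroid.
Proof.
apply/forallP => F; apply/forallP => G; apply/implyP.
move=> /andP[/andP[fF /existsP[s /andP[sc /eqP Fs]]]].
move=> /andP[fG /existsP[t /andP[tc /eqP Gt]]].
have [//|/= /subsetPn[x xF xG]] := boolP (F \subset G).
have [D Ds xD] : exists2 D, D \in s & x \in D by apply/bigcupP; rewrite -/(cover s) -Fs.
have cov (u : {set {set T}}) (E D0 : {set T}) : E = cover u -> D0 \in u -> D0 \subset E.
  by move=> -> /(bigcup_sup (P := mem u) D0 (F := id)); apply.
have [S [SP DS SF]] := chain_circuit (subsetP sc _ Ds) fF (cov _ _ _ Fs Ds).
apply/subsetP => y; rewrite Gt => /bigcupP[D' D't yD'].
have [S' [S'P DS' SG]] := chain_circuit (subsetP tc _ D't) fG (cov _ _ _ Gt D't).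
case/orP: (cP SP S'P) => SS'.
  by case/negP: xG; apply: (subsetP SG); apply: (subsetP SS'); apply: (subsetP DS).
by apply: (subsetP SF); apply: (subsetP SS'); apply: (subsetP DS').
Qed.

End ChainMatroid.

(** * Large flats and large flags *)

Ltac card_lia :=
  repeat match goal with
  | |- context [card ?X] => generalize (card X)
  | |- context [rk ?M ?X] => generalize (rk M X)
  | |- context [binomial ?a ?b] => generalize (binomial a b)
  end; clear; lia.

Lemma binS2 n : 'C(n.+1, 2) = 'C(n, 2) + n.
Proof. by rewrite binS bin1. Qed.

Lemma bin2_double n : 'C(n.+1, 2) * 2 = n.+1 * n.
Proof. by elim: n => // n IHn; rewrite binS2 mulnDl IHn; lia. Qed.

Lemma simple_rk2 (T : finType) (M : matroid T) x y :
  simple M -> x != y -> rk M [set x; y] = 2.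
Proof.
move=> /andP[/forallP nl /forallP np] xy.
suff : [set x; y] \in indep M by rewrite indepE cards2 xy => /eqP.
apply: contraT => /dep_circuit[C cC Cxy]; have [nC _] := circuitP cC.
have := np x => /forallP/(_ y); rewrite /parallel xy /= => nxy.
have : C \in powerset [set x; y] by rewrite inE.
have [xC|xC] := boolP (x \in C); have [yC|yC] := boolP (y \in C) => _.
- suff E : C = [set x; y] by rewrite -E cC in nxy.
  by apply/eqP; rewrite eqEsubset Cxy subUset !sub1set xC.
- suff E : C = [set x] by have := nl x; rewrite /loop -E cC.
  apply/eqP; rewrite eqEsubset sub1set xC andbT; apply/subsetP => z zC.
  by have := subsetP Cxy z zC; rewrite !inE => /orP[//|/eqP zy]; rewrite -zy zC in yC.
- suff E : C = [set y] by have := nl y; rewrite /loop -E cC.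
  apply/eqP; rewrite eqEsubset sub1set yC andbT; apply/subsetP => z zC.
  by have := subsetP Cxy z zC; rewrite !inE => /orP[/eqP zx|//]; rewrite -zx zC in xC.
- case/negP: nC; suff -> : C = set0 by rewrite indep0.
  apply/setP => z; rewrite inE; apply/negP => zC.
  have := subsetP Cxy z zC; rewrite !inE => /orP[]/eqP E.
    by rewrite -E zC in xC.
  by rewrite -E zC in yC.
Qed.

Section LargeFlats.
Variables (T : finType) (M : matroid T).
Implicit Types (A B F G H : {set T}).

(** The second alternative asks for positive rank because at rank 0 its bound would tolerate one
    loop. *)
Definition good := forall F, flat M F ->
  #|F| = 'C((rk M F).+1, 2) \/ 0 < rk M F /\ #|F| <= 'C(rk M F, 2) + 1.

Definition large_hyps G :=
  [set H : {set T} | [&& large M H, H \subset G & (rk M H).+1 == rk M G]].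

Lemma largeP F : reflect (flat M F /\ #|F| = 'C((rk M F).+1, 2)) (large M F).
Proof. by apply: (iffP andP) => -[? /eqP]. Qed.

Lemma large_hypsP G k H : rk M G = k.+1 -> H \in large_hyps G ->
  [/\ flat M H, H \subset G, rk M H = k & #|H| = 'C(k, 2) + k].
Proof.
rewrite inE => -> /and3P[/largeP[fH cH] HG /eqP[E]].
by split=> //; rewrite cH E binS2.
Qed.

Hypothesis gM : good.

Lemma good_le F : flat M F -> #|F| <= 'C((rk M F).+1, 2).
Proof. by case/gM => [->//|[? ?]]; rewrite binS2; lia. Qed.

(** Upper bound: the intersection is a flat of rank below [k]. Lower bound: the union fits into [G],
    and 2 C(k+1,2) - C(k+2,2) = C(k,2) - 1. A flat of rank below k-1 is too small to have C(k,2)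
    elements, which gives the last clause. *)
Lemma hyps_meet G k H H' : large M G -> rk M G = k.+1 ->
  H \in large_hyps G -> H' \in large_hyps G -> H != H' ->
  [/\ rk M (H :&: H') < k, #|H :&: H'| <= 'C(k, 2),
      'C(k, 2) <= #|H :&: H'| + 1 &
      #|H :&: H'| = 'C(k, 2) -> H :&: H' \in large_hyps H].
Proof.
move=> /largeP[fG cG] rG hH hH' ne.
have [fH HG rH cH] := large_hypsP rG hH.
have [fH' HG' rH' cH'] := large_hypsP rG hH'.
have fI := flatI fH fH'.
have lt : rk M (H :&: H') < k.
  rewrite -rH; apply: flat_rk_lt => //; rewrite properE subsetIl subsetI subxx /=.
  by apply: contra ne => HH'; apply/eqP/(flat_eq fH HH'); rewrite rH rH'.
have le := good_le fI.
have leC := leq_trans le (leq_bin2l _ lt).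
have cU := cardsUI H H'.
have : #|H :|: H'| <= #|G| by apply: subset_leq_card; rewrite subUset HG.
rewrite cG rG !binS2 => lU; split=> //; first by move: cU cH cH' lU; card_lia.
move=> cI; rewrite inE subsetIl rH /=.
suff E : (rk M (H :&: H')).+1 = k by rewrite /large fI E cI !eqxx.
apply/eqP; rewrite eqn_leq lt /= leqNgt; apply/negP => lt2.
case: k lt2 cI {rG rH rH' cH cH' lt leC cG cU lU} => // k lt2 cI.
by have := leq_trans le (leq_bin2l 2 (ltnSE lt2)); rewrite cI binS2; move: lt2; card_lia.
Qed.

(* If two large hyperplanes H, H' of G meet in fewer than 'C(k, 2) points then
   they cover G; goodness leaves only ranks 3 and 4, and there is then at most
   one further large hyperplane. *)
Lemma hyps_cover G k H H' : large M G -> rk M G = k.+1 -> 1 < k ->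
  H \in large_hyps G -> H' \in large_hyps G -> H != H' ->
  #|H :&: H'| <> 'C(k, 2) -> #|large_hyps G| <= 3.
Proof.
move=> lG rG k1 hH hH' ne cI.
have [lt le ge _] := hyps_meet lG rG hH hH' ne.
have [fG cG] := largeP _ lG.
have [fH HG rH cH] := large_hypsP rG hH.
have [fH' HG' rH' cH'] := large_hypsP rG hH'.
have {cI ge}cI : #|H :&: H'| + 1 = 'C(k, 2) by move: cI le ge; card_lia.
(* The intersection is a flat of rank below k with C(k,2) - 1 elements. Rank k-1 and large would
   mean C(k,2); a smaller large flat has at most C(k,2) - (k-1); a flat that is not large has at
   most C(k-1,2) + 1 = C(k,2) - k + 2. For k > 3 none of these fits. *)
have k3 : k <= 3.
  rewrite leqNgt; apply/negP => k3; case: k k1 k3 cI lt {rG rH cH rH' cH' le} => // k _ k3.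
  rewrite binS2 => cI lt; case: (gM (flatI fH fH')).
    rewrite binS2; case: (ltnP (rk M (H :&: H')) k) => [lt2|]; last first.
      move=> ge; have -> : rk M (H :&: H') = k by move: lt ge; card_lia.
    by move: cI; card_lia.
    by have := leq_bin2l 2 lt2; rewrite binS2; move: cI k3; card_lia.
  by case=> _; have := leq_bin2l 2 (ltnSE lt); move: cI k3; card_lia.
rewrite (cardsD1 H) hH (cardsD1 H') in_setD1 eq_sym ne hH' !add1n !ltnS.
(* Since [H] and [H'] cover [G], the set [A] is the union of two traces of at most C(k,2) elements
   each. For k = 2 this gives 2 < 3; for k = 3 it gives 3 + 3 = 6, which is just enough if the
   traces are disjoint. *)
have third A : A \in large_hyps G -> A != H -> A != H' ->
    #|A :&: (H :&: H')| = 0 /\ k = 3.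
  move=> hA nAH nAH'.
  have [_ leA _ _] := hyps_meet lG rG hA hH nAH.
  have [_ leA' _ _] := hyps_meet lG rG hA hH' nAH'.
  have [fA AG rA cA] := large_hypsP rG hA.
  have EG : H :|: H' = G.
    apply/eqP; rewrite eqEcard subUset HG HG' cG rG !binS2.
    by have := cardsUI H H'; move: cI cH cH'; card_lia.
  have := cardsUI (A :&: H) (A :&: H').
  rewrite -setIUr EG (setIidPl AG) setIACA setIid cA.
  have [k2|k2] : k = 2 \/ k = 3 by move: k1 k3; clear; lia.
    by move: leA leA'; rewrite k2 !binS2 !bin0n /=; card_lia.
  by move: leA leA'; rewrite k2 !binS2 !bin0n /=; card_lia.
apply/card_le1_eqP => A B; rewrite !in_setD1 => /and3P[nA' nA hA] /and3P[nB' nB hB].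
apply/eqP; apply: contraT => nBA; have nAB : A != B by rewrite eq_sym.
(* Two further hyperplanes would have 6 elements each and share at most 3, while both avoid the 2
   elements of [H :&: H']: at least 11 elements in a flat with 10. *)
have [dA k3'] := third A hA nA nA'; have [dB _] := third B hB nB nB'.
have [_ leAB _ _] := hyps_meet lG rG hA hB nAB.
have [fA AG rA cA] := large_hypsP rG hA.
have [fB BG rB cB] := large_hypsP rG hB.
have LG : H :&: H' \subset G by apply: subset_trans HG; apply: subsetIl.
have : #|(A :|: B) :|: (H :&: H')| <= #|G|.
  by apply: subset_leq_card; rewrite !subUset AG BG.
have cU := cardsUI (A :|: B) (H :&: H').
have := (leq_card_setU (A :&: (H :&: H')) (B :&: (H :&: H'))).1.
rewrite -setIUl; have := cardsUI A B.
by move: cI leAB dA dB cU; rewrite cG rG cA cB k3' !binS2 !bin0n /=; card_lia.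
Qed.

(** When all pairs meet in C(k+2,2) elements at the induction step, intersecting with one fixed [H]
    sends the others injectively to the large hyperplanes of [H]. Otherwise there are at most 3,
    which is below the bound, so equality also excludes that case. In rank 2 the flat [G] has 3
    elements and its large hyperplanes are singletons. *)
Lemma card_large_hyps k : forall G, large M G -> rk M G = k.+2 ->
  #|large_hyps G| <= k.+3 /\ (#|large_hyps G| = k.+3 -> forall H H', H \in large_hyps G ->
    H' \in large_hyps G -> H != H' -> #|H :&: H'| = 'C(k.+1, 2)).
Proof.
elim: k => [|k IHk] G lG rG; have [fG cG] := largeP _ lG.
  split; last first.
    move=> _ H H' hH hH' ne; have [_ le _ _] := hyps_meet lG rG hH hH' ne.
    by apply/eqP; rewrite -leqn0.
  suff sub : large_hyps G \subset [set A : {set T} | A \subset G & #|A| == 1].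
    by apply: leq_trans (subset_leq_card sub) _; rewrite cards_draws cG rG.
  apply/subsetP => H /(large_hypsP rG)[_ HG _ cH].
  by rewrite inE HG cH.
have [allm|] := boolP [forall H in large_hyps G, forall H' in large_hyps G,
    (H != H') ==> (#|H :&: H'| == 'C(k.+2, 2))]; last first.
  move=> /forall_inPn[H hH /forall_inPn[H' hH']]; rewrite negb_imply => /andP[ne /eqP nc].
  have le3 := hyps_cover lG rG isT hH hH' ne nc.
  split; first exact: leq_trans le3 _.
  by move=> E; rewrite E in le3.
have {}allm H H' : H \in large_hyps G -> H' \in large_hyps G -> H != H' ->
    #|H :&: H'| = 'C(k.+2, 2).
  by move=> hH hH' ne; have /forall_inP/(_ _ hH)/forall_inP/(_ _ hH') := allm;
    rewrite ne => /eqP.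
split=> //.
have [->|[H hH]] := set_0Vmem (large_hyps G); first by rewrite cards0.
have [fH HG rH cH] := large_hypsP rG hH.
have lH : large M H by move: hH; rewrite inE => /andP[].
have [leH _] := IHk H lH rH.
rewrite (cardsD1 H) hH add1n ltnS; apply: leq_trans leH.
(* If [A] and [B] had the same trace on [H], it would also be their mutual intersection, and the
   union of the three would have 3 C(m+1,2) - 2 C(m,2) elements with m = k+2, more than the C(m+2,2)
   of [G]. *)
have inj : {in large_hyps G :\ H &, injective (fun H' => H :&: H')}.
  move=> A B; rewrite !in_setD1 => /andP[nA hA] /andP[nB hB] EAB.
  apply/eqP; apply: contraT => nAB.
  have [fA AG rA cA] := large_hypsP rG hA.
  have [fB BG rB cB] := large_hypsP rG hB.
  rewrite eq_sym in nA; rewrite eq_sym in nB.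
  have cHA := allm _ _ hH hA nA; have cAB := allm _ _ hA hB nAB.
  have cHB := allm _ _ hH hB nB.
  have EA : H :&: A = A :&: B.
    by apply/eqP; rewrite eqEcard cHA cAB leqnn andbT subsetI subsetIr EAB subsetIr.
  have : #|H :|: A :|: B| <= #|G| by apply: subset_leq_card; rewrite !subUset HG AG.
  have := cardsUI (H :|: A) B; have := cardsUI H A.
  rewrite setIUl -EAB EA setUid cAB cG rG cH cA cB !binS2; card_lia.
rewrite -(card_in_imset inj); apply/subset_leq_card/subsetP => F /imsetP[A].
rewrite in_setD1 => /andP[nA hA] ->; rewrite eq_sym in nA.
have [_ _ _ inH] := hyps_meet lG rG hH hA nA.
by apply: inH; apply: allm.
Qed.

Definition flags_to k G :=
  [set F in large_flags M k | F ord_max == G].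

Lemma large_flagP k (F : {ffun 'I_k.+1 -> {set T}}) :
  reflect ((forall i, rk M (F i) = i /\ large M (F i)) /\
           (forall i j : 'I_k.+1, i < j -> F i \proper F j))
          (F \in large_flags M k).
Proof.
rewrite inE; apply: (iffP andP) => -[H1 H2]; split.
- by move=> i; have /forallP/(_ i)/andP[/eqP] := H1.
- by move=> i j ij; have /forallP/(_ i)/forallP/(_ j) := H2; rewrite ij.
- by apply/forallP => i; have [-> ->] := H1 i; rewrite eqxx.
- by apply/forallP => i; apply/forallP => j; apply/implyP/H2.
Qed.

(** The bijection is [ext], which appends [G] on top of a shorter flag, with inverse [res], which
    drops the top. *)
Lemma card_flags_to k G : large M G -> rk M G = k.+1 ->
  #|flags_to k.+1 G| = \sum_(H in large_hyps G) #|flags_to k H|.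
Proof.
move=> lG rG.
pose B := [set F in large_flags M k | F ord_max \in large_hyps G].
have -> : \sum_(H in large_hyps G) #|flags_to k H| = #|B|.
  rewrite -sum1_card (partition_big (fun F : {ffun 'I_k.+1 -> {set T}} => F ord_max)
    (mem (large_hyps G))) /=; last by move=> F; rewrite inE => /andP[].
  apply: eq_bigr => H hH; rewrite -sum1_card; apply: eq_bigl => F.
  rewrite in_set [in RHS]in_set.
  have [->|] := eqVneq (F ord_max) H; last by rewrite !andbF.
  by rewrite [H \in _]hH !andbT.
pose ext (F : {ffun 'I_k.+1 -> {set T}}) : {ffun 'I_k.+2 -> {set T}} :=
  [ffun i : 'I_k.+2 => if i < k.+1 then F (inord i) else G].
pose res (F : {ffun 'I_k.+2 -> {set T}}) : {ffun 'I_k.+1 -> {set T}} :=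
  [ffun i : 'I_k.+1 => F (widen_ord (leqnSn _) i)].
have extK : cancel ext res.
  move=> F; apply/ffunP => i; rewrite !ffunE /= ltn_ord; congr (F _).
  by apply: val_inj; rewrite /= inordK.
rewrite -(card_imset _ (can_inj extK)); apply: eq_card => F.
rewrite in_set; apply/andP/imsetP => [[/large_flagP[FL Fp] /eqP Ftop]|[F' F'B ->]].
  exists (res F); last first.
    apply/ffunP => i; rewrite !ffunE; case: ltnP => ik.
      by congr (F _); apply: val_inj; rewrite /= inordK.
    rewrite -Ftop; congr (F _); apply: val_inj; apply/eqP.
    by rewrite eqn_leq ik -ltnS ltn_ord.
  rewrite in_set; apply/andP; split.
    apply/large_flagP; split=> [i|i j ij]; rewrite !ffunE.
      by have := FL (widen_ord (leqnSn _) i).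
    exact: Fp.
  have -> : res F ord_max = F (widen_ord (leqnSn _) (@ord_max k)) by rewrite ffunE.
  rewrite inE; have [-> ->] := FL (widen_ord (leqnSn _) (@ord_max k)).
  rewrite -Ftop; have [-> _] := FL ord_max; rewrite eqxx andbT /=.
  by apply: proper_sub; apply: Fp.
move: F'B; rewrite in_set => /andP[/large_flagP[FL Fp] hTop].
have [fH HG rH cH] := large_hypsP rG hTop.
split; last by rewrite ffunE /= ltnn.
have HpG : F' ord_max \proper G.
  by rewrite properEneq HG andbT; apply/eqP => E; move: rH; rewrite E rG; clear; lia.
apply/large_flagP; split=> [i|i j ij]; rewrite !ffunE.
  case: ltnP => ik; first by have := FL (inord i); rewrite inordK.
  by rewrite rG; split=> //; have := ltn_ord i; move: ik; clear; lia.
case: (ltnP j k.+1) => jk.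
  by rewrite (ltn_trans ij jk); apply: Fp; rewrite !inordK ?(ltn_trans ij jk).
have ik : i < k.+1 by have := ltn_ord j; move: ij; clear; lia.
rewrite ik; apply: sub_proper_trans HpG.
have [ik'|ik'] := ltnP i k; first by apply: proper_sub; apply: Fp; rewrite inordK.
rewrite (_ : inord i = ord_max) //; apply: val_inj; rewrite /= inordK //; move: ik ik'; clear; lia.
Qed.

(** The product of the numbers of choices runs down to 3 in rank 2. In rank 1 the only large
    hyperplane is the empty set, so the factor 2 of the factorial is missing; this is the origin of
    the halving. *)
Lemma card_flags_to_le k : forall G, large M G -> rk M G = k.+1 ->
  #|flags_to k.+1 G| * 2 <= k.+2`!.
Proof.
elim: k => [|k IHk] G lG rG; rewrite card_flags_to //.
  have hyp0 H : H \in large_hyps G -> H = set0.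
    by move=> /(large_hypsP rG)[_ _ _ cH]; apply/eqP; rewrite -cards_eq0 cH.
  have fl1 H : #|flags_to 0 H| <= 1.
    apply/card_le1_eqP => F F'; rewrite !in_set => /andP[_ /eqP E] /andP[_ /eqP E'].
    by apply/ffunP => i; rewrite !ord1 -(ord1 ord_max) E E'.
  rewrite (_ : 2`! = 1 * 2) // leq_pmul2r //.
  have [->|[H hH]] := set_0Vmem (large_hyps G); first by rewrite big_set0.
  rewrite (big_pred1 H) // => H'; rewrite -topredE /=; apply/idP/eqP => [/hyp0 ->|-> //].
  by rewrite (hyp0 H hH).
have [le _] := card_large_hyps lG rG.
rewrite big_distrl /= factS.
apply: (@leq_trans (\sum_(H in large_hyps G) (k.+2)`!)).
  apply: leq_sum => H hH; have [_ _ rH _] := large_hypsP rG hH.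
  by apply: IHk => //; move: hH; rewrite inE => /andP[].
by rewrite sum_nat_const leq_mul2r le orbT.
Qed.

(** Each hyperplane carries at most half of [k.+2]! flags, so the total can be reached only with all
    k+3 hyperplanes present. *)
Lemma card_flags_to_eq k G : large M G -> rk M G = k.+2 ->
  #|flags_to k.+2 G| * 2 = k.+3`! -> #|large_hyps G| = k.+3.
Proof.
move=> lG rG E; have [le _] := card_large_hyps lG rG.
apply/eqP; rewrite eqn_leq le /= leqNgt; apply/negP => lt.
have : #|flags_to k.+2 G| * 2 <= #|large_hyps G| * k.+2`!.
  rewrite card_flags_to // big_distrl -sum_nat_const /=; apply: leq_sum => H hH.
  have [_ _ rH _] := large_hypsP rG hH.
  by apply: card_flags_to_le => //; move: hH; rewrite inE => /andP[].
rewrite E factS leqNgt ltn_mul2r fact_gt0 /= lt.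
by [].
Qed.

Lemma large_flags_top k : rank M = k -> large_flags M k = flags_to k [set: T].
Proof.
move=> rM; apply/setP => F; rewrite [RHS]in_set.
have [FF|//] := boolP (F \in large_flags M k); have /large_flagP[FL _] := FF.
have [rF /largeP[fF _]] := FL ord_max.
by rewrite (flat_eq fF (subsetT _)) ?eqxx // rF -/(rank M) rM.
Qed.

End LargeFlats.

(* Triangles of the complete graph are lines. *)
Definition triangular (T V : finType) (M : matroid T) (lab : T -> edge V) :=
  forall (u v w : V) (a b c : T), val (lab a) = [set u; v] ->
    val (lab b) = [set v; w] -> val (lab c) = [set u; w] ->
    c \in cl M [set a; b].

(** * Labelling the elements by pairs of hyperplanes in the case of equality *)

Section Labelling.
Variables (T : finType) (M : matroid T) (r : nat).
Hypotheses (rM : rank M = r.+2) (cT : #|T| = 'C(r.+3, 2)) (sM : simple M).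
Variable h : 'I_r.+3 -> {set T}.
Hypothesis fh : forall i, flat M (h i).
Hypothesis ch : forall i, #|h i| = 'C(r.+2, 2).
Hypothesis ch2 : forall i j, i != j -> #|h i :&: h j| = 'C(r.+1, 2).

(** In the complete graph [h i] would be the edges avoiding the vertex [i], so this set should be
    the pair of ends of [x]. *)
Let stars x := [set i | x \notin h i].

(* Writing d x for the number of complements of hyperplanes containing x,
   double counting gives the sum of (d x - 2)^2 over all x equal to 0. *)
Lemma card_stars x : #|stars x| = 2.
Proof.
pose d x := \sum_i (x \notin h i : nat).
have dE y : #|stars y| = d y.
  rewrite -sum1_card big_mkcond; apply: eq_bigr => i _.
  by rewrite inE; case: (y \in h i).
have cC i : #|~: h i| = r.+2.
  by have := cardsC (h i); rewrite ch cT (binS2 r.+2); card_lia.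
(* This is the second difference C(r+3,2) - 2 C(r+2,2) + C(r+1,2) = 1: two vertices span one
   edge. *)
have cI i j : i != j -> #|~: h i :&: ~: h j| = 1.
  move=> ij; rewrite -setCU; have := cardsC (h i :|: h j).
  have := cardsUI (h i) (h j); rewrite !ch ch2 // cT !binS2; card_lia.
have s1 : \sum_y d y = r.+3 * r.+2.
  rewrite exchange_big /=.
  transitivity (\sum_(i < r.+3) r.+2); last by rewrite sum_nat_const card_ord.
  apply: eq_bigr => i _; rewrite -(cC i) -sum1_card [RHS]big_mkcond.
  by apply: eq_bigr => y _; rewrite inE; case: (y \in h i).
have s2 : \sum_y d y * d y = r.+3 * (r.+2 + r.+2).
  transitivity (\sum_i \sum_j #|~: h i :&: ~: h j|).
    under eq_bigr => y _ do rewrite big_distrl.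
    rewrite exchange_big /=; apply: eq_bigr => i _.
    under eq_bigr => y _ do rewrite big_distrr.
    rewrite exchange_big /=; apply: eq_bigr => j _.
    rewrite -sum1_card [RHS]big_mkcond; apply: eq_bigr => y _.
    by rewrite !inE; case: (y \in h i); case: (y \in h j).
  transitivity (\sum_(i < r.+3) (r.+2 + r.+2)); last by rewrite sum_nat_const card_ord.
  apply: eq_bigr => i _.
  rewrite (bigD1 i) //= setIid cC; congr (_ + _).
  rewrite (eq_bigr (fun=> 1)); last by move=> j ji; rewrite cI // eq_sym.
  by rewrite sum1_card cardC1 card_ord.
(* This is (d - 2)^2 >= 0 with its equality case, in a form free of subtraction. *)
have agm y : 4 * d y <= d y * d y + 4 ?= iff (d y == 2).
  case: (d y) => [|[|e]] //; have -> : e.+2 * e.+2 + 4 = 4 * e.+2 + e * e by clear; lia.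
  split; first exact: leq_addr.
  by case: e => [|e]; [rewrite addn0 eqxx | clear; lia].
have [_] : \sum_y 4 * d y <= \sum_y (d y * d y + 4) ?= iff [forall y, d y == 2].
  by apply: leqif_sum => y _; apply: agm.
have -> : \sum_y 4 * d y = 4 * (r.+3 * r.+2) by rewrite -s1 big_distrr.
have -> : \sum_y (d y * d y + 4) = r.+3 * (r.+2 + r.+2) + 'C(r.+3, 2) * 4.
  by rewrite -s2 -cT -sum_nat_const -big_split.
have -> : 4 * (r.+3 * r.+2) == r.+3 * (r.+2 + r.+2) + 'C(r.+3, 2) * 4.
  have := bin2_double r.+2; card_lia.
by move=> /esym/forallP/(_ x)/eqP; rewrite dE.
Qed.

Let lab x : edge 'I_r.+3 := exist _ (stars x) (introT eqP (card_stars x)).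

(** Two elements with the same label would both lie in the complements of the same two hyperplanes,
    which share a single element; surjectivity follows by counting. *)
Lemma lab_bij : bijective lab.
Proof.
apply: inj_card_bij; last by rewrite card_edge cT.
move=> x y /(congr1 val) /= E.
have /eqP/cards2P[i [j [ij Ex]]] := card_stars x.
have : #|~: h i :&: ~: h j| <= 1.
  rewrite -setCU; have := cardsC (h i :|: h j).
  have := cardsUI (h i) (h j); rewrite !ch ch2 // cT !binS2; card_lia.
have xs k : k \in stars x -> x \in ~: h k by rewrite !inE.
have ys k : k \in stars x -> y \in ~: h k by rewrite E !inE.
move=> /card_le1_eqP; apply; rewrite in_setI ?xs ?ys //= Ex ?inE ?eqxx ?orbT //.
Qed.

(** Every new hyperplane lowers the rank: for [i] in [A] and some [j] outside [A], the element
    labelled by [i] and [j] lies in all the other hyperplanes of [A] but not in [h i]. The bound on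
    [#|A|] provides such a [j]. *)
Lemma rk_bigcap (A : {set 'I_r.+3}) : #|A| <= r.+1 ->
  flat M (\bigcap_(i in A) h i) /\ rk M (\bigcap_(i in A) h i) + #|A| <= r.+2.
Proof.
have [m] := ubnP #|A|; elim: m A => // m IHm A ltm leA.
have [->|[i iA]] := set_0Vmem A.
  by rewrite big_set0 cards0 addn0 flatT -rM rkS ?subsetT.
have cA := cardsD1 i A; rewrite iA add1n in cA.
have [||fB rB] := IHm (A :\ i); [by rewrite -cA|by rewrite -ltnS -cA leqW|].
rewrite (big_setD1 i) //=; split; first exact: flatI.
rewrite cA addnS; apply: leq_trans rB; rewrite -addSn leq_add2r.
apply: flat_rk_lt; first exact: flatI.
have /subsetPn[j _ jA] : ~~ ([set: 'I_r.+3] \subset A).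
  by apply: contraL leA => /subset_leq_card; rewrite cardsT card_ord; card_lia.
have ij : i != j by apply: contraNneq jA => <-.
have [x xE] : exists x, val (lab x) = [set i; j].
  have [g _ labK] := lab_bij.
  have c2 : #|[set i; j]| == 2 by rewrite cards2 ij.
  by exists (g (exist _ [set i; j] c2)); rewrite labK.
have {}xE k : (x \notin h k) = (k == i) || (k == j).
  by have := congr1 (fun s : {set _} => k \in s) xE; rewrite !inE.
rewrite properE subsetIr /=; apply/subsetPn; exists x.
  apply/bigcapP => k; rewrite !inE => /andP[ki kA].
  apply: contraT; rewrite xE (negPf ki) /= => /eqP kj.
  by rewrite -kj kA in jA.
by rewrite inE negb_and xE eqxx.
Qed.

Lemma lab_triangular : triangular M lab.
Proof.
move=> u v w a b c /= Ea Eb Ec.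
have uv : u != v by have := card_stars a; rewrite Ea cards2; case: eqP.
have vw : v != w by have := card_stars b; rewrite Eb cards2; case: eqP.
have uw : u != w by have := card_stars c; rewrite Ec cards2; case: eqP.
have ab : a != b.
  apply/eqP => E; have := congr1 (fun s : {set _} => u \in s) Ea.
  by rewrite E Eb !inE eqxx (negPf uv) (negPf uw).
(* The [r] hyperplanes outside the triangle all contain [a], [b] and [c], and their intersection has
   rank at most 2, which [a] and [b] already reach. *)
pose A := ~: [set u; v; w].
have cA : #|A| = r.
  have := cardsC [set u; v; w]; rewrite -/A card_ord.
  rewrite -setUA cardsU1 !inE negb_or uv uw cards2 vw.
  by rewrite !addSn => -[].
have leA : #|A| <= r.+1 by rewrite cA.
have [_ rA] := rk_bigcap leA.
have abcA : c |: [set a; b] \subset \bigcap_(i in A) h i.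
  apply/subsetP => x xabc; apply/bigcapP => i; rewrite !inE !negb_or.
  move=> /andP[/andP[iu iv] iw]; apply: contraT => xi.
  have : i \in stars x by rewrite inE.
  move: xabc; rewrite !inE => /or3P[]/eqP ->; [move: Ec | move: Ea | move: Eb];
    by move=> /setP/(_ i); rewrite !inE ?(negPf iu) ?(negPf iv) ?(negPf iw) => ->.
apply/clP/eqP; rewrite eqn_leq (rkS _ (subsetUr _ _)) andbT (simple_rk2 sM) //.
by apply: leq_trans (rkS M abcA) _; move: rA; rewrite cA -[r.+2]/(2 + r) leq_add2r.
Qed.

End Labelling.

(** * Matroids labelled by the edges of a complete graph *)

Lemma rk_bigcup (T I : finType) (M : matroid T) (P : {set I}) (F : I -> {set T}) :
  rk M (\bigcup_(i in P) F i) <= \sum_(i in P) rk M (F i).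
Proof.
elim/big_rec2: _ => [|i n A _ le]; first by rewrite rk0.
by apply: leq_trans (rkU _ _ _) _; rewrite leq_add2l.
Qed.

Section Triangular.
Variables (T V : finType) (M : matroid T) (lab : T -> edge V).
Hypotheses (lab_bij : bijective lab) (triM : triangular M lab).
Implicit Types (A B : {set T}) (N U : {set V}) (u v w : V) (a b c : T).

Lemma lab_ex u v : u != v -> exists a, val (lab a) = [set u; v].
Proof.
move=> uv; have c2 : #|[set u; v]| == 2 by rewrite cards2 uv.
by have [g _ labK] := lab_bij; exists (g (exist _ [set u; v] c2)); rewrite labK.
Qed.

Lemma val_lab_inj : injective (val \o lab).
Proof. by apply: inj_comp; [exact: val_inj|exact: bij_inj]. Qed.

Lemma lab_ends a : exists u v, u != v /\ val (lab a) = [set u; v].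
Proof. exact: edge_ends. Qed.

Lemma adj_labP A u v :
  reflect (exists2 a, a \in A & val (lab a) = [set u; v]) (adj (lab @: A) u v).
Proof.
apply: (iffP (adjP _ _ _)) => [[_ /imsetP[a aA ->]]|[a aA E]]; first by exists a.
by exists (lab a); rewrite ?imset_f.
Qed.

Lemma triangular_flat F u v w a b c : flat M F -> a \in F -> b \in F ->
  val (lab a) = [set u; v] -> val (lab b) = [set v; w] ->
  val (lab c) = [set u; w] -> c \in F.
Proof.
move=> fF aF bF Ea Eb Ec; apply: (subsetP (cl_sub_flat fF _) _ (triM Ea Eb Ec)).
by rewrite subUset !sub1set aF.
Qed.

(** Along the path, triangles replace two consecutive edges by a chord, until only the edge from [u]
    to [v] is left. *)
Lemma connect_cl A u v a : connect (adj (lab @: A)) u v ->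
  val (lab a) = [set u; v] -> a \in cl M A.
Proof.
case/connectP => p; elim: p u a => [|w p IHp] u a /=.
  by move=> _ -> /edge_neq; rewrite eqxx.
case/andP => /adj_labP[b bA Eb] pw Ev Ea.
have bcl := subsetP (sub_cl M A) _ bA.
have [wv|wv] := eqVneq w v.
  by rewrite (_ : a = b) //; apply: val_lab_inj; rewrite /= Ea Eb wv.
have [c Ec] := lab_ex wv.
exact: (triangular_flat (cl_flat M A) bcl (IHp _ _ pw Ev Ec) Eb Ec).
Qed.

Definition star N (f : V -> V) := \bigcup_(v in N) [set a | val (lab a) == [set v; f v]].

Lemma rk_star N f : rk M (star N f) <= #|N|.
Proof.
apply: leq_trans (rk_bigcup _ _ _) _; rewrite -sum1_card; apply: leq_sum => v _.
apply: leq_trans (rk_le_card _ _) _; apply/card_le1_eqP => a b.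
by rewrite !inE => /eqP Ea /eqP Eb; apply: val_lab_inj; rewrite /= Ea Eb.
Qed.

Lemma star_mem N f v a : v \in N -> val (lab a) = [set v; f v] -> a \in star N f.
Proof. by move=> vN E; apply/bigcupP; exists v; rewrite // inE E. Qed.

(** Every edge away from [v0] closes a triangle with two edges at [v0]. *)
Lemma star_span A v0 :
  (forall v a, val (lab a) = [set v; v0] -> a \in cl M A) -> rk M A = rank M.
Proof.
move=> H; rewrite -rk_cl (_ : cl M A = setT) //; apply/setP => c; rewrite [RHS]inE.
have [u [w [uw Ec]]] := lab_ends c.
have [E|u0] := eqVneq u v0; first by apply: (H w); rewrite Ec E setUC.
have [E|w0] := eqVneq w v0; first by apply: (H u); rewrite Ec E.
have [a Ea] := lab_ex u0; have [b Eb] := lab_ex w0; rewrite setUC in Eb.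
apply: (triangular_flat (cl_flat M A) (H _ _ Ea) _ Ea Eb Ec).
by apply: (H w); rewrite Eb setUC.
Qed.

Lemma rank_triangular_le (v0 : V) : (rank M).+1 <= #|V|.
Proof.
have le := rk_star (setT :\ v0) (fun=> v0).
rewrite -cardsT (cardsD1 v0) inE ltnS; apply: leq_trans le.
rewrite (@star_span _ v0) // => v a E; apply: (subsetP (sub_cl _ _)).
by apply: (star_mem _ E); rewrite !inE andbT (edge_neq E).
Qed.

Hypothesis rM : (rank M).+1 = #|V|.

(** With one root in each component, the cardinal of this set is the number of vertices minus the
    number of components, the graphic rank of [A]. *)
Definition nonroots A := [set v | fingraph.root (adj (lab @: A)) v != v].

Let csym A : connect_sym (adj (lab @: A)).
Proof. by apply: sym_connect_sym; apply: adjC. Qed.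

(** Upper bound: the forest joining each vertex to its root spans [A]. Lower bound: joining all
    other roots to one root [r0] makes [A] spanning, and this adds at most the number of components
    minus one to the rank, while the full rank is [#|V|.-1]. *)
Lemma rk_triangular A : rk M A = #|nonroots A|.
Proof.
set N := nonroots A; pose rt := fingraph.root (adj (lab @: A)).
apply/eqP; rewrite eqn_leq; apply/andP; split.
  apply: leq_trans (rk_star N rt); rewrite -[leqRHS]rk_cl; apply: rkS.
  apply/subsetP => c cA; have [u [v [uv Ec]]] := lab_ends c.
  have Er : rt u = rt v.
    apply/eqP; rewrite root_connect //; apply: connect1.
    by apply/adj_labP; exists c.
  have memS w a : rt w != w -> val (lab a) = [set w; rt w] -> a \in cl M (star N rt).
    move=> wN E; apply: (subsetP (sub_cl _ _)).
    by apply: (star_mem _ E); rewrite inE.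
  have [Eu|nu] := eqVneq (rt u) u.
    by apply: (memS v); rewrite -Er Eu // Ec setUC.
  have [Ev|nv] := eqVneq (rt v) v.
    by apply: (memS u); rewrite // Er Ev Ec.
  have /lab_ex[a Ea] : u != rt u by rewrite eq_sym.
  have /lab_ex[b Eb] : v != rt v by rewrite eq_sym.
  rewrite -Er setUC in Eb.
  apply: (triangular_flat (cl_flat _ _) (memS u a nu Ea) (memS v b nv _) Ea Eb Ec).
  by rewrite Eb Er setUC.
have [->|[v0 v0N]] := set_0Vmem N; first by rewrite cards0.
pose r0 := rt v0.
have r0N : r0 \notin N by rewrite inE /r0 /rt root_root // eqxx.
have /esym/eqP : rk M (A :|: star (~: N :\ r0) (fun=> r0)) = rank M.
  apply: (@star_span _ r0) => v a Ea; have vr0 := edge_neq Ea.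
  have fC := cl_flat M (A :|: star (~: N :\ r0) (fun=> r0)).
  have starC w c : w \notin N -> val (lab c) = [set w; r0] ->
      c \in cl M (A :|: star (~: N :\ r0) (fun=> r0)).
    move=> wN Ec; apply: (subsetP (sub_cl _ _)); rewrite inE; apply/orP; right.
    by apply: (star_mem _ Ec); rewrite !inE (edge_neq Ec) /=; move: wN; rewrite inE.
  have [vN|vN] := boolP (v \in N); last exact: starC Ea.
  have clA c w : connect (adj (lab @: A)) v w -> val (lab c) = [set v; w] ->
      c \in cl M (A :|: star (~: N :\ r0) (fun=> r0)).
    move=> vw Ec; apply: (subsetP (cl_mono _ (subsetUl _ _))).
    exact: connect_cl vw Ec.
  have [E|ne] := eqVneq (rt v) r0.
    by apply: clA Ea; rewrite -E connect_root.
  have [b Eb] := lab_ex ne.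
  have nv : v != rt v by move: vN; rewrite inE eq_sym.
  have [c Ec] := lab_ex nv.
  apply: (triangular_flat fC (clA _ _ (connect_root _ _) Ec) _ Ec Eb Ea).
  by apply: starC Eb; rewrite inE /rt root_root // eqxx.
move/eqP; have := rkU M A (star (~: N :\ r0) (fun=> r0)).
have := rk_star (~: N :\ r0) (fun=> r0).
have := cardsD1 r0 (~: N); rewrite in_setC r0N.
have := cardsC N; rewrite -rM.
move: (rank M) (rk M A) (rk M (_ :|: _)) (rk M (star _ _)) #|N| #|~: N| #|_ :\ _|.
by clear; lia.
Qed.

(** The ends of an edge of [A] share their root, so at most one of them is a root, and in that case
    it is recovered from the other end. Elements of [A] are thus encoded by subsets of [nonroots A]
    of size 1 or 2, which bounds their number. *)
Lemma trace_edge A a (S := val (lab a) :&: nonroots A) : a \in A ->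
  [/\ S \subset nonroots A, (#|S| == 1) || (#|S| == 2) &
   val (lab a) = if #|S| == 2 then S else S :|: fingraph.root (adj (lab @: A)) @: S].
Proof.
move=> aA; rewrite /S subsetIr; have [u [v [uv Ea]]] := lab_ends a.
set N := nonroots A; pose rt := fingraph.root (adj (lab @: A)).
have Er : rt u = rt v.
  apply/eqP; rewrite root_connect //; apply: connect1.
  by apply/adj_labP; exists a.
rewrite Ea.
have [uN|uN] := boolP (u \in N); have [vN|vN] := boolP (v \in N).
- have -> : [set u; v] :&: N = [set u; v].
    by apply/setIidPl; rewrite subUset !sub1set uN.
  by rewrite cards2 uv.
- have -> : [set u; v] :&: N = [set u].
    apply/setP => x; rewrite in_setI in_set2 in_set1.
    have [->|_] := eqVneq x u => //=.
    by case: eqP => //= ->; apply/negbTE.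
  rewrite cards1 imset_set1; split=> //=; rewrite -/rt Er.
  by move: vN; rewrite inE negbK -/rt => /eqP ->.
- have -> : [set u; v] :&: N = [set v].
    apply/setP => x; rewrite in_setI in_set2 in_set1.
    have [->|_] /= := eqVneq x v; first by rewrite orbT.
    by rewrite orbF; case: eqP => //= ->; apply/negbTE.
  rewrite cards1 imset_set1; split=> //=; rewrite -/rt -Er setUC.
  by move: uN; rewrite inE negbK -/rt => /eqP ->.
- move: uN vN; rewrite !inE !negbK => /eqP Eu /eqP Ev.
  by case/eqP: uv; rewrite -Eu -/(rt u) Er.
Qed.

Let traces A := [set val (lab a) :&: nonroots A | a in A].
Let draws A k := [set S : {set V} | S \subset nonroots A & #|S| == k].

Lemma card_traces A : #|traces A| = #|A|.
Proof.
apply: card_in_imset => a b aA bA E; apply: val_lab_inj => /=.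
by have [_ _ ->] := trace_edge aA; have [_ _ ->] := trace_edge bA; rewrite E.
Qed.

Lemma traces_sub A : traces A \subset draws A 1 :|: draws A 2.
Proof.
apply/subsetP => S /imsetP[a aA ->]; have [sN c12 _] := trace_edge aA.
by rewrite !inE sN.
Qed.

Lemma card_le_triangular A : #|A| <= 'C((rk M A).+1, 2).
Proof.
rewrite -card_traces; apply: leq_trans (subset_leq_card (traces_sub A)) _.
apply: leq_trans (leq_card_setU _ _).1 _.
by rewrite !cards_draws rk_triangular binS2 bin1 addnC.
Qed.

Lemma edge_root_mem A S : flat M A -> S \in draws A 1 -> S \in traces A.
Proof.
move=> fA; rewrite inE => /andP[SN /cards1P[u Su]].
have uN : fingraph.root (adj (lab @: A)) u != u by move: SN; rewrite Su sub1set inE.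
have /lab_ex[a Ea] : u != fingraph.root (adj (lab @: A)) u by rewrite eq_sym.
apply/imsetP; exists a.
  by rewrite -(flat_cl fA); apply: (connect_cl _ Ea); apply: connect_root.
rewrite Ea Su; apply/setP => x; rewrite !inE.
have [->|xu] /= := eqVneq x u; first by rewrite uN.
by case: eqP => //= ->; rewrite root_root ?eqxx.
Qed.

(** Let k be the rank of [F]. If all non-roots are connected to each other, all k singletons and
    C(k,2) pairs are traces. Otherwise at least k-1 pairs join different components and are not
    traces, which leaves at most k + C(k,2) - (k-1) elements. *)
Lemma good_triangular : good M.
Proof.
move=> F fF; rewrite rk_triangular; set N := nonroots F.
pose con := connect (adj (lab @: F)).
have [allc|] := boolP [forall u in N, forall v in N, con u v].
  left; apply/eqP; rewrite -rk_triangular eqn_leq card_le_triangular /=.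
  rewrite -card_traces rk_triangular binS2 -/N.
  have -> : 'C(#|N|, 2) + #|N| = #|draws F 1 :|: draws F 2|.
    rewrite cardsU !cards_draws bin1 (_ : _ :&: _ = set0) ?cards0 ?subn0 1?addnC //.
    by apply/setP => S; rewrite !inE; case: eqP => [->|]; rewrite ?andbF.
  apply: subset_leq_card; apply/subsetP => S; rewrite in_setU => /orP[|].
    exact: edge_root_mem.
  rewrite inE => /andP[SN /cards2P[u [v [uv ES]]]].
  move: SN; rewrite ES subUset !sub1set => /andP[uN vN].
  have [a Ea] := lab_ex uv; apply/imsetP; exists a; last first.
    by rewrite Ea; apply/esym/setIidPl; rewrite subUset !sub1set uN.
  rewrite -(flat_cl fF); apply: (connect_cl _ Ea).
  by have /forall_inP/(_ _ uN)/forall_inP/(_ _ vN) := allc.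
case/forall_inPn => u uN /forall_inPn[v vN nuv]; right.
have i0 : 0 < #|N| by apply/card_gt0P; exists u.
split=> //.
(* Given non-roots [u] and [v] in different components, every other non-root [w] is paired with
   whichever of the two it is not connected to ([v] itself is paired with [u]); this produces the
   k-1 missing pairs. *)
pose g w := if con u w then [set w; v] else [set w; u].
have uv : u != v by apply: contraNneq nuv => ->; apply: connect0.
have gconn w x y : w \in N :\ u -> g w = [set x; y] -> ~~ con x y.
  rewrite in_setD1 => /andP[wu wN] E.
  have conW : exists z, [/\ g w = [set w; z] & ~~ con w z].
    rewrite /g; case: ifPn => uw; [exists v|exists u]; split=> //.
      by apply: contra nuv; apply: connect_trans.
    by rewrite /con csym.
  have [z [Ez nwz]] := conW; move: E; rewrite Ez => /setP E.
  have wz : w != z by apply: contraNneq nwz => ->; apply: connect0.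
  have := E w; have := E z; have := E x; have := E y.
  rewrite !inE !eqxx ?orbT /= => /orP[]/eqP -> /orP[]/eqP ->.
  - by rewrite (eq_sym z w) (negPf wz).
  - by rewrite /con csym.
  - by [].
  - by rewrite (negPf wz).
have g2 w : w \in N :\ u -> #|g w| = 2.
  rewrite in_setD1 => /andP[wu wN]; rewrite /g; case: ifPn => uw; rewrite cards2.
    by rewrite (_ : w != v) //; apply: contraNneq nuv => <-.
  by rewrite wu.
have ginj : {in N :\ u &, injective g}.
  move=> w w'; rewrite !in_setD1 => /andP[wu _] /andP[wu' _]; rewrite /g.
  case: ifPn => uw; case: ifPn => uw' /setP E.
  - have /esym := E w; rewrite !inE eqxx => /orP[/eqP //|/eqP Ev].
    by rewrite -Ev uw in nuv.
  - have := E u; rewrite !inE eqxx orbT => /orP[]; first by rewrite eq_sym (negPf wu).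
    by rewrite (negPf uv).
  - have := E u; rewrite !inE eqxx orbT => /esym/orP[]; first by rewrite eq_sym (negPf wu').
    by rewrite (negPf uv).
  - by have := E w; rewrite !inE eqxx (negPf wu) !orbF => /esym/eqP.
have gD : g @: (N :\ u) \subset draws F 2.
  apply/subsetP => S /imsetP[w wNu ->]; rewrite inE g2 // eqxx andbT /g.
  by move: wNu; rewrite in_setD1 => /andP[_ wN]; case: ifP => _;
    rewrite subUset !sub1set wN ?uN ?vN.
have disj : traces F \subset draws F 1 :|: (draws F 2 :\: g @: (N :\ u)).
  apply/subsetP => S SF; have /setUP[S1|S2] := subsetP (traces_sub F) S SF.
    by rewrite in_setU S1.
  rewrite in_setU in_setD S2 andbT; apply/orP; right; apply/imsetP => -[w wNu Eg].
  have {SF}/imsetP[a aF ES] := SF.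
  have [_ _] := trace_edge aF; rewrite -ES.
  move: S2; rewrite inE => /andP[_ S2]; rewrite S2 => EaS.
  have [x [y [_ Exy]]] := lab_ends a.
  have /negP[] : ~~ con x y by apply: (gconn w); rewrite // -Eg -EaS.
  by apply: connect1; apply/adj_labP; exists a.
rewrite -card_traces; apply: leq_trans (subset_leq_card disj) _.
apply: leq_trans (leq_card_setU _ _).1 _.
rewrite cardsD (setIidPr gD) (card_in_imset ginj) !cards_draws bin1 -/N.
have := cardsD1 u N; rewrite uN => cN.
have : #|N :\ u| <= 'C(#|N|, 2).
  by rewrite -(card_in_imset ginj) -cards_draws; apply: subset_leq_card.
move: cN; generalize 'C(#|N|, 2) #|N| #|N :\ u|; clear; lia.
Qed.

Definition clique U := [set a | val (lab a) \subset U].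

Lemma card_clique U : #|clique U| = 'C(#|U|, 2).
Proof.
rewrite -cards_draws -(card_imset _ val_lab_inj); apply: eq_card => S.
rewrite inE; apply/imsetP/andP => [[a aU ->]|[SU /cards2P[u [v [uv ES]]]]].
  by split; [rewrite inE in aU|exact: (valP (lab a))].
have [a Ea] := lab_ex uv; exists a; last by rewrite /= Ea ES.
by rewrite inE Ea -ES.
Qed.

(** A star inside [U] spans the clique, and adding one edge to [u0] for each vertex outside [U]
    spans everything. *)
Lemma rk_clique U : U != set0 -> (rk M (clique U)).+1 = #|U|.
Proof.
case/set0Pn => u0 u0U; apply/eqP; rewrite eqn_leq; apply/andP; split.
  rewrite (cardsD1 u0) u0U ltnS; apply: leq_trans (rk_star _ (fun=> u0)).
  rewrite -[leqRHS]rk_cl; apply: rkS; apply/subsetP => c; rewrite inE.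
  have [u [v [uv Ec]]] := lab_ends c; rewrite Ec subUset !sub1set => /andP[uU vU].
  have memS w a : w \in U -> val (lab a) = [set w; u0] ->
      a \in cl M (star (U :\ u0) (fun=> u0)).
    move=> wU E; apply: (subsetP (sub_cl _ _)); apply: (star_mem _ E).
    by rewrite in_setD1 wU (edge_neq E).
  have [E|un] := eqVneq u u0; first by apply: (memS v); rewrite // Ec E setUC.
  have [E|vn] := eqVneq v u0; first by apply: (memS u); rewrite // Ec E.
  have [a Ea] := lab_ex un; have [b Eb] := lab_ex vn; rewrite setUC in Eb.
  apply: (triangular_flat (cl_flat _ _) (memS u a uU Ea) (memS v b vU _) Ea Eb Ec).
  by rewrite Eb setUC.
have := rkU M (clique U) (star (~: U) (fun=> u0)).
rewrite (@star_span _ u0) => [|v a Ea]; last first.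
  apply: (subsetP (sub_cl _ _)); rewrite inE; have [vU|vU] := boolP (v \in U).
    by rewrite inE Ea subUset !sub1set vU u0U.
  by apply/orP; right; apply: (star_mem _ Ea); rewrite inE.
have := rk_star (~: U) (fun=> u0); have := cardsC U; rewrite -rM.
move: (rank M) => q; card_lia.
Qed.

(** Flatness is obtained by counting: the closure has the same rank, hence no room for further
    elements. *)
Lemma large_clique U : U != set0 -> large M (clique U).
Proof.
move=> U0; have rU := rk_clique U0; rewrite /large rU card_clique eqxx andbT.
suff -> : clique U = cl M (clique U) by apply: cl_flat.
apply/eqP; rewrite eqEcard sub_cl /= card_clique -rU -rk_cl.
exact: card_le_triangular.
Qed.

Lemma clique_sub U U' : 1 < #|U| -> clique U \subset clique U' -> U \subset U'.
Proof.
move=> U1 sub; apply/subsetP => u uU.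
have /set0Pn[v] : U :\ u != set0.
  by rewrite -card_gt0; move: U1; rewrite (cardsD1 u) uU.
rewrite in_setD1 => /andP[vu vU]; have [a Ea] := lab_ex vu.
have /(subsetP sub) : a \in clique U by rewrite inE Ea subUset !sub1set vU uU.
by rewrite inE Ea subUset !sub1set => /andP[].
Qed.

(** Deleting vertices of [U] one at a time gives large flags of cliques. The choice among the last
    two vertices is lost, since a single vertex spans no edge, whence the factor 2. *)
Lemma card_flags_clique k : forall U, #|U| = k.+2 ->
  k.+2`! <= #|flags_to M k.+1 (clique U)| * 2.
Proof.
have cardD U u : u \in U -> #|U :\ u| = #|U|.-1 by move=> uU; rewrite (cardsD1 u U) uU.
have hypU j U u : #|U| = j.+2 -> u \in U -> clique (U :\ u) \in large_hyps M (clique U).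
  move=> cU uU; have cD := cardD U u uU; rewrite cU /= in cD.
  have U0 : U != set0 by rewrite -card_gt0 cU.
  have D0 : U :\ u != set0 by rewrite -card_gt0 cD.
  rewrite inE large_clique //= -eqSS !rk_clique // cU cD eqxx andbT.
  apply/subsetP => a; rewrite !inE.
  by move/subset_trans; apply; apply: subD1set.
have rkU k' U : #|U| = k'.+1 -> rk M (clique U) = k' /\ large M (clique U).
  move=> cU; have U0 : U != set0 by rewrite -card_gt0 cU.
  by split; [have := rk_clique U0; rewrite cU => -[]|apply: large_clique].
elim: k => [|k IHk] U cU.
  have [rU lU] := rkU _ _ cU; rewrite (card_flags_to lU rU) (_ : 2`! = 1 * 2) // leq_pmul2r //.
  have /card_gt0P[u uU] : 0 < #|U| by rewrite cU.
  have hH := hypU _ _ _ cU uU; rewrite (bigD1 _ hH) /=.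
  have cD := cardD U u uU; rewrite cU /= in cD.
  have [rD lD] := rkU _ _ cD.
  apply: ltn_addr; apply/card_gt0P; exists [ffun=> clique (U :\ u)].
  rewrite in_set ffunE eqxx andbT; apply/large_flagP; split=> [i|i j].
    by rewrite ffunE rD lD ord1.
  by rewrite !ord1.
have [rU lU] := rkU _ _ cU; rewrite (card_flags_to lU rU).
have inj : {in U &, injective (fun u => clique (U :\ u))}.
  move=> u v uU vU E; apply/eqP; apply: contraT => uv.
  have cD := cardD U u uU; rewrite cU /= in cD.
  have : U :\ u \subset U :\ v by apply: clique_sub; rewrite ?cD // E.
  by move=> /subsetP/(_ v); rewrite !in_setD1 eqxx eq_sym uv vU => /(_ isT).
have sub : [set clique (U :\ u) | u in U] \subset large_hyps M (clique U).
  by apply/subsetP => H /imsetP[u uU ->]; apply: hypU cU uU.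
rewrite (big_setID [set clique (U :\ u) | u in U]) /= (setIidPr sub) big_imset //=.
rewrite mulnDl; apply: leq_trans (leq_addr _ _).
rewrite factS -cU -sum_nat_const big_distrl /=; apply: leq_sum => u uU.
have cD := cardD U u uU; rewrite cU /= in cD.
exact: IHk.
Qed.

Lemma card_large_flags_triangular k : #|V| = k.+2 ->
  k.+2`! <= #|large_flags M k.+1| * 2.
Proof.
move=> cV; have rk1 : rank M = k.+1 by move: rM; rewrite cV => -[].
rewrite (large_flags_top rk1) (_ : setT = clique setT).
  by apply: card_flags_clique; rewrite cardsT.
by apply/setP => a; rewrite !inE subsetT.
Qed.

End Triangular.

(** * The cycle matroid of a complete graph is triangular *)

Section CompleteGraphMatroid.
Variable V : finType.
Implicit Types (A : {set edge V}) (v : V).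

Lemma cycle_indepP A : reflect (acyclic A) (A \in indep (cycle_matroid_complete V)).
Proof. by rewrite inE; apply: asboolP. Qed.

(** Three consecutive edges of a cycle, even of a triangle, have no common vertex. *)
Lemma acyclic_star A v : (forall e, e \in A -> v \in val e) -> acyclic A.
Proof.
move=> H; have adjv x y : adj A x y -> (v == x) || (v == y).
  by case/adjP => e /H ve E; move: ve; rewrite E !inE.
case=> [|x [|y [|z p]]] // _ /andP[/= /and3P[/adjv xy /adjv yz pz]].
rewrite !inE !negb_or => /andP[/and3P[nxy nxz nxp] /andP[/andP[nyz nyp] _]].
have vy : v = y.
  case/orP: xy => /eqP // vx; case/orP: yz => /eqP // vz.
  by rewrite -vx -vz eqxx in nxz.
have [t [zt ty]] : exists t, (v == z) || (v == t) /\ t != y.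
  case: p pz nxp nyp => [|t p] /= /andP[/adjv zt _] _ nyp; first by exists x.
  by exists t; split=> //; move: nyp; rewrite inE negb_or eq_sym => /andP[].
move: zt; rewrite vy (negPf nyz) /= eq_sym (negPf ty) //.
Qed.

Lemma cycle_triangular : triangular (cycle_matroid_complete V) id.
Proof.
move=> u v w a b c Ea Eb Ec.
have [cab|cab] := boolP (c \in [set a; b]); first exact: (subsetP (sub_cl _ _)).
have iab : [set a; b] \in indep (cycle_matroid_complete V).
  apply/cycle_indepP/(@acyclic_star _ v) => e; rewrite !inE => /orP[]/eqP ->.
    by rewrite Ea !inE eqxx orbT.
  by rewrite Eb !inE eqxx.
apply/clP/eqP; rewrite eqn_leq (rkS _ (subsetUr _ _)) andbT.
move: (iab); rewrite indepE => /eqP ->.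
have uv := edge_neq Ea; have vw := edge_neq Eb; have uw := edge_neq Ec.
have : c |: [set a; b] \notin indep (cycle_matroid_complete V).
  apply/negP => /cycle_indepP/(_ [:: u; v; w] isT); apply.
  rewrite /ucycle /= !inE negb_or uv uw vw !andbT /=; apply/and3P; split.
  - by apply/adjP; exists a; rewrite // !inE eqxx orbT.
  - by apply/adjP; exists b; rewrite // !inE eqxx !orbT.
  - by apply/adjP; exists c; rewrite ?inE ?eqxx // setUC.
rewrite indepE; have := rk_le_card (cycle_matroid_complete V) (c |: [set a; b]).
by rewrite cardsU1 cab add1n leq_eqVlt => /orP[->|].
Qed.

Lemma rank_cycle (v0 : V) : (rank (cycle_matroid_complete V)).+1 = #|V|.
Proof.
apply/eqP; rewrite eqn_leq.
have idb : bijective (@id (edge V)) by exists id.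
rewrite (rank_triangular_le idb cycle_triangular v0) /=.
rewrite -cardsT (cardsD1 v0) inE ltnS.
pose S := [set e : edge V | v0 \in val e].
have iS : S \in indep (cycle_matroid_complete V).
  by apply/cycle_indepP/(@acyclic_star _ v0) => e; rewrite inE.
apply: leq_trans (card_le_rk iS (subsetT _)).
rewrite -(card_imset _ set1_inj).
apply: leq_trans (leq_imset_card (fun e : edge V => val e :\ v0) _).
apply: subset_leq_card; apply/subsetP => _ /imsetP[v vv0 ->].
rewrite !inE andbT in vv0; have [e Ee] := lab_ex idb vv0.
apply/imsetP; exists e; first by rewrite inE Ee !inE eqxx orbT.
apply/setP => x; rewrite Ee !inE; case: (eqVneq x v) => [->|]; first by rewrite vv0.
by case: (eqVneq x v0).
Qed.

(** [rk_triangular] computes both rank functions from the labels alone. *)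
Lemma triangular_isomorphic (T : finType) (M : matroid T) (lab : T -> edge V) (v0 : V) :
  bijective lab -> triangular M lab -> (rank M).+1 = #|V| ->
  isomorphic M (cycle_matroid_complete V).
Proof.
move=> lb tM rM; exists lab; split=> // A.
have idb : bijective (@id (edge V)) by exists id.
rewrite !indepE (rk_triangular lb tM rM).
rewrite (rk_triangular idb cycle_triangular (rank_cycle v0)).
by rewrite /nonroots imset_id card_imset //; apply: bij_inj.
Qed.

End CompleteGraphMatroid.

Lemma simple_rk1 (T : finType) (M : matroid T) x : simple M -> rk M [set x] = 1.
Proof.
move=> /andP[/forallP nl _].
suff : [set x] \in indep M by rewrite indepE cards1 => /eqP.
apply: contraT => /dep_circuit[C cC Cx]; have [nC _] := circuitP cC.
move: Cx; rewrite subset1 => /orP[]/eqP E; last by rewrite E indep0 in nC.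
by have := nl x; rewrite /loop -E cC.
Qed.

Section CompleteGraphCharacterization.
Variables (T : finType) (M : matroid T) (r : nat).
Hypotheses (sM : simple M) (rM : rank M = r.+2) (cT : #|T| = 'C(r.+3, 2)).
Hypothesis gM : good M.

Let lT : large M setT.
Proof. by apply/largeP; rewrite flatT cardsT -/(rank M) rM cT. Qed.

Lemma card_large_flags_le : #|large_flags M r.+2| * 2 <= r.+3`!.
Proof. by rewrite (large_flags_top rM) card_flags_to_le. Qed.

Lemma card_large_flags_eq :
  #|large_flags M r.+2| * 2 = r.+3`! -> isomorphic M (MK r.+3).
Proof.
rewrite (large_flags_top rM) => /(card_flags_to_eq gM lT rM) cH.
have [_ /(_ cH) meet] := card_large_hyps gM lT rM.
pose h (i : 'I_r.+3) : {set T} := enum_val (cast_ord (esym cH) i).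
have hP i : h i \in large_hyps M setT by apply: enum_valP.
have hinj : injective h by move=> i j /enum_val_inj/cast_ord_inj.
have fh i : flat M (h i) by have [] := large_hypsP rM (hP i).
have ch i : #|h i| = 'C(r.+2, 2) by have [_ _ _] := large_hypsP rM (hP i); rewrite (binS2 r.+1).
have ch2 i j : i != j -> #|h i :&: h j| = 'C(r.+1, 2).
  by move=> ij; apply: meet => //; apply: contra ij => /eqP/hinj ->.
apply: (triangular_isomorphic ord0 (lab_bij cT ch ch2)).
  exact: lab_triangular.
by rewrite rM card_ord.
Qed.

End CompleteGraphCharacterization.

Lemma good_of_middle_flats (T : finType) (M : matroid T) r :
  simple M -> rank M = r -> #|T| = 'C(r.+1, 2) ->
  (forall (i : nat) (F : {set T}), (1 <= i <= r.-1)%N -> flat M F -> rk M F = i ->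
     #|F| = 'C(i.+1, 2) \/ (#|F| <= 'C(i, 2) + 1)%N) ->
  good M.
Proof.
move=> sM rM cT H F fF.
have [r0|r0] := posnP (rk M F).
  left; rewrite r0 (_ : F = set0) ?cards0 //; apply/setP => x; rewrite inE.
  apply/negP => xF; have : rk M [set x] <= rk M F by rewrite rkS ?sub1set.
  by rewrite (simple_rk1 x sM) r0.
have [lt|ge] := ltnP (rk M F) r.
  have le : 0 < rk M F <= r.-1 by rewrite r0 -ltnS (ltn_predK lt).
  by case: (H _ F le fF erefl) => [->|]; [left|right].
have rF : rk M F = r by apply/eqP; rewrite eqn_leq ge andbT -rM rk_le_rank.
by left; rewrite rF -cT -cardsT (flat_eq fF (subsetT F)) // rF -rM.
Qed.

(** * Edmonds' theorem and the order complex of the violated sets *)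

Section Edmonds.
Local Open Scope ring_scope.
Variables (R : realFieldType) (T : finType).
Implicit Types (S B : {set T}) (x v z : T -> R) (M : matroid T).

(** Nonnegativity is implied: subtract the inequality for the complement of [e] from the
    equation. *)
Definition in_base_polytope M x :=
  \sum_e x e = (rank M)%:R /\ forall S, \sum_(e in S) x e <= (rk M S)%:R.

(* Summation by parts over the level sets of z: peel off the smallest positive
   value of z. *)
Lemma level_sets_ge0 z v : (forall e, 0 <= z e) ->
  (forall f, 0 < z f -> 0 <= \sum_(e | z f <= z e) v e) -> 0 <= \sum_e z e * v e.
Proof.
have [m] := ubnP #|[set e | 0 < z e]|; elim: m z => // m IHm z ltm z0 H.
have [f1 f1p|none] := pickP (fun e => 0 < z e); last first.
  rewrite big1 // => e _; have := none e; rewrite lt_neqAle z0 andbT => /negbFE/eqP <-.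
  by rewrite mul0r.
case: (@arg_minP _ _ _ f1 (fun e => 0 < z e) z f1p) => f0 f0p f0min.
pose z' e := if 0 < z e then z e - z f0 else 0.
have E : \sum_e z e * v e = z f0 * (\sum_(e | z f0 <= z e) v e) + \sum_e z' e * v e.
  rewrite big_distrr /= [X in X + _]big_mkcond -big_split /=; apply: eq_bigr => e _.
  rewrite /z'; case: (boolP (0 < z e)) => [ep|]; first by rewrite (f0min _ ep); ring.
  rewrite lt_neqAle z0 andbT negbK => /eqP ze; rewrite -ze leNgt f0p /=; ring.
rewrite E addr_ge0 // ?mulr_ge0 ?H //.
apply: IHm => [|e|f].
- apply: leq_trans (ltm : _ <= m)%N; apply: proper_card; apply/properP; split.
    by apply/subsetP => e; rewrite !inE /z'; case: ifP; rewrite ?ltxx.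
  by exists f0; rewrite !inE ?f0p // /z' f0p subrr ltxx.
- by rewrite /z'; case: ifP => // ep; rewrite subr_ge0; apply: f0min.
rewrite {1}/z'; case: ifP; rewrite ?ltxx // => fp; rewrite subr_gt0 => lt.
rewrite (eq_bigl (fun e => z f <= z e)) ?H // => e; rewrite /z' fp.
case: ifPn => [ep|ep]; first by rewrite lerD2r.
have -> : z e = 0 by apply/eqP; move: ep; rewrite lt_neqAle z0 andbT negbK eq_sym.
by rewrite subr_le0 !leNgt lt fp.
Qed.

Lemma sum_indicator S B : \sum_(e in S) (e \in B)%:R = #|B :&: S|%:R :> R.
Proof.
rewrite -sum1_card natr_sum big_mkcond [RHS]big_mkcond; apply: eq_bigr => e _.
by rewrite inE; case: (e \in S); case: (e \in B).
Qed.

(** The level sets of [z] form a chain, so one basis [B] meets each in full rank. The indicator of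
    [B] minus [x] then has nonnegative sums over all level sets, and summation by parts applies. *)
Lemma greedy_basis M z : exists2 B, basis M B &
  forall x, in_base_polytope M x -> \sum_e z e * x e <= \sum_(e in B) z e.
Proof.
pose lev f := [set e | z f <= z e].
have [|A _|B [iB _ cB BP]] := @chain_basis _ M [set lev f | f in T] setT.
- move=> A A' /imsetP[f _ ->] /imsetP[f' _ ->].
  have [le|/ltW le] := leP (z f) (z f'); apply/orP; [right|left];
    by apply/subsetP => e; rewrite !inE; apply: le_trans.
- exact: subsetT.
exists B => [|x [x1 xS]]; first by apply/basisP.
pose c := \sum_e `|z e|; pose v e := (e \in B)%:R - x e.
have cz e : 0 <= z e + c.
  rewrite /c (bigD1 e) //= addrA addr_ge0 ?sumr_ge0 //.
  by rewrite addrC -lerBlDr sub0r -normrN ler_norm.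
have v0 : \sum_e v e = 0.
  rewrite /v big_split /= sumrN x1 -{1}(eq_bigl _ _ (in_setT (T := T))).
  by rewrite sum_indicator setIT cB subrr.
have : 0 <= \sum_e (z e + c) * v e.
  apply: level_sets_ge0 => // f _.
  rewrite (eq_bigl (mem (lev f))) => [|e]; last by rewrite !inE lerD2r.
  rewrite /v big_split /= sumrN sum_indicator BP ?imset_f // subr_ge0; exact: xS.
under eq_bigr => e _ do rewrite mulrDl.
rewrite big_split /= -big_distrr /= v0 mulr0 addr0 /v.
under eq_bigr => e _ do rewrite mulrBr.
rewrite big_split /= sumrN subr_ge0 => /le_trans; apply.
rewrite [leRHS]big_mkcond; apply: ler_sum => e _.
by case: (e \in B); rewrite ?mulr1 ?mulr0.
Qed.

Lemma sum_set_mul x (P : pred {set T}) :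
  \sum_e (\sum_(S | P S) (e \in S)%:R) * x e = \sum_(S | P S) \sum_(e in S) x e.
Proof.
under eq_bigr => e _ do rewrite big_distrl.
rewrite exchange_big /=; apply: eq_bigr => S _.
rewrite [RHS]big_mkcond; apply: eq_bigr => e _.
by case: (e \in S); rewrite ?mul1r ?mul0r.
Qed.

(* A point is moved away from a basis meeting all its tight sets fully, until a
   new set becomes tight. *)
Theorem edmonds M x : in_base_polytope M x ->
  exists w : {set T} -> R, [/\ forall B, 0 <= w B, forall B, w B != 0 -> basis M B,
    \sum_B w B = 1 & forall e, x e = \sum_B w B * (e \in B)%:R].
Proof.
pose tight x S := \sum_(e in S) x e == (rk M S)%:R.
have [m] := ubnP #|[set S | ~~ tight x S]|; elim: m x => // m IHm x ltm xP.
have [x1 xS] := xP.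
have [B bB Bmax] := greedy_basis M (fun e => \sum_(S | tight x S) (e \in S)%:R).
(* Maximality of [B] for the sum of the indicators of all tight sets gives the inequality opposite
   to [basis_rk_le] in total, hence equality for every tight set. *)
have Btight S : tight x S -> #|B :&: S| = rk M S.
  have := Bmax x xP; rewrite sum_set_mul //.
  rewrite exchange_big /=; under [leRHS]eq_bigr => S' _.
    rewrite (_ : \sum_(e in B) (e \in S')%:R = #|B :&: S'|%:R); last first.
      by rewrite sum_indicator setIC.
    over.
  have d0 S' : tight x S' -> 0 <= \sum_(e in S') x e - #|B :&: S'|%:R :> R.
    by move=> /eqP ->; rewrite subr_ge0 ler_nat basis_rk_le.
  rewrite -subr_le0 -sumrN -big_split /= => le0 tS.
  have /eqP : \sum_(S' | tight x S') (\sum_(e in S') x e - #|B :&: S'|%:R) = 0 :> R.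
    by apply/eqP; rewrite eq_le le0 sumr_ge0.
  rewrite psumr_eq0 // => /allP/(_ S (mem_index_enum _)); rewrite tS subr_eq0 /=.
  by rewrite (eqP tS) eqr_nat => /eqP.
have [S1 S1v|noviol] := pickP (fun S => #|B :&: S|%:R < \sum_(e in S) x e); last first.
  have le e : x e <= (e \in B)%:R.
    have := noviol [set e]; rewrite big_set1 ltNge => /negbFE/le_trans; apply.
    rewrite ler_nat; case: (boolP (e \in B)) => eB.
      by apply: leq_trans (subset_leq_card (subsetIr _ _)) _; rewrite cards1.
    rewrite (_ : _ :&: _ = set0) ?cards0 //; apply/setP => f; rewrite !inE.
    by case: eqP => [->|]; rewrite ?andbF // (negPf eB).
  have eqx : forall e, (e \in B)%:R - x e = 0.
    have /eqP : \sum_e ((e \in B)%:R - x e) = 0.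
      rewrite big_split /= sumrN x1 -{1}(eq_bigl _ _ (in_setT (T := T))).
      by rewrite sum_indicator setIT; have [_ ->] := basisP _ _ bB; rewrite subrr.
    rewrite psumr_eq0 => [/allP H e|e _]; last by rewrite subr_ge0.
    exact/eqP/H/mem_index_enum.
  exists (fun B' => (B' == B)%:R); split=> [B'|B'||e]; rewrite ?ler0n //.
  - by have [->|_] := eqVneq B' B; rewrite ?eqxx.
  - by rewrite (bigD1 B) //= eqxx big1 ?addr0 // => B' /negPf ->.
  - rewrite (bigD1 B) //= eqxx big1 ?addr0 => [|B' /negPf ->]; last by rewrite mul0r.
    by rewrite mul1r; apply/esym/eqP; rewrite -subr_eq0 eqx.
(* Write [x] as [t] times the indicator of [B] plus 1 - [t] times [y]. The inequality for [S]
   survives in [y] exactly when [t <= q S], and it is automatic when [S] is not among the sets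
   minimized over. At the minimum, tight sets stay tight and [S0] becomes tight. *)
pose q S : R := ((rk M S)%:R - \sum_(e in S) x e) / ((rk M S)%:R - #|B :&: S|%:R).
case: (@arg_minP _ _ _ S1 (fun S => #|B :&: S|%:R < \sum_(e in S) x e) q S1v) => S0 S0v S0min.
have [t tE] : exists t, t = q S0 by exists (q S0).
have den S : #|B :&: S|%:R < \sum_(e in S) x e -> 0 < (rk M S)%:R - #|B :&: S|%:R :> R.
  by move=> lt; rewrite subr_gt0; apply: lt_le_trans (xS S).
have t0 : 0 <= t by rewrite tE divr_ge0 ?(ltW (den _ S0v)) // subr_ge0.
have t1 : t < 1 by rewrite tE ltr_pdivrMr ?den // mul1r ltrD2l ltrN2.
have t1' : 0 < 1 - t by rewrite subr_gt0.
pose y e := (x e - t * (e \in B)%:R) / (1 - t).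
have yS S : \sum_(e in S) y e = (\sum_(e in S) x e - t * #|B :&: S|%:R) / (1 - t).
  by rewrite -big_distrl /= big_split /= sumrN -big_distrr /= sum_indicator.
have yP : in_base_polytope M y.
  split=> [|S].
    have := yS setT; rewrite setIT !(eq_bigl _ _ (in_setT (T := T))) x1 => ->.
    have [_ ->] := basisP _ _ bB; have : 1 - t != 0 by rewrite gt_eqF.
    by move=> ?; field.
  rewrite yS ler_pdivrMr //; have bS : #|B :&: S|%:R <= (rk M S)%:R :> R.
    by rewrite ler_nat basis_rk_le.
  have [lt|ge] := ltP (#|B :&: S|%:R : R) (\sum_(e in S) x e).
    have := S0min S lt; rewrite -tE ler_pdivlMr ?den //.
    by move: (\sum_(e in S) x e) => s; nra.
  have h : 0 <= (1 - t) * ((rk M S)%:R - #|B :&: S|%:R) by rewrite mulr_ge0 ?(ltW t1') ?subr_ge0.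
  by move: ge h; move: (\sum_(e in S) x e) #|B :&: S|%:R (rk M S)%:R => s b k; nra.
have [|w [w0 wb w1 we]] := IHm y _ yP.
  apply: leq_trans (ltm : _ <= m)%N; apply: proper_card; apply/properP; split.
    apply/subsetP => S; rewrite !inE; apply: contra => tS.
    rewrite /tight yS (eqP tS) (Btight _ tS); apply/eqP.
    have t1'' : 1 - t != 0 by rewrite gt_eqF.
    by field.
  exists S0; rewrite !inE; last first.
    rewrite /tight yS negbK; apply/eqP.
    have d0 : (rk M S0)%:R - #|B :&: S0|%:R != 0 :> R by rewrite gt_eqF ?den.
    have tq : t * ((rk M S0)%:R - #|B :&: S0|%:R) = (rk M S0)%:R - \sum_(e in S0) x e.
      by rewrite tE divfK.
    have t1'' : 1 - t != 0 by rewrite gt_eqF.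
    apply: (canLR (mulfK t1'')); move: tq; move: (\sum_(e in S0) x e) => s tq.
    by rewrite mulrBr mulr1 [_ * t]mulrC; lra.
  apply/negP => tS; have := Btight _ tS => E.
  by move: S0v; rewrite (eqP tS) E ltxx.
exists (fun B' => t * (B' == B)%:R + (1 - t) * w B'); split=> [B'|B'||e].
- by rewrite addr_ge0 // mulr_ge0 ?ler0n // ltW.
- have [->//|ne] := eqVneq B' B; rewrite mulr0 add0r mulf_eq0 => /norP[_].
  exact: wb.
- rewrite big_split -!big_distrr /= w1 (bigD1 B) //= eqxx big1 => [|B' /negPf -> //].
  by rewrite -[true%:R]/(1 : R); ring.
- under eq_bigr => B' _ do rewrite mulrDl -!mulrA.
  rewrite big_split -!big_distrr /= -we (bigD1 B) //= eqxx big1 => [|B' /negPf ->].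
    have t1'' : 1 - t != 0 by rewrite gt_eqF.
    by rewrite /y -[true%:R]/(1 : R); field.
  by rewrite mul0r.
Qed.

End Edmonds.

(** * The reduced Euler characteristic of chains of violated sets *)

Section ChainEuler.
Variables (T : finType) (bad : pred {set T}) (S0 : {set T}).
Hypotheses (bad0 : bad S0) (badI : forall S, bad S -> bad (S0 :&: S)).
Implicit Types (A : {set T}) (D : {set {set T}}).

Definition chainb D := [forall A in D, forall B in D, (A \subset B) || (B \subset A)].

Lemma chainbP D : reflect (comparable_sets D) (chainb D).
Proof.
apply: (iffP forall_inP) => [H A B AD BD|H A AD].
  by have /forall_inP := H A AD; apply.
by apply/forall_inP => B BD; apply: H.
Qed.

(** For a chain the big intersection is the smallest member not inside [S0], or everything if there
    is none. The pivot is comparable with every member and depends only on members outside [S0], so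
    adding or removing it does not change it. *)
Let pivot D := S0 :&: \bigcap_(A in [set A in D | ~~ (A \subset S0)]) A.
Let toggle D := if pivot D \in D then D :\ pivot D else pivot D |: D.
Let bad_chain D := chainb D && [forall A in D, bad A].

Let pivot_toggle D : pivot (toggle D) = pivot D.
Proof.
rewrite {1}/pivot; congr (_ :&: _); apply: eq_bigl => A; rewrite !inE /toggle.
have [AS|AS] := boolP (A \subset S0); first by rewrite !andbF.
have ne : A != pivot D by apply: contraNneq AS => ->; apply: subsetIl.
by case: ifP => _; rewrite !inE ?ne ?(negPf ne).
Qed.

Let toggleK : involutive toggle.
Proof.
move=> D; rewrite {1}/toggle pivot_toggle /toggle.
have [pD|pD] := boolP (pivot D \in D).
  by rewrite !inE eqxx /= setD1K.
by rewrite !inE eqxx /= setU1K.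
Qed.

Let bad_pivot D : bad_chain D -> bad (pivot D).
Proof.
case/andP => /chainbP cD /forall_inP bD; rewrite /pivot.
have [->|[A0 A0D]] := set_0Vmem [set A in D | ~~ (A \subset S0)].
  by rewrite big_set0 setIT.
have [A AD Amin] := arg_minnP (fun A : {set T} => #|A|) A0D.
have {}AD : A \in [set A in D | ~~ (A \subset S0)] := AD.
have AinD : A \in D by move: AD; rewrite inE => /andP[].
suff -> : \bigcap_(A in [set A in D | ~~ (A \subset S0)]) A = A.
  by apply/badI/bD.
apply/eqP; rewrite eqEsubset; apply/andP; split; first exact: (bigcap_inf A).
apply/bigcapsP => C CD; have CinD : C \in D by move: CD; rewrite inE => /andP[].
case/orP: (cD _ _ AinD CinD) => // CA.
by have /eqP -> : C == A by rewrite eqEcard CA; apply: Amin.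
Qed.

Let bad_chain_toggle D : bad_chain D -> bad_chain (toggle D).
Proof.
move=> bcD; have bp := bad_pivot bcD; case/andP: (bcD) => /chainbP cD /forall_inP bD.
rewrite /toggle; case: ifP => pD; apply/andP; split.
- by apply/chainbP => A B; rewrite !inE => /andP[_ AD] /andP[_ BD]; apply: cD.
- by apply/forall_inP => A; rewrite !inE => /andP[_]; apply: bD.
- have comp A : A \in D -> (A \subset pivot D) || (pivot D \subset A).
    move=> AD; have [AS|AS] := boolP (A \subset S0); last first.
      apply/orP; right; apply: subset_trans (subsetIr _ _) _.
      by apply: (bigcap_inf A); rewrite // inE AD.
    apply/orP; left; rewrite subsetI AS; apply/bigcapsP => C; rewrite inE => /andP[CD CS].
    case/orP: (cD _ _ AD CD) => // CA.
    by case/negP: CS; apply: subset_trans AS.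
  apply/chainbP => A B; rewrite !inE => /orP[/eqP ->|AD] /orP[/eqP ->|BD].
  + by rewrite subxx.
  + by rewrite orbC comp.
  + exact: comp.
  + exact: cD.
- by apply/forall_inP => A; rewrite !inE => /orP[/eqP ->|/bD].
Qed.

(* The order complex of the bad sets is collapsed by toggling the pivot. *)
Lemma bad_chains_euler :
  (\sum_(D : {set {set T}} | chainb D && [forall A in D, bad A]) (-1) ^+ #|D| = 0 :> int)%R.
Proof.
set s := (X in X = _).
have bad_chainE D : bad_chain (toggle D) = bad_chain D.
  apply/idP/idP; last exact: bad_chain_toggle.
  by move/bad_chain_toggle; rewrite toggleK.
suff : (s = - s)%R by move=> E; lia.
rewrite /s [LHS](reindex_inj (inv_inj toggleK)) -sumrN; apply: eq_big => [D|D _].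
  exact: bad_chainE.
rewrite /toggle; case: ifPn => pD; last by rewrite cardsU1 pD exprS mulN1r.
by rewrite (cardsD1 (pivot D) D) pD exprS mulN1r opprK.
Qed.

End ChainEuler.

(** Each element of [S] missed by a maximal independent [I] is blocked by a tight set, and the
    largest tight set contains all of these elements; [I] therefore contains the rest of [S]. *)
Lemma chain_matroid_rk (T : finType) (P : {set {set T}}) (rho : {set T} -> nat)
    (cP : comparable_sets P) (S : {set T}) (L := chain_matroid rho cP) :
  rk L S = #|S| \/ exists2 S', S' \in P & rho S' + #|S :\: S'| <= rk L S.
Proof.
have [I [iI IS cI]] := rk_witness L S.
have [SI|] := boolP (S \subset I).
  by left; rewrite -cI; congr #|pred_of_set _|; apply/eqP; rewrite eqEsubset IS.
have tightP y : y \in S -> y \notin I ->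
    exists S', [/\ S' \in P, #|I :&: S'| == rho S' & y \in S'].
  move=> yS yI; have : y |: I \notin indep L.
    apply/negP => iyI; have sub : y |: I \subset S by rewrite subUset sub1set yS.
    by have := card_le_rk iyI sub; rewrite cardsU1 yI -cI add1n ltnn.
  move=> nind; have /existsP[S' /andP[S'P lt]] :
      [exists S', (S' \in P) && (rho S' < #|(y |: I) :&: S'|)].
    apply: contraNT nind; rewrite negb_exists => /forallP H.
    by apply/chain_matroidP => S' S'P; have := H S'; rewrite S'P -leqNgt.
  have le : #|I :&: S'| <= rho S' by move/chain_matroidP: iI; apply.
  have yS' : y \in S'.
    apply: contraLR lt => yS'; rewrite -leqNgt; apply: leq_trans le.
    apply/subset_leq_card/subsetP => z; rewrite !inE => /andP[/orP[/eqP zy|->] zS'] //.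
    by rewrite -zy zS' in yS'.
  exists S'; split=> //; rewrite eqn_leq le /= -ltnS (leq_trans lt) //.
  rewrite setIUl (setIidPl _) ?sub1set // cardsU1 -add1n leq_add2r.
  by case: (_ \notin _).
case/subsetPn => y yS yI; right.
have [S1 [S1P S1t _]] := tightP y yS yI.
have t1 : (S1 \in P) && (#|I :&: S1| == rho S1) by rewrite S1P.
have [S' /andP[S'P /eqP S't] S'max] :=
  arg_maxnP (fun S : {set T} => #|S|) (P := fun S' => (S' \in P) && (#|I :&: S'| == rho S')) t1.
exists S' => //; rewrite -cI -(cardsID S' I) S't leq_add2l; apply: subset_leq_card.
apply/subsetP => z; rewrite !inE => /andP[zS' zS]; rewrite zS' /=.
apply: contraT => zI; have [S2 [S2P S2t zS2]] := tightP z zS zI.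
have [S2S'|S'S2] := orP (cP _ _ S2P S'P); first by rewrite (subsetP S2S' z zS2) in zS'.
case/negP: zS'; have /eqP -> // : S' == S2.
by rewrite eqEcard S'S2; apply: S'max; rewrite S2P.
Qed.

(** * Isomorphisms and relabelling by permutations *)

Section Isomorphism.
Variables (T U : finType) (M : matroid T) (M' : matroid U) (f : T -> U).
Hypotheses (fb : bijective f).
Hypothesis fM : forall A : {set T}, (A \in indep M) = (f @: A \in indep M').

Let fi : injective f := bij_inj fb.

Lemma rk_iso (A : {set T}) : rk M' (f @: A) = rk M A.
Proof.
have [g fK gK] := fb; apply/eqP; rewrite eqn_leq; apply/andP; split.
  have [I [iI IA <-]] := rk_witness M' (f @: A).
  have E : f @: (g @: I) = I by rewrite -imset_comp (eq_imset _ gK) imset_id.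
  rewrite -E (card_imset _ fi); apply: card_le_rk; first by rewrite fM E.
  apply/subsetP => _ /imsetP[y yI ->].
  by have /imsetP[x xA ->] := subsetP IA y yI; rewrite fK.
have [I [iI IA <-]] := rk_witness M A.
by rewrite -(card_imset _ fi) card_le_rk // -?fM ?imsetS.
Qed.

Lemma rank_iso : rank M' = rank M.
Proof.
have [g fK gK] := fb; rewrite /rank -rk_iso; congr (rk _ _).
by apply/setP => y; rewrite inE -[y]gK imset_f.
Qed.

End Isomorphism.

Lemma isomorphic_join (T T' U : finType) (M : matroid T) (M' : matroid T') (K : matroid U) :
  isomorphic M K -> isomorphic M' K -> isomorphic M M'.
Proof.
move=> [f [fb fM]] [g [gb gM]]; have [h gK hK] := gb.
exists (h \o f); split; first by apply: bij_comp => //; exists g.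
by move=> A; rewrite fM gM -imset_comp (eq_imset (g := f)) // => x /=; rewrite hK.
Qed.

Lemma matroid_eq_bases (T : finType) (M M' : matroid T) :
  (forall B, basis M B = basis M' B) -> M = M'.
Proof.
move=> H; apply: matroid_eq; apply/setP => A.
have sub (M1 M2 : matroid T) : (forall B, basis M1 B -> basis M2 B) ->
    A \in indep M1 -> A \in indep M2.
  move=> H12 iA; have [B [iB AB _ cB]] := indep_extend iA (subsetT A).
  have /basisP[iB' _] : basis M2 B by apply/H12/basisP.
  exact: indepS iB'.
by apply/idP/idP; apply: sub => B; rewrite H.
Qed.

Section Relabel.
Variables (T : finType) (s : {perm T}) (M : matroid T).
Implicit Types (A B : {set T}).

Let I := [set A : {set T} | s @^-1: A \in indep M].

Lemma imset_preimset_perm A : s @: (s @^-1: A) = A.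
Proof.
apply/setP => x; apply/imsetP/idP => [[y]|xA]; first by rewrite inE => ? ->.
by exists ((s^-1)%g x); rewrite ?inE permKV.
Qed.

Lemma preimset_imset_perm A : s @^-1: (s @: A) = A.
Proof. by apply/setP => x; rewrite inE mem_imset //; apply: perm_inj. Qed.

Lemma card_preimset_perm A : #|s @^-1: A| = #|A|.
Proof. by rewrite -{2}(imset_preimset_perm A) card_imset //; apply: perm_inj. Qed.

Fact relabel0 : set0 \in I.
Proof. by rewrite inE preimset0 indep0. Qed.

Fact relabelS A B : A \subset B -> B \in I -> A \in I.
Proof. by rewrite !inE => AB; apply/indepS/preimsetS. Qed.

Fact relabel_aug A B : A \in I -> B \in I -> #|A| < #|B| ->
  exists2 x, x \in B :\: A & x |: A \in I.
Proof.
rewrite [A \in _]inE [B \in _]inE => iA iB.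
rewrite -(card_preimset_perm A) -(card_preimset_perm B) => lt.
have [x xBA ixA] := indep_aug iA iB lt; exists (s x); first by rewrite !inE in xBA *.
rewrite inE (_ : s @^-1: _ = x |: (s @^-1: A)) //.
by apply/setP => y; rewrite !inE (inj_eq perm_inj).
Qed.

Definition relabel : matroid T := Matroid relabel0 relabelS relabel_aug.

Lemma relabel_indep A : (A \in indep M) = (s @: A \in indep relabel).
Proof. by rewrite inE preimset_imset_perm. Qed.

Let sb : bijective s. Proof. by exists (s^-1)%g; [apply: permK|apply: permKV]. Qed.

Lemma rk_relabel A : rk relabel A = rk M (s @^-1: A).
Proof. by rewrite -{1}(imset_preimset_perm A) (rk_iso sb relabel_indep). Qed.

Lemma rank_relabel : rank relabel = rank M.
Proof. exact: rank_iso sb relabel_indep. Qed.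

Lemma relabel_isomorphic : isomorphic M relabel.
Proof. by exists s; split; [apply: sb|apply: relabel_indep]. Qed.

Lemma basis_relabel B : basis relabel (s @: B) = basis M B.
Proof.
by apply/basisP/basisP; rewrite -relabel_indep rank_relabel (card_imset _ (@perm_inj _ s)).
Qed.

Lemma card_bases_relabel :
  #|[set B | basis relabel B]| = #|[set B | basis M B]|.
Proof.
rewrite -[RHS](card_imset _ (imset_inj (@perm_inj _ s))); apply: eq_card => B.
rewrite inE -{1}(imset_preimset_perm B) basis_relabel.
apply/idP/imsetP => [bB|[B' + ->]]; last by rewrite inE preimset_imset_perm.
by exists (s @^-1: B); rewrite ?inE ?imset_preimset_perm.
Qed.

End Relabel.

Lemma isomorphic_relabel (T : finType) (M M' : matroid T) :
  isomorphic M M' -> exists s : {perm T}, M' = relabel s M.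
Proof.
case=> f [fb fM]; pose s := perm (bij_inj fb); exists s.
apply: matroid_eq; apply/setP => A.
rewrite -{2}(imset_preimset_perm s A) -relabel_indep fM -{1}(imset_preimset_perm s A).
by rewrite (@eq_imset _ _ s f) // => x; rewrite permE.
Qed.

Section FlatCount.
Local Open Scope ring_scope.
Variables (R : realFieldType) (T : finType) (M : matroid T).

(** If [S] is not a flat, toggling an element [x] of its closure outside [S] pairs off the terms
    with opposite signs. This makes flatness accessible to counts of chains with prescribed
    ranks. *)
Lemma flat_alternating_sum (S : {set T}) :
  \sum_(A : {set T} | (S \subset A) && (rk M A == rk M S)) (-1) ^+ #|A :\: S| =
  (flat M S)%:R :> R.
Proof.
have [fS|nfS] := boolP (flat M S).
  rewrite (big_pred1 S) ?finset.setDv ?cards0 // => A /=.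
  apply/andP/eqP => [[SA /eqP rA]|->]; last by rewrite subxx.
  by apply/esym/(flat_eq fS SA); rewrite rA.
have [x xS xcl] : exists2 x, x \notin S & x \in cl M S.
  move: nfS; rewrite negb_forall => /existsP[x]; rewrite negb_imply => /andP[xS].
  rewrite -leqNgt => le; exists x => //; apply/clP/eqP.
  by rewrite eqn_leq le rkS ?finset.subsetUr.
pose toggle (A : {set T}) := if x \in A then A :\ x else x |: A.
have toggleK : involutive toggle.
  move=> A; rewrite /toggle; have [xA|xA] := boolP (x \in A).
    by rewrite !inE eqxx /= setD1K.
  by rewrite !inE eqxx /= setU1K.
have st (A : {set T}) : (S \subset A) && (rk M A == rk M S) ->
    (S \subset toggle A) && (rk M (toggle A) == rk M S).
  case/andP => SA /eqP rA; rewrite /toggle; case: ifPn => xA.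
    have SA' : S \subset A :\ x by rewrite subsetD1 SA.
    by rewrite SA' eqn_leq -{1}rA !rkS // subD1set.
  rewrite (fintype.subset_trans SA (subsetUr _ _)) /= -rA; apply/eqP/clP.
  exact: (fintype.subsetP (cl_mono M SA)).
set t := (X in X = _); suff : t = - t by move=> E; rewrite mulr0n; lra.
rewrite /t [LHS](reindex_inj (inv_inj toggleK)) -sumrN; apply: eq_big => [A|A].
  by apply/idP/idP => [/st|]; [rewrite toggleK|apply: st].
move=> /andP[SA _]; rewrite /toggle.
case: ifPn => xA; last by rewrite setDUl (setDidPl _) ?disjoints1 //
   cardsU1 !inE (negPf xA) andbF exprS mulN1r.
have -> : #|A :\: S| = (#|(A :\ x) :\: S|).+1.
  by rewrite setDDl setUC -setDDl (cardsD1 x (A :\: S)) !inE xA xS.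
by rewrite exprS mulN1r opprK.
Qed.

End FlatCount.

Section Criteria.
Variables (T : finType) (M : matroid T) (r : nat).
Hypotheses (r2 : 1 < r) (rM : rank M = r) (cT : #|T| = 'C(r.+1, 2)).

(** Rank 0 is separate because the general clause would accept a single loop. *)
Definition bad_size i s := if i == 0 then 0 < s
  else (s != 'C(i.+1, 2)) && ('C(i, 2) + 1 < s).

(** A loop or a parallel pair is a dependent set of rank at most 1, and its closure would be a
    nonempty flat of rank 0 or a flat of rank 1 with at least 2 elements, both of bad size. *)
Lemma simple_of_sizes : (forall F, flat M F -> rk M F < r -> ~~ bad_size (rk M F) #|F|) ->
  simple M.
Proof.
move=> H; have small S : rk M S < #|S| -> 1 < rk M S.
  move=> lt; rewrite ltnNge; apply/negP => le.
  have := H _ (cl_flat M S); rewrite rk_cl => /(_ (leq_ltn_trans le r2)).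
  have := leq_trans lt (subset_leq_card (sub_cl M S)).
  rewrite /bad_size; case: (rk M S) le => [|[|//]] _ /=; first by move=> ->.
  by rewrite !binS2 /= !bin0n /=; case: #|_| => [|[|]].
apply/andP; split; apply/forallP => x.
  apply/negP => /circuitP[nx _].
  have lt : rk M [set x] < #|[set x]| by rewrite ltn_neqAle rk_le_card andbT -indepE.
  by have := small _ lt; rewrite cards1 in lt; rewrite ltnNge (ltnW lt).
apply/forallP => y; apply/negP => /andP[xy /circuitP[nxy _]].
have lt : rk M [set x; y] < #|[set x; y]| by rewrite ltn_neqAle rk_le_card andbT -indepE.
by have := small _ lt; rewrite cards2 xy in lt; rewrite ltnNge -ltnS lt.
Qed.

Lemma good_of_sizes : (forall F, flat M F -> rk M F < r -> ~~ bad_size (rk M F) #|F|) ->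
  good M.
Proof.
move=> H; apply: (good_of_middle_flats (simple_of_sizes H) rM cT) => i F.
move=> /andP[i0 ir] fF rF; have := H F fF; rewrite rF /bad_size -{1}(ltn_predK r2) ltnS.
move=> /(_ ir); rewrite eqn0Ngt i0 /= negb_and negbK -leqNgt.
by case/orP => [/eqP|]; [left|right].
Qed.

Lemma good_bad_size F : good M -> flat M F -> ~~ bad_size (rk M F) #|F|.
Proof.
move=> gM fF; rewrite /bad_size; case: (gM F fF) => [->|[r0 le]].
  by case: eqP => [->|_]; rewrite ?eqxx.
by rewrite eqn0Ngt r0 /= negb_and -leqNgt le orbT.
Qed.

(** Sizes and weak inclusions are invariant under permutations and do not involve the matroid; only
    the ranks do, and they are imposed separately. *)
Definition size_flag (F : {ffun 'I_r.+1 -> {set T}}) :=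
  [forall i, #|F i| == 'C(i.+1, 2)] &&
  [forall i : 'I_r.+1, forall j : 'I_r.+1, (i <= j) ==> (F i \subset F j)].

(** By [good_le] a set of rank i with C(i+1,2) elements fills its closure, so it is a flat
    automatically. *)
Lemma large_flagsE : good M -> large_flags M r =
  [set F : {ffun 'I_r.+1 -> {set T}} | size_flag F && [forall i, rk M (F i) == i]].
Proof.
move=> gM; apply/setP => F; rewrite [RHS]in_set.
apply/large_flagP/andP => [[FL Fp]|[/andP[/forallP Fs /forallP Fm] /forallP Fr]].
  split; last by apply/forallP => i; have [->] := FL i.
  apply/andP; split; apply/forallP => i.
    by have [ri /largeP[_ ->]] := FL i; rewrite ri.
  apply/forallP => j; apply/implyP; rewrite leq_eqVlt => /orP[/eqP/val_inj ->//|ij].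
  by apply: proper_sub; apply: Fp.
split=> [i|i j ij].
  split; first exact/eqP.
  have ri := eqP (Fr i); have ci := eqP (Fs i).
  rewrite /large ri ci eqxx andbT (_ : F i = cl M (F i)) ?cl_flat //.
  apply/eqP; rewrite eqEcard sub_cl /= ci.
  by have := good_le gM (cl_flat M (F i)); rewrite rk_cl ri.
rewrite properE; have /forallP/(_ j) := Fm i; rewrite (ltnW ij) /= => ->.
by apply/negP => /(rkS M); rewrite (eqP (Fr i)) (eqP (Fr j)) leqNgt ij.
Qed.

End Criteria.

(** * Linear relations between indicators of compact intervals *)

Section Intervals.
Local Open Scope ring_scope.
Variables (R : realFieldType) (I : finType) (P : pred I) (a b l : I -> R).
Hypothesis ab : forall i, P i -> a i <= b i.
Hypothesis l0 : forall t, \sum_(i | P i && (a i <= t <= b i)) l i = 0.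

Let sum_left_right t : \sum_(i | P i && (a i <= t)) l i = \sum_(i | P i && (b i < t)) l i.
Proof.
rewrite (bigID (fun i => t <= b i)) /=.
rewrite (eq_bigl (fun i => P i && (a i <= t <= b i))) ?l0 ?add0r => [|i]; last by rewrite andbA.
apply: eq_bigl => i; rewrite -andbA -ltNge; case: (boolP (P i)) => //= Pi.
have [lt|] := ltP (b i) t; last by rewrite andbF.
by rewrite (le_trans (ab Pi) (ltW lt)).
Qed.

Let separate (s t : R) : s < t ->
  exists u, [/\ s < u, u <= t & forall i, s < a i -> u < a i].
Proof.
move=> st; suff [u [su ut H]] : exists u, [/\ s < u, u <= t &
    forall i, i \in enum I -> s < a i -> u < a i].
  by exists u; split=> // i; apply: H; rewrite mem_enum.
elim: (enum I) => [|i r [u [su ut H]]]; first by exists t.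
have [lt|ge] := ltP s (a i); last first.
  exists u; split=> // j; rewrite inE => /orP[/eqP ->|]; last exact: H.
  by rewrite ltNge ge.
exists (Num.min u ((s + a i) / 2)); split.
- by rewrite lt_min su /=; lra.
- by rewrite ge_min ut.
- move=> j; rewrite inE => /orP[/eqP -> _|jr sj]; rewrite gt_min.
    by apply/orP; right; lra.
  by rewrite (H j jr sj).
Qed.

(** Sweep over right ends. Let b be the largest right end below [t]. No left end lies strictly after
    b up to a suitable [u], so the intervals ending before [t] have the same sum as those starting
    by b, and by the relation at b the same sum as those ending before b, which are fewer. *)
Lemma sum_intervals_eq0 : \sum_(i | P i) l i = 0.
Proof.
have H t : \sum_(i | P i && (b i < t)) l i = 0.
  have [m] := ubnP #|[pred i | P i && (b i < t)]|; elim: m t => // m IHm t ltm.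
  have [i0 i0P|none] := pickP (fun i => P i && (b i < t)); last by rewrite big_pred0.
  case: (@Order.TotalTheory.arg_maxP _ _ _ i0 (fun i => P i && (b i < t)) b i0P) => i1 i1P i1max.
  have /andP[Pi1 lt1] := i1P.
  have [u [su ut uH]] := separate lt1.
  have -> : \sum_(i | P i && (b i < t)) l i = \sum_(i | P i && (b i < u)) l i.
    apply: eq_bigl => i; case: (boolP (P i)) => //= Pi; apply/idP/idP.
      by move=> lt; apply: le_lt_trans su; apply: i1max; rewrite Pi.
    by move=> /lt_le_trans; apply.
  rewrite -sum_left_right (eq_bigl (fun i => P i && (a i <= b i1))) => [|i].
    rewrite sum_left_right IHm //; apply: leq_trans (ltm : (_ <= m)%N).
    apply: proper_card; apply/properP; split.
      by apply/fintype.subsetP => i; rewrite !inE => /andP[-> /lt_trans]; apply.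
    by exists i1; rewrite !inE ?Pi1 // ltxx.
  case: (boolP (P i)) => //= Pi; apply/idP/idP; last by move=> /le_trans; apply; apply: ltW.
  by rewrite !leNgt; apply: contra => /uH.
pose t := 1 + \sum_i `|b i|.
rewrite -[RHS](H t); apply: eq_bigl => i; rewrite [X in _ && X](_ : _ = true) ?andbT //.
rewrite /t (bigD1 i) //=; have := ler_norm (b i).
have : 0 <= \sum_(j | j != i) `|b j| by apply: sumr_ge0.
move: (\sum_(j | _) _) `|_| => x y; lra.
Qed.

End Intervals.

From mathcomp Require Import classical_sets reals numfun topology normedtype derive.
Import numFieldNormedType.Exports.

(** * Valuations of base polytopes *)

Section EulerCharacteristic.
Local Open Scope classical_set_scope.
Local Open Scope ring_scope.
Variables (R : realType) (n : nat) (I : finType) (l : I -> R).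
Implicit Types K : I -> set 'rV[R]_n.

Definition convex (A : set 'rV[R]_n) := forall x y t, A x -> A y -> 0 <= t <= 1 ->
  A (t *: x + (1 - t) *: y).

(* A linear relation between indicator functions of compact convex sets is also
   satisfied by their Euler characteristics: slice along the coordinates one at a
   time. *)
Lemma compact_convex_euler K : (forall i, compact (K i)) -> (forall i, convex (K i)) ->
  (forall x, \sum_i l i * \1_(K i) x = 0) ->
  \sum_i l i * (`[< K i !=set0 >])%:R = 0.
Proof.
(* The induction is on the number of free coordinates: from index [k] on, all points of all the sets
   agree with [b]. For [k = 0] each set is empty or the single point [b]. *)
have ind k : forall K (b : 'I_n -> R), (forall i, compact (K i)) ->
    (forall i, convex (K i)) -> (forall i x (j : 'I_n), K i x -> (k <= j)%N -> x 0 j = b j) ->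
    (forall x, \sum_i l i * \1_(K i) x = 0) ->
    \sum_i l i * (`[< K i !=set0 >])%:R = 0.
  elim: k => [|k IHk] {}K b Kc Kconv Kb K0.
    rewrite -[RHS](K0 (\row_j b j)); apply: eq_bigr => i _; rewrite indicE.
    congr (_ * (nat_of_bool _)%:R); apply/asboolP/idP => [[x Kx]|]; last first.
      by rewrite in_setE => Kx; exists (\row_j b j).
    rewrite in_setE (_ : \row_j b j = x) //.
    by apply/rowP => j; rewrite mxE (Kb i x j).
  have [kn|nk] := ltnP k n; last first.
    apply: (IHk K b) => // i x j Kx kj; apply: (Kb i) => //.
    by have := ltn_ord j; rewrite ltnNge (leq_trans nk kj).
  pose kk := Ordinal kn.
  pose P i := `[< K i !=set0 >].
  have slice t i : convex (K i `&` [set x | x 0 kk = t]).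
    move=> x y s [Kx xt] [Ky yt] s01; split; first exact: Kconv.
    by rewrite /= !mxE xt yt; ring.
  (* The projection to the coordinate is a compact interval: compactness supplies its ends,
     convexity the points between. *)
  have ends i : exists ab : R * R, P i ->
      ab.1 <= ab.2 /\ forall t, (K i `&` [set x | x 0 kk = t]) !=set0 <-> ab.1 <= t <= ab.2.
    have [Ki|nKi] := pselect (K i !=set0); last by exists (0, 0) => /asboolP.
    have cf : {within K i, continuous (fun x : 'rV[R]_n => x 0 kk)}.
      by apply: continuous_subspaceT => x; apply: coord_continuous.
    have [x /set_mem Kx xmin] := compact_EVT_min Ki (Kc i) cf.
    have [y /set_mem Ky ymax] := compact_EVT_max Ki (Kc i) cf.
    exists (x 0 kk, y 0 kk) => _ /=; split; first by apply: xmin; apply: mem_set.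
    move=> t; split=> [[z [Kz <-]]|/andP[xt ty]].
      by rewrite xmin ?ymax //; apply: mem_set.
    have [E|ne] := eqVneq (x 0 kk) (y 0 kk).
      exists x; split=> //=; apply/eqP; rewrite eq_le xt /=; by rewrite E.
    have lt : 0 < y 0 kk - x 0 kk by rewrite subr_gt0 lt_neqAle ne /=; apply: le_trans xt ty.
    have nz : y 0 kk - x 0 kk != 0 by rewrite gt_eqF.
    exists ((y 0 kk - t) / (y 0 kk - x 0 kk) *: x +
      (1 - (y 0 kk - t) / (y 0 kk - x 0 kk)) *: y); split.
      apply: Kconv => //; rewrite divr_ge0 ?subr_ge0 ?(ltW lt) //=; last first.
        exact: le_trans xt ty.
      by rewrite ler_pdivrMr // mul1r lerD2l lerN2.
    by rewrite /= !mxE; field.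
  have [ab abP] := choice ends.
  have eqP' : \sum_i l i * (P i)%:R = \sum_(i | P i) l i.
    rewrite [RHS]big_mkcond; apply: eq_bigr => i _.
    by case: (P i); rewrite ?mulr1 ?mulr0.
  rewrite eqP'; apply: (@sum_intervals_eq0 _ _ P (fun i => (ab i).1) (fun i => (ab i).2)).
    by move=> i /abP[].
  move=> t; pose b' j := if j == kk then t else b j.
  (* The intervals containing [t] belong to the nonempty slices, so the hypothesis on intervals is
     the Euler relation of the slices at [t]. *)
  rewrite -[RHS](IHk (fun i => K i `&` [set x | x 0 kk = t]) b').
  - rewrite big_mkcond /=; apply: eq_bigr => i _.
    have [Pi|nPi] := boolP (P i) => /=.
      have [_ /(_ t) E] := abP i Pi; rewrite (asbool_equiv_eq E) asboolb.
      by case: ifP; rewrite ?mulr1 ?mulr0.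
    rewrite asboolF ?mulr0 // => -[x [Kx _]].
    by case/negP: nPi; apply/asboolP; exists x.
  - move=> i; apply: compact_closedI; first exact: Kc.
    apply: (@preimage_closed _ _ (fun x : 'rV[R]_n => x 0 kk) [set x | x = t]).
      by move=> x _; apply: coord_continuous.
    exact: closed_eq.
  - exact: slice.
  - move=> i x j [Kx xt] kj; rewrite /b'; have [->//|ne] := eqVneq j kk.
    apply: (Kb i) => //; rewrite ltn_neqAle kj andbT.
    by apply: contra ne => /eqP E; apply/eqP/val_inj.
  - move=> x; have [E|ne] := eqVneq (x 0 kk) t.
      rewrite -[RHS](K0 x); apply: eq_bigr => i _; rewrite !indicE.
      congr (_ * (nat_of_bool _)%:R); by apply/idP/idP; rewrite !in_setE; [case|move=> Kx].
    rewrite big1 // => i _; rewrite indicE (_ : (x \in _) = false) ?mulr0 //.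
    by apply/negP; rewrite in_setE => -[_ /eqP]; rewrite (negPf ne).
move=> Kc Kconv; apply: (ind n K (fun=> 0)) => // i x j _.
by rewrite leqNgt ltn_ord.
Qed.

End EulerCharacteristic.

Section BasePolytope.
Local Open Scope classical_set_scope.
Local Open Scope ring_scope.
Variables (R : realType) (n : nat).
Implicit Types (M : matroid 'I_n) (S B : {set 'I_n}) (x : 'rV[R]_n).

Lemma sum_char_vec S B : \sum_(e in S) @char_vec R n B 0 e = #|B :&: S|%:R.
Proof. by rewrite -sum_indicator; apply: eq_bigr => e _; rewrite mxE. Qed.

Lemma base_polytopeP M x :
  @base_polytope R n M x <-> in_base_polytope M (fun e => x 0 e).
Proof.
split=> [[m [p [w [pB w0 w1 ->]]]]|].
  have pS S : \sum_(e in S) (\sum_i w i *: p i) 0 e =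
      \sum_i w i * \sum_(e in S) p i 0 e.
    under eq_bigr => e _ do rewrite summxE.
    rewrite exchange_big /=; apply: eq_bigr => i _; rewrite big_distrr /=.
    by apply: eq_bigr => e _; rewrite mxE.
  split=> [|S].
    rewrite -(eq_bigl _ _ (finset.in_setT (T := 'I_n))) pS.
    transitivity ((\sum_i w i) * (rank M)%:R); last by rewrite w1 mul1r.
    rewrite big_distrl; apply: eq_bigr => i _; have [B bB <-] := pB i.
    by rewrite sum_char_vec finset.setIT; have [_ ->] := basisP _ _ bB.
  rewrite pS -[leRHS]mul1r -[X in X * _]w1 big_distrl /=; apply: ler_sum => i _.
  rewrite ler_wpM2l //; have [B bB <-] := pB i.
  by rewrite sum_char_vec ler_nat basis_rk_le.
move=> /edmonds[w [w0 wb w1 xE]].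
pose bases := [set B : {set 'I_n} | Defs.basis M B]%SET.
have restrict (F : {set 'I_n} -> R) : (forall B, w B = 0 -> F B = 0) ->
    \sum_B F B = \sum_(i < #|bases|) F (enum_val i).
  move=> F0; rewrite -big_enum_val [RHS]big_mkcond /=; apply: eq_bigr => B _.
  by rewrite inE; case: ifPn => // nB; apply: F0; apply/eqP; apply: contraNT nB => /wb.
exists #|bases|, (fun i => @char_vec R n (enum_val i)), (fun i => w (enum_val i)); split.
- by move=> i; exists (enum_val i) => //; have := enum_valP i; rewrite inE.
- by [].
- by rewrite -restrict.
- apply/rowP => e; rewrite xE summxE restrict => [|B ->]; last by rewrite mul0r.
  by apply: eq_bigr => i _; rewrite !mxE.
Qed.

Lemma base_polytope01 M x e : @base_polytope R n M x -> 0 <= x 0 e <= 1.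
Proof.
move=> /base_polytopeP[x1 xS]; apply/andP; split; last first.
  have := xS [set e]%SET; rewrite big_set1 => /le_trans; apply.
  by rewrite lern1 (leq_trans (rk_le_card _ _)) ?cards1.
have := xS (~: [set e])%SET; move: x1.
have -> : \sum_(i in (~: [set e])%SET) x 0 i = \sum_(i | i != e) x 0 i.
  by apply: eq_bigl => i; rewrite !inE.
rewrite (bigD1 e) //=.
have : (rk M (~: [set e])%SET)%:R <= (rank M)%:R :> R by rewrite ler_nat rk_le_rank.
by move: (\sum_(i | _) _) => y; lra.
Qed.

Lemma continuous_sum_coord S : continuous (fun x : 'rV[R]_n => \sum_(e in S) x 0 e).
Proof.
have -> : (fun x : 'rV[R]_n => \sum_(e in S) x 0 e) =
    (fun x => \sum_(e <- enum S) x 0 e).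
  by apply/funext => x; rewrite big_enum.
elim: (enum S) => [|e s IHs].
  have -> : (fun x : 'rV[R]_n => \sum_(e <- [::]) x 0 e) = (fun=> 0).
    by apply/funext => x; rewrite big_nil.
  exact: cst_continuous.
have -> : (fun x : 'rV[R]_n => \sum_(i <- e :: s) x 0 i) =
    (fun x : 'rV[R]_n => x 0 e) \+ (fun x => \sum_(i <- s) x 0 i).
  by apply/funext => x; rewrite big_cons.
by move=> x; apply: continuousD; [apply: coord_continuous | apply: IHs].
Qed.

Lemma closed_sum_coord S (C : set R) : closed C ->
  closed [set x : 'rV[R]_n | C (\sum_(e in S) x 0 e)].
Proof.
apply: (@preimage_closed _ _ (fun x : 'rV[R]_n => \sum_(e in S) x 0 e)) => x _.
exact: continuous_sum_coord.
Qed.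

Lemma compact_base_polytope M : compact (@base_polytope R n M).
Proof.
apply: bounded_closed_compact.
  exists 1; split; first exact: num_real.
  move=> c c1 x Px; apply: le_trans (ltW c1).
  rewrite /Num.norm /= mx_normrE; apply/bigmax_leP; split=> // -[i j] _ /=.
  rewrite ord1; have /andP[x0 x1] := base_polytope01 j Px.
  by rewrite ger0_norm.
rewrite (_ : @base_polytope R n M =
  [set x : 'rV[R]_n | \sum_(e in finset.setT) x 0 e = (rank M)%:R] `&`
  \bigcap_(S in [set: {set 'I_n}]) [set x : 'rV[R]_n | \sum_(e in S) x 0 e <= (rk M S)%:R]).
  apply: closedI.
    apply: (@closed_sum_coord finset.setT [set y | y = (rank M)%:R]).
    exact: closed_eq.
  apply: closed_bigI => S _; apply: (@closed_sum_coord S [set y | y <= (rk M S)%:R]).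
  exact: closed_le.
apply/seteqP; split=> x.
  move=> /base_polytopeP[x1 xS]; split=> [|S _]; last exact: xS.
  by rewrite /= (eq_bigl _ _ (finset.in_setT (T := 'I_n))).
move=> [/= x1 xS]; apply/base_polytopeP; split=> [|S]; last exact: xS.
by rewrite -x1 (eq_bigl _ _ (finset.in_setT (T := 'I_n))).
Qed.

Lemma convex_base_polytope M : convex (@base_polytope R n M).
Proof.
move=> x y t /base_polytopeP[x1 xS] /base_polytopeP[y1 yS] /andP[t0 t1].
have E S : \sum_(e in S) (t *: x + (1 - t) *: y) 0 e =
    t * \sum_(e in S) x 0 e + (1 - t) * \sum_(e in S) y 0 e.
  by rewrite !big_distrr /= -big_split; apply: eq_bigr => e _; rewrite !mxE.
apply/base_polytopeP; split=> [|S].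
  rewrite -(eq_bigl _ _ (finset.in_setT (T := 'I_n))) E !(eq_bigl _ _ (finset.in_setT (T := 'I_n))).
  by rewrite x1 y1; ring.
rewrite E; have := xS S; have := yS S.
have : 0 <= 1 - t by rewrite subr_ge0.
move: (\sum_(e in S) x 0 e) (\sum_(e in S) y 0 e) ((rk M S)%:R) => a b c t1' bc ac.
have : 0 <= t * (c - a) + (1 - t) * (c - b) by rewrite addr_ge0 // mulr_ge0 ?subr_ge0.
by move=> h; lra.
Qed.

Section Valuative.
Variables (I J : finType) (l : I -> R) (M : I -> matroid 'I_n).
Variable F : J -> {set 'I_n}.
Hypothesis rel : forall x, \sum_i l i * \1_(@base_polytope R n (M i)) x = 0.
Hypothesis cF : forall j k, (F j \subset F k) || (F k \subset F j).

(** Cutting by the half-spaces where the coordinate sums over [F j] are at least [rho j] leaves a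
    nonempty set exactly when all the rank bounds hold: as the [F j] form a chain, one basis attains
    all ranks at once. The Euler characteristic of the cut is thus the indicator wanted. *)
Lemma rank_ge_valuative (rho : J -> nat) :
  \sum_i l i * [forall j, rho j <= rk (M i) (F j)]%N%:R = 0.
Proof.
pose H := [set x : 'rV[R]_n | forall j, (rho j)%:R <= \sum_(e in F j) x 0 e].
have clH : closed H.
  rewrite (_ : H = \bigcap_(j in [set: J])
    [set x : 'rV[R]_n | (rho j)%:R <= \sum_(e in F j) x 0 e]); last first.
    by apply/seteqP; split=> x Hx j; [move=> _; apply: (Hx j)|apply: (Hx j)].
  apply: closed_bigI => j _; apply: (@closed_sum_coord (F j) [set y | (rho j)%:R <= y]).
  exact: closed_ge.
rewrite -[RHS](@compact_convex_euler R n I l (fun i => @base_polytope R n (M i) `&` H)).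
- apply: eq_bigr => i _; congr (_ * (nat_of_bool _)%:R).
  apply/forallP/asboolP => [ge|[x [/base_polytopeP[_ xS] Hx]] j]; last first.
    by rewrite -(ler_nat R); apply: le_trans (Hx j) (xS _).
  have [|A _|B [iB _ cB BP]] := @chain_basis _ (M i) [set F j | j in J]%SET finset.setT.
  + by move=> A A' /imsetP[j _ ->] /imsetP[k _ ->]; apply: cF.
  + exact: finset.subsetT.
  exists (@char_vec R n B); split.
    exists 1%N, (fun=> @char_vec R n B), (fun=> 1); split=> //.
    + by move=> _; exists B => //; apply: rank_indep_card.
    + by rewrite big_ord1.
    + by rewrite big_ord1 scale1r.
  by move=> j; rewrite sum_char_vec ler_nat BP ?imset_f.
- by move=> i; apply: compact_closedI => //; apply: compact_base_polytope.
- move=> i x y t [Px Hx] [Py Hy] t01; split; first exact: convex_base_polytope.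
  move=> j; have -> : \sum_(e in F j) (t *: x + (1 - t) *: y) 0 e =
      t * \sum_(e in F j) x 0 e + (1 - t) * \sum_(e in F j) y 0 e.
    by rewrite !big_distrr /= -big_split; apply: eq_bigr => e _; rewrite !mxE.
  have /andP[t0 t1] := t01; have t1' : 0 <= 1 - t by rewrite subr_ge0.
  have := Hx j; have := Hy j.
  move: (\sum_(e in F j) x 0 e) (\sum_(e in F j) y 0 e) ((rho j)%:R) => a b c bc ac.
  have : 0 <= t * (a - c) + (1 - t) * (b - c) by rewrite addr_ge0 // mulr_ge0 ?subr_ge0.
  by move=> h; lra.
- move=> x; have [Hx|nHx] := pselect (H x).
    rewrite -[RHS](rel x); apply: eq_bigr => i _; rewrite !indicE.
    by congr (_ * (nat_of_bool _)%:R); apply/idP/idP; rewrite !in_setE; [case|move=> ?].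
  rewrite big1 // => i _; rewrite indicE (_ : (x \in _) = false) ?mulr0 //.
  by apply/negP; rewrite in_setE => -[].
Qed.

Lemma prod_bool (b : pred J) : \prod_j (b j)%:R = [forall j, b j]%:R :> R.
Proof.
have [/forallP H|/forallPn[j nj]] := boolP [forall j, b j].
  by rewrite big1 // => j _; rewrite H.
by rewrite (bigD1 j) //= (negPf nj) mul0r.
Qed.

(* Inclusion-exclusion: [a = b] = [b <= a] - [b + 1 <= a]. *)
Lemma rank_eq_valuative (rho : J -> nat) :
  \sum_i l i * [forall j, rk (M i) (F j) == rho j]%:R = 0.
Proof.
have expand i : [forall j, rk (M i) (F j) == rho j]%:R =
    \sum_(A : {set J}) (-1) ^+ #|~: A|%SET *
      [forall j, rho j + (j \notin A) <= rk (M i) (F j)]%N%:R :> R.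
  rewrite -prod_bool.
  rewrite (eq_bigr (fun j => (rho j <= rk (M i) (F j))%N%:R +
      - (rho j + 1 <= rk (M i) (F j))%N%:R)) => [|j _]; last first.
    case: (ltngtP (rho j) (rk (M i) (F j))) => [lt|gt|->].
    - by rewrite addn1 lt subrr.
    - by rewrite addn1 (leqNgt _.+1) ltnS (ltnW gt) subr0.
    - by rewrite addn1 ltnn subr0.
  rewrite bigA_distr; apply: eq_bigr => A _; rewrite -prod_bool.
  rewrite -[(-1) ^+ _]prodr_const [X in X * _]big_mkcond -big_split /=.
  apply: eq_bigr => j _; rewrite !inE; case: (j \in A) => /=.
    by rewrite addn0 mul1r.
  by rewrite mulN1r.
under eq_bigr => i _ do rewrite expand big_distrr.
rewrite exchange_big /= big1 // => A _.
under eq_bigr => i _ do rewrite mulrCA.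
by rewrite -big_distrr /= rank_ge_valuative mulr0.
Qed.

End Valuative.
End BasePolytope.

(** * Symmetrized indicators and the independence of nested matroids *)

Section SymmetrizedIndicator.
Local Open Scope classical_set_scope.
Local Open Scope ring_scope.
Variables (R : realType) (n : nat).
Implicit Types (M : matroid 'I_n) (x : 'rV[R]_n).

Let poly M := @base_polytope R n M.

Lemma relabel_polytope (s : 'S_n) M x :
  poly (relabel s M) x <-> poly M (\row_i x 0 (s i)).
Proof.
have E (S : {set 'I_n}) :
    \sum_(e in s @: S) x 0 e = \sum_(e in S) (\row_i x 0 (s i)) 0 e.
  rewrite big_imset /=; last by move=> ? ? _ _; apply: perm_inj.
  by apply: eq_bigr => e _; rewrite mxE.
have ET : \sum_e x 0 e = \sum_e (\row_i x 0 (s i)) 0 e.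
  by rewrite (reindex_inj (@perm_inj _ s)); apply: eq_bigr => e _; rewrite mxE.
split=> /base_polytopeP[x1 xS]; apply/base_polytopeP; split.
- by rewrite -ET x1 rank_relabel.
- by move=> S; rewrite -E -{2}(preimset_imset_perm s S) -rk_relabel.
- by rewrite ET x1 rank_relabel.
- by move=> S; rewrite -(imset_preimset_perm s S) E rk_relabel preimset_imset_perm.
Qed.

Lemma indic_relabel (s : 'S_n) M x :
  \1_(poly M) (\row_i x 0 (s i)) = \1_(poly (relabel s M)) x :> R.
Proof.
rewrite !indicE; congr (nat_of_bool _)%:R.
by apply/idP/idP; rewrite !in_setE => /relabel_polytope.
Qed.

Lemma sym_indic_isomorphic M M' : isomorphic M M' ->
  sym_indic (poly M) = sym_indic (poly M').
Proof.
move=> /isomorphic_relabel[s ->]; apply/funext => x; rewrite /sym_indic.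
congr (_ * _); rewrite (reindex_inj (mulgI s)); apply: eq_bigr => t _.
rewrite -(indic_relabel s); congr (\1_(poly M) _).
by apply/rowP => i; rewrite !mxE permM.
Qed.

Section Relations.
Variables (I : finType) (l : I -> R) (M : I -> matroid 'I_n).
Hypothesis rel : forall x, \sum_i l i * sym_indic (poly (M i)) x = 0.

(** Permuting coordinates relabels the matroid, so a symmetrized relation is an ordinary relation
    between the polytopes of all relabellings, indexed by pairs. *)
Lemma sym_valuative (J : finType) (F : J -> {set 'I_n}) (rho : J -> nat) :
  (forall j k, (F j \subset F k) || (F k \subset F j)) ->
  \sum_i l i * \sum_(s : 'S_n) [forall j, rk (M i) (s @^-1: F j) == rho j]%:R = 0.
Proof.
move=> cF; under eq_bigr => i _ do rewrite big_distrr.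
rewrite pair_bigA /=.
rewrite -[RHS](@rank_eq_valuative R n (I * 'S_n)%type J (fun p => l p.1)
  (fun p => relabel p.2 (M p.1)) F _ cF rho).
  apply: eq_bigr => p _; congr (_ * (nat_of_bool _)%:R).
  by apply: eq_forallb => j; rewrite rk_relabel.
move=> x; rewrite -(pair_bigA _ (fun i s => l i * \1_(poly (relabel s (M i))) x)) /=.
apply: (@mulfI _ ((n`!)%:R^-1)); first by rewrite invr_eq0 pnatr_eq0 -lt0n fact_gt0.
rewrite mulr0 -[RHS](rel x) big_distrr /=; apply: eq_bigr => i _.
rewrite -big_distrr /= mulrCA; congr (_ * (_ * _)); apply: eq_bigr => s _.
by rewrite -indic_relabel.
Qed.

(* Summing over a family of chains that is stable under permutations removes the
   symmetrization. *)
Lemma weighted_chains (J : finType) (theta : {ffun J -> {set 'I_n}} -> R) (rho : J -> nat) :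
  (forall F, theta F != 0 -> forall j k, (F j \subset F k) || (F k \subset F j)) ->
  (forall (s : 'S_n) (F : {ffun J -> {set 'I_n}}), theta [ffun j => s @^-1: F j] = theta F) ->
  \sum_i l i * \sum_F theta F * [forall j, rk (M i) (F j) == rho j]%:R = 0.
Proof.
move=> theta0 thetaS.
apply: (@mulfI _ (#|'S_n|%:R)).
  by rewrite pnatr_eq0 -lt0n; apply/card_gt0P; exists 1%g.
rewrite mulr0 big_distrr /=.
transitivity (\sum_F theta F *
    \sum_i l i * \sum_(s : 'S_n)
      [forall j, rk (M i) (s @^-1: (F : {ffun J -> _}) j) == rho j]%:R); last first.
  rewrite big1 // => F _; have [->|/theta0 cF] := eqVneq (theta F) 0; first by rewrite mul0r.
  by rewrite sym_valuative // mulr0.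
under [RHS]eq_bigr => F _ do rewrite big_distrr.
rewrite exchange_big /=; apply: eq_bigr => i _.
under [RHS]eq_bigr => F _ do rewrite mulrCA.
rewrite -big_distrr /= mulrCA; congr (_ * _).
under [RHS]eq_bigr => F _ do rewrite big_distrr.
rewrite exchange_big /= -[in LHS]cardsT -sum1_card natr_sum big_distrl /=.
apply: eq_big => [s|s _]; first by rewrite inE.
rewrite mul1r (reindex_inj (h := fun F : {ffun J -> {set 'I_n}} => [ffun j => s @^-1: F j])) /=.
  apply: eq_bigr => F _; rewrite thetaS; congr (_ * (nat_of_bool _)%:R).
  by apply: eq_forallb => j; rewrite ffunE.
move=> F G /ffunP E; apply/ffunP => j; have := E j; rewrite !ffunE => Ej.
by rewrite -(imset_preimset_perm s (F j)) Ej imset_preimset_perm.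
Qed.

End Relations.

Section Uniqueness.
Variables (r : nat) (N : 'I_('C(n, r)) -> matroid 'I_n).
Hypothesis HN : nested_representatives N.

(* Test a relation on the chain of cyclic flats of the matroid with the fewest
   bases among those that occur. *)
Lemma nested_independent (d : 'I_('C(n, r)) -> R) :
  (forall x, \sum_j d j * sym_indic (poly (N j)) x = 0) -> forall j, d j = 0.
Proof.
move=> rel j0; apply/eqP; apply: contraT => dj0.
have [Nr Niso _] := HN.
pose nb M := #|[set B | Defs.basis M B]%SET|.
case: (arg_minnP (P := fun j => d j != 0) (fun j => nb (N j)) dj0) => j dj jmin.
(* Sets that are not cyclic flats are sent to the empty set, so the family indexed by all sets stays
   a chain and they impose only a trivial condition. *)
pose F (A : {set 'I_n}) := if cyclic_flat (N j) A then A else finset.set0.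
have cF A A' : (F A \subset F A') || (F A' \subset F A).
  rewrite /F; case: ifPn => cA; case: ifPn => cA'; rewrite ?finset.sub0set ?orbT //.
  have [/forallP/(_ A)/forallP/(_ A')/implyP nest _] := Nr j.
  by apply: nest; rewrite cA.
have := sym_valuative rel (fun A => rk (N j) (F A)) cF.
(* A relabelling of [N k] with the same ranks on the cyclic flats of [N j] has only bases of [N j]
   as bases, by [indep_cyclic]; as [N j] has the fewest, the two are equal, against [k != j]. For
   [j] itself the identity permutation contributes 1. *)
rewrite (bigD1 j) //= [X in _ + X]big1 => [|k kj]; last first.
  have [->|dk] := eqVneq (d k) 0; first by rewrite mul0r.
  rewrite big1 ?mulr0 // => s _.
  case: forallP => // H; case/eqP: kj; apply: Niso.
  suff -> : N j = relabel s (N k) by apply: relabel_isomorphic.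
  have sub : [set B | Defs.basis (relabel s (N k)) B]%SET \subset
      [set B | Defs.basis (N j) B]%SET.
    apply/fintype.subsetP => B; rewrite !inE => bB.
    have [_ cB] := basisP _ _ bB.
    apply: rank_indep_card; last by rewrite cB rank_relabel !(Nr _).2.
    apply: indep_cyclic => A cA; have /eqP := H A; rewrite /F cA => <-.
    by rewrite -rk_relabel basis_rk_le.
  have E : [set B | Defs.basis (relabel s (N k)) B]%SET = [set B | Defs.basis (N j) B]%SET.
    by apply/eqP; rewrite eqEcard sub card_bases_relabel; apply: jmin.
  by apply: matroid_eq_bases => B; have /setP/(_ B) := E; rewrite !inE.
rewrite addr0 => /eqP; rewrite mulf_eq0 (negPf dj) /= gt_eqF //.
rewrite (bigD1 1%g) //=; apply: ltr_wpDr; first by apply: sumr_ge0 => s _; apply: ler0n.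
rewrite (_ : [forall _, _] = true) ?ltr01 //; apply/forallP => A; apply/eqP.
congr (rk _ _); apply/setP => i; by rewrite !inE perm1.
Qed.

Lemma nested_coords_inj M M' c c' : isomorphic M M' ->
  nested_coords R N M c -> nested_coords R N M' c' -> c = c'.
Proof.
move=> iso cM cM'; apply/rowP => j; apply/eqP; rewrite -subr_eq0 -(intr_eq0 R).
apply/eqP; apply: (nested_independent (d := fun j => (c 0 j - c' 0 j)%:~R)) => x.
transitivity (sym_indic (poly M) x - sym_indic (poly M') x).
  rewrite cM cM' -sumrB; apply: eq_bigr => k _.
  by rewrite intrB mulrBl.
by rewrite (sym_indic_isomorphic iso) subrr.
Qed.

End Uniqueness.
End SymmetrizedIndicator.

(** * Extremality *)

Section AlternatingSums.
Local Open Scope ring_scope.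
Variable R : realType.

(** This is the expansion of the product over [D] of the factors 1 - [g S]. *)
Lemma alternating_subsets (T : finType) (D : {set T}) (g : pred T) :
  \sum_(C : {set T} | C \subset D) (-1) ^+ #|C| * [forall S in C, g S]%:R =
  [forall S in D, ~~ g S]%:R :> R.
Proof.
rewrite -prod_bool (eq_bigr (fun S => (if S \in D then - (g S)%:R else 0) + 1)); last first.
  by move=> S _; case: (S \in D); case: (g S); rewrite /= ?addNr ?oppr0 ?add0r.
rewrite bigA_distr [LHS]big_mkcond; apply: eq_bigr => A _.
case: ifPn => [/fintype.subsetP AD|/subsetPn[S SA SD]]; last first.
  by rewrite (bigD1 S) //= SA (negPf SD) mul0r.
rewrite -[(-1) ^+ _]prodr_const -prod_bool [X in X * _]big_mkcond -big_split /=.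
apply: eq_bigr => S _; case: (boolP (S \in A)) => [SA|_] /=; last by rewrite mulr1.
by rewrite (AD S SA) mulN1r.
Qed.

End AlternatingSums.

(** * Existence of nested coordinates *)

Section Existence.
Local Open Scope classical_set_scope.
Local Open Scope ring_scope.
Variables (R : realType) (n r : nat) (N : 'I_('C(n, r)) -> matroid 'I_n).
Hypothesis HN : nested_representatives N.
Variable M : matroid 'I_n.
Hypothesis rM : rank M = r.
Implicit Types (x : 'rV[R]_n) (S : {set 'I_n}) (C D : {set {set 'I_n}}).

Definition chain_polytope C := [set x : 'rV[R]_n |
  [/\ \sum_e x 0 e = (rank M)%:R, forall e, 0 <= x 0 e <= 1 &
      forall S, S \in C -> \sum_(e in S) x 0 e <= (rk M S)%:R]].

Lemma sum_setID x S S' : \sum_(e in S) x 0 e =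
  \sum_(e in S :&: S') x 0 e + \sum_(e in S :\: S') x 0 e.
Proof. by rewrite (big_setID S'). Qed.

Lemma sum_coord_le_card x S : (forall e, x 0 e <= 1) -> \sum_(e in S) x 0 e <= #|S|%:R.
Proof. by move=> x1; rewrite -sum1_card natr_sum; apply: ler_sum. Qed.

Lemma sum_coord_sub x S S' : (forall e, 0 <= x 0 e) -> S \subset S' ->
  \sum_(e in S) x 0 e <= \sum_(e in S') x 0 e.
Proof.
move=> x0 SS'; rewrite [leRHS](sum_setID x S' S) (finset.setIidPr SS') lerDl.
exact: sumr_ge0.
Qed.

(** The nested matroid bounds the members of [C] by their ranks in [M]; the ground set is added to
    fix the total rank. By [chain_matroid_rk] its other inequalities follow from these and from the
    cube. *)
Lemma chain_polytope_nested C : chainb C ->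
  exists j, sym_indic (chain_polytope C) = sym_indic (@base_polytope R n (N j)).
Proof.
move=> /chainbP cC.
have cP : comparable_sets (finset.setT |: C)%SET.
  move=> A B; rewrite !finset.in_setU1 => /orP[/eqP ->|AC] /orP[/eqP ->|BC].
  - by rewrite subxx.
  - by rewrite finset.subsetT orbT.
  - by rewrite finset.subsetT.
  - exact: cC.
pose L := chain_matroid (rk M) cP.
have leL S : S \in (finset.setT |: C)%SET -> (rk L S <= rk M S)%N.
  move=> SP; have [I [/chain_matroidP iI IS <-]] := rk_witness L S.
  by have := iI S SP; rewrite (finset.setIidPl IS).
have rL : rank L = r.
  apply/eqP; rewrite -rM eqn_leq leL ?finset.in_setU1 ?eqxx //=.
  have [B [iB _ cB]] := rk_witness M finset.setT.
  rewrite -[leqLHS]cB card_le_rk ?finset.subsetT //; apply/chain_matroidP => S _.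
  by apply: card_le_rk (finset.subsetIr _ _); apply: indepS iB; apply: finset.subsetIl.
have [_ _ /(_ L (chain_matroid_nested _ _) rL)[j Lj]] := HN.
exists j; rewrite -(sym_indic_isomorphic _ Lj); congr sym_indic.
apply/seteqP; split=> x.
  move=> [x1 x01 xS]; apply/base_polytopeP; split; first by rewrite x1 rM rL.
  have x0 e : 0 <= x 0 e by case/andP: (x01 e).
  have xle1 e : x 0 e <= 1 by case/andP: (x01 e).
  move=> S; have [->|[S' S'P le]] := chain_matroid_rk (rk M) cP S.
    exact: sum_coord_le_card.
  rewrite (sum_setID x S S'); apply: (@le_trans _ _ ((rk M S')%:R + #|S :\: S'|%:R)).
    apply: lerD; last exact: sum_coord_le_card.
    apply: le_trans (sum_coord_sub x0 (finset.subsetIr S S')) _.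
    move: S'P; rewrite finset.in_setU1 => /orP[/eqP ->|]; last exact: xS.
    by rewrite (eq_bigl _ _ (finset.in_setT (T := 'I_n))) x1.
  by rewrite -natrD ler_nat.
move=> Px; have [x1 xS] := (base_polytopeP _ _).1 Px; split.
- by rewrite x1 rL rM.
- by move=> e; apply: base_polytope01 Px.
- move=> S SC; apply: le_trans (xS S) _.
  by rewrite ler_nat leL // finset.in_setU1 SC orbT.
Qed.

Lemma sum_modular x S S' : \sum_(e in S :|: S') x 0 e + \sum_(e in S :&: S') x 0 e =
  \sum_(e in S) x 0 e + \sum_(e in S') x 0 e.
Proof.
rewrite !(big_mkcond (fun e => e \in _)) -!big_split /=; apply: eq_bigr => e _.
by rewrite !inE; case: (e \in S); case: (e \in S'); rewrite /= ?addr0 ?add0r.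
Qed.

(** Inside the slice of the cube, the signed count of chains of violated sets is 1 if no set is
    violated, from the empty chain, and 0 otherwise. The condition that all of [D] is violated is
    then expanded over the subsets [C] of [D]. *)
Lemma indic_base_polytope x : \1_(@base_polytope R n M) x =
  \sum_(D : {set {set 'I_n}} | chainb D) \sum_(C : {set {set 'I_n}} | C \subset D)
    (-1) ^+ (#|C| + #|D|) * \1_(chain_polytope C) x :> R.
Proof.
have [xD|nxD] := pselect (\sum_e x 0 e = (rank M)%:R /\ forall e, 0 <= x 0 e <= 1); last first.
  rewrite indicE (_ : (x \in _) = false); last first.
    apply/negP; rewrite in_setE => Px; apply: nxD; split; last first.
      by move=> e; apply: base_polytope01 Px.
    by have [] := (base_polytopeP _ _).1 Px.
  rewrite big1 // => D _; rewrite big1 // => C _; rewrite indicE (_ : (x \in _) = false) ?mulr0 //.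
  by apply/negP; rewrite in_setE => -[x1 x01 _]; apply: nxD.
have [x1 x01] := xD.
pose g S := \sum_(e in S) x 0 e <= (rk M S)%:R.
have gC C : \1_(chain_polytope C) x = [forall S in C, g S]%:R :> R.
  rewrite indicE; congr (nat_of_bool _)%:R; apply/idP/forall_inP; rewrite in_setE.
    by case.
  by move=> H; split.
transitivity (\sum_(D : {set {set 'I_n}} | chainb D) (-1) ^+ #|D| *
    [forall S in D, ~~ g S]%:R : R); last first.
  apply: eq_bigr => D _; rewrite -alternating_subsets big_distrr /=.
  by apply: eq_bigr => C _; rewrite gC mulrA -exprD addnC.
transitivity (\sum_(D : {set {set 'I_n}} | chainb D && [forall S in D, ~~ g S]) (-1) ^+ #|D| : R);
  last first.
  rewrite big_mkcondr /=; apply: eq_bigr => D _.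
  by case: [forall S in D, ~~ g S]; rewrite ?mulr1 ?mulr0.
have [allg|] := boolP [forall S, g S].
  rewrite (big_pred1 finset.set0) => [|D /=].
    rewrite cards0 expr0 indicE (_ : (x \in _) = true) //; apply: mem_set.
    by apply/base_polytopeP; split=> // S; apply: (forallP allg).
  apply/andP/eqP => [[_ /forall_inP H]|->].
    apply/finset.setP => S; rewrite !inE; apply/negP => /H.
    by rewrite (forallP allg).
  split; first by apply/chainbP => A B; rewrite inE.
  by apply/forall_inP => S; rewrite inE.
case/forallPn => S1 S1bad.
rewrite indicE (_ : (x \in _) = false); last first.
  apply/negP; rewrite in_setE => /base_polytopeP[_ /(_ S1)].
  by apply/negP.
pose h S := (rk M S)%:R - \sum_(e in S) x 0 e.
have gh S : g S = (0 <= h S) by rewrite subr_ge0.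
(* [h] is submodular. At its minimum [S0] the union costs at least as much as [S0], so intersecting
   with [S0] does not increase [h] and keeps a violated set violated. *)
have [S0 _ S0min] : exists2 S0, true & forall S, h S0 <= h S.
  case: (@Order.TotalTheory.arg_minP _ _ _ finset.set0 predT h isT) => S0 _ H.
  by exists S0 => // S; apply: H.
have bad0 : ~~ g S0.
  by move: S1bad; rewrite !gh -!ltNge; apply: le_lt_trans.
have badI S : ~~ g S -> ~~ g (S0 :&: S)%SET.
  rewrite !gh -!ltNge; apply: le_lt_trans.
  have := sum_modular x S0 S; have := rk_submod M S0 S; rewrite -(ler_nat R) !natrD.
  have := S0min (S0 :|: S)%SET; rewrite /h.
  move: (\sum_(e in S0 :|: S) _) (\sum_(e in S0 :&: S) _) (\sum_(e in S0) _) (\sum_(e in S) _).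
  by move=> a b c d; lra.
have := bad_chains_euler bad0 badI => /(congr1 (fun z : int => z%:~R : R)).
rewrite mulr0z rmorph_sum /= => E; rewrite -[LHS]E; apply: eq_bigr => D _.
by rewrite rmorphXn rmorphN1.
Qed.

Lemma nested_coords_exist : exists c, nested_coords R N M c.
Proof.
have ex C : exists j, chainb C ->
    sym_indic (chain_polytope C) = sym_indic (@base_polytope R n (N j)).
  have [/chain_polytope_nested[j E]|_] := boolP (chainb C); first by exists j.
  (* For [C] that is not a chain the index is irrelevant; the empty chain shows that one exists. *)
  have [|j _] := @chain_polytope_nested finset.set0; last by exists j.
  by apply/chainbP => A B; rewrite inE.
have [jj jjP] := choice ex.
exists (\row_j \sum_(D : {set {set 'I_n}} | chainb D) \sum_(C : {set {set 'I_n}} | C \subset D)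
    (-1) ^+ (#|C| + #|D|) * (jj C == j)%:R) => x.
transitivity (\sum_(D : {set {set 'I_n}} | chainb D) \sum_(C : {set {set 'I_n}} | C \subset D)
    (-1) ^+ (#|C| + #|D|) * sym_indic (chain_polytope C) x).
  rewrite /sym_indic; under eq_bigr => s _ do rewrite indic_base_polytope.
  rewrite exchange_big big_distrr; apply: eq_bigr => D _ /=.
  rewrite exchange_big big_distrr; apply: eq_bigr => C _ /=.
  by rewrite -big_distrr /= mulrCA.
symmetry; under eq_bigr => j _ do rewrite mxE rmorph_sum /= big_distrl.
rewrite exchange_big /=; apply: eq_bigr => D cD.
under eq_bigr => j _ do rewrite rmorph_sum /= big_distrl.
rewrite exchange_big /=; apply: eq_bigr => C CD.
have cC : chainb C.
  apply/chainbP => A B AC BC; apply: (chainbP _ cD); exact: (fintype.subsetP CD).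
rewrite (bigD1 (jj C)) //= eqxx mulr1 big1 => [|j jC]; last first.
  by rewrite eq_sym (negPf jC) mulr0 mul0r.
by rewrite addr0 jjP // rmorphXn rmorphN1.
Qed.

End Existence.

Section Extremality.
Local Open Scope ring_scope.
Variables (R : realType) (r n : nat).
Hypotheses (r2 : (1 < r)%N) (En : n = 'C(r.+1, 2)).
Variable N : 'I_('C(n, r)) -> matroid 'I_n.
Hypothesis HN : nested_representatives N.
Implicit Types (M K : matroid 'I_n).

Definition chain_count (J : finType) (theta : {ffun J -> {set 'I_n}} -> R)
    (rho : J -> nat) M :=
  \sum_F theta F * [forall j, rk M (F j) == rho j]%:R.

Definition linear_on_coords (f : matroid 'I_n -> R) := forall M c, nested_coords R N M c ->
  f M = \sum_j (c 0 j)%:~R * f (N j).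

Lemma chain_count_linear (J : finType) (theta : {ffun J -> {set 'I_n}} -> R)
    (rho : J -> nat) :
  (forall F, theta F != 0 -> forall j k, (F j \subset F k) || (F k \subset F j)) ->
  (forall (s : 'S_n) (F : {ffun J -> {set 'I_n}}), theta [ffun j => s @^-1: F j] = theta F) ->
  linear_on_coords (chain_count theta rho).
Proof.
move=> theta0 thetaS M c cM.
(* The definition of coordinates is read as a linear relation in which [M] itself has coefficient
   -1. *)
pose l (i : unit + 'I_('C(n, r))) : R := if i is inr j then (c 0 j)%:~R else -1.
pose Ms (i : unit + 'I_('C(n, r))) := if i is inr j then N j else M.
have rel x : \sum_i l i * sym_indic (@base_polytope R n (Ms i)) x = 0.
  by rewrite big_sumType /= (big_pred1 tt) => [|[]] //=; rewrite -cM mulN1r addNr.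
have := weighted_chains rel rho theta0 thetaS.
rewrite big_sumType /= (big_pred1 tt) => [|[]] //=.
by rewrite mulN1r addrC => /eqP; rewrite subr_eq0 => /eqP/esym.
Qed.

Lemma forall_bool (P : pred bool) : [forall b, P b] = P false && P true.
Proof.
by apply/forallP/andP => [H|[Pf Pt] [|]]; [split; apply: H| |].
Qed.

(** [F false] is the candidate flat and [F true] a larger set of the same rank, weighted by the sign
    of [flat_alternating_sum]. *)
Definition flat_count i s :=
  chain_count (fun F : {ffun bool -> {set 'I_n}} =>
    ((F false \subset F true) && (#|F false| == s))%:R * (-1) ^+ #|F true :\: F false|)
    (fun=> i).

Lemma flat_count_linear i s : linear_on_coords (flat_count i s).
Proof.
apply: chain_count_linear => [F|t F].
  have [/andP[FF _] _|_] := boolP (_ && _); last by rewrite mul0r eqxx.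
  by case=> -[]; rewrite ?subxx ?FF ?orbT.
have sb : forall A B : {set 'I_n}, (t @^-1: A \subset t @^-1: B) = (A \subset B).
  move=> A B; apply/idP/idP; last exact: preimsetS.
  by move/(imsetS t); rewrite !imset_preimset_perm.
rewrite !ffunE sb card_preimset_perm -[in #|F true :\: _|](card_preimset_perm t).
by congr (_ * _ ^+ #|pred_of_set _|); apply/setP => e; rewrite !inE.
Qed.

Lemma flat_countE i s M :
  flat_count i s M = #|[set S | [&& flat M S, rk M S == i & #|S| == s]]|%:R.
Proof.
pose h (p : {set 'I_n} * {set 'I_n}) := [ffun b : bool => if b then p.2 else p.1].
have hb : bijective h.
  exists (fun F : {ffun bool -> {set 'I_n}} => (F false, F true)) => [[S A]|F].
    by rewrite !ffunE.
  by apply/ffunP => -[]; rewrite ffunE.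
rewrite /flat_count /chain_count (reindex h) /=; last exact: onW_bij.
rewrite -(pair_bigA _ (fun S A => ((h (S, A) false \subset h (S, A) true) &&
  (#|h (S, A) false| == s))%:R * (-1) ^+ #|h (S, A) true :\: h (S, A) false| *
  [forall j, rk M (h (S, A) j) == i]%:R)) /=.
rewrite -sum1_card natr_sum [RHS]big_mkcond; apply: eq_bigr => S _.
rewrite inE; have [rS|] := eqVneq (rk M S) i; last first.
  move=> ne; rewrite /= andbF big1 // => A _.
  by rewrite forall_bool !ffunE /= (negPf ne) mulr0.
have [cS|] := eqVneq #|S| s; last first.
  move=> ne; rewrite /= !andbF big1 // => A _.
  by rewrite !ffunE /= (negPf ne) andbF !mul0r.
transitivity ((flat M S)%:R : R); last by case: (flat M S).
rewrite -flat_alternating_sum [RHS]big_mkcond; apply: eq_bigr => A _.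
rewrite forall_bool !ffunE /= cS rS !eqxx andbT /=.
by case: (S \subset A); case: (rk M A == i); rewrite ?mul1r ?mulr1 ?mul0r ?mulr0.
Qed.

Definition flag_count :=
  chain_count (fun F : {ffun 'I_r.+1 -> {set 'I_n}} => (size_flag F)%:R) (fun i => i).

Lemma flag_count_linear : linear_on_coords flag_count.
Proof.
apply: chain_count_linear => [F|t F].
  have [/andP[_ /forallP Fm] _ j k|_] := boolP (size_flag F); last by rewrite eqxx.
  have [jk|kj] := leqP j k; apply/orP; [left|right].
    by have /forallP/(_ k) := Fm j; rewrite jk.
  by have /forallP/(_ j) := Fm k; rewrite ltnW.
congr (nat_of_bool _)%:R; congr (_ && _).
  by apply: eq_forallb => i; rewrite ffunE card_preimset_perm.
apply: eq_forallb => i; apply: eq_forallb => j; rewrite !ffunE; congr (_ ==> _).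
apply/idP/idP; last exact: preimsetS.
by move/(imsetS t); rewrite !imset_preimset_perm.
Qed.

Lemma flag_countE M : flag_count M =
  #|[set F : {ffun 'I_r.+1 -> {set 'I_n}} | size_flag F && [forall i, rk M (F i) == i]]|%:R.
Proof.
rewrite -sum1_card natr_sum [RHS]big_mkcond; apply: eq_bigr => F _.
by rewrite inE; case: (size_flag F); case: [forall _, _]; rewrite ?mulr1 ?mulr0.
Qed.

(* Penalize every flat whose size violates the hypotheses of the combinatorial
   bound by more than the largest conceivable number of large flags. *)
Definition penalized M := flag_count M - #|{: {ffun 'I_r.+1 -> {set 'I_n}}}|%:R *
  \sum_(p : 'I_r * 'I_n.+1 | bad_size p.1 p.2) flat_count p.1 p.2 M.

Lemma penalized_linear : linear_on_coords penalized.
Proof.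
move=> M c cM.
have E : \sum_(p : 'I_r * 'I_n.+1 | bad_size p.1 p.2) flat_count p.1 p.2 M =
    \sum_j (c 0 j)%:~R *
      \sum_(p : 'I_r * 'I_n.+1 | bad_size p.1 p.2) flat_count p.1 p.2 (N j).
  under eq_bigr => p _ do rewrite (flat_count_linear _ _ cM).
  by rewrite exchange_big; apply: eq_bigr => j _; rewrite big_distrr.
rewrite /penalized E (flag_count_linear cM) big_distrr -sumrB.
by apply: eq_bigr => j _; rewrite /= mulrCA -mulrBr.
Qed.

Lemma penalized_good M :
  (forall F, flat M F -> (rk M F < r)%N -> ~~ bad_size (rk M F) #|F|) ->
  penalized M = flag_count M.
Proof.
move=> H; rewrite /penalized big1 ?mulr0 ?subr0 // => -[i s] /= bad.
rewrite flat_countE (_ : [set _ | _] = finset.set0) ?cards0 //.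
apply/finset.setP => F; rewrite !inE; apply/negP => /and3P[fF /eqP rF /eqP cF].
by have := H F fF; rewrite rF cF bad ltn_ord => /(_ isT).
Qed.

Lemma penalized_bad M F : flat M F -> (rk M F < r)%N -> bad_size (rk M F) #|F| ->
  penalized M <= 0.
Proof.
move=> fF ltr bad; rewrite subr_le0.
have cF : (#|F| < n.+1)%N by rewrite ltnS -[n in (_ <= n)%N]card_ord max_card.
apply: (@le_trans _ _ #|{: {ffun 'I_r.+1 -> {set 'I_n}}}|%:R).
  by rewrite flag_countE ler_nat max_card.
rewrite ler_peMr ?ler0n // (bigD1 (Ordinal ltr, Ordinal cF)) //=.
apply: (@le_trans _ _ (flat_count (rk M F) #|F| M)).
  rewrite flat_countE ler1n; apply/card_gt0P; exists F.
  by rewrite inE fF !eqxx.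
by rewrite lerDl; apply: sumr_ge0 => p _; rewrite flat_countE ler0n.
Qed.

(** Without bad flats the combinatorial theorem applies; with one, the value is at most 0, which
    also rules out equality. *)
Lemma penalized_le M : rank M = r ->
  penalized M * 2 <= (r.+1)`!%:R /\
  (penalized M * 2 = (r.+1)`!%:R -> isomorphic M (MK r.+1)).
Proof.
move=> rM; have cT : #|'I_n| = 'C(r.+1, 2) by rewrite card_ord.
have [/forallP H|] := boolP [forall F, flat M F ==> ((rk M F < r)%N ==> ~~ bad_size (rk M F) #|F|)].
  have {}H F : flat M F -> (rk M F < r)%N -> ~~ bad_size (rk M F) #|F|.
    by move=> fF lt; have := H F; rewrite fF lt.
  have sM := simple_of_sizes r2 H; have gM := good_of_sizes r2 rM cT H.
  rewrite penalized_good // flag_countE -(large_flagsE r gM).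
  move: rM cT; case: r r2 => [|[|k]] // _ rM cT.
  rewrite -[2]/(2%:R) -natrM ler_nat; split; first exact: card_large_flags_le.
  by move/eqP; rewrite eqr_nat => /eqP; apply: card_large_flags_eq.
case/forallPn => F; rewrite negb_imply => /andP[fF]; rewrite negb_imply negbK => /andP[lt bad].
have le := penalized_bad fF lt bad.
have lt0 : 0 < (r.+1)`!%:R :> R by rewrite ltr0n fact_gt0.
split; first by lra.
by move=> E; move: le; lra.
Qed.

Variable K : matroid 'I_n.
Hypothesis isoK : isomorphic K (MK r.+1).

Lemma rank_iso_complete : rank K = r.
Proof.
have [f [fb fK]] := isoK; rewrite -(rank_iso fb fK).
by have := rank_cycle (@ord0 r); rewrite card_ord => -[].
Qed.

(** A complete graph has no flat of bad size, so nothing is subtracted, and its cliques already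
    supply enough large flags. *)
Lemma penalized_complete : (r.+1)`!%:R <= penalized K * 2.
Proof.
have [f [fb fK]] := isoK; have rK := rank_iso_complete.
have cT : #|'I_n| = 'C(r.+1, 2) by rewrite card_ord.
have tK : triangular K f.
  move=> u v w a b c Ea Eb Ec; apply/clP.
  rewrite -!(rk_iso fb fK) !imsetU1 imset_set1; apply/clP.
  exact: cycle_triangular Ea Eb Ec.
have rV : (rank K).+1 = #|'I_r.+1| by rewrite rK card_ord.
have gK := good_triangular fb tK rV.
rewrite penalized_good => [|F fF _]; last exact: good_bad_size.
rewrite flag_countE -(large_flagsE r gK) -[2]/(2%:R) -natrM ler_nat.
have := @card_large_flags_triangular _ _ _ _ fb tK rV r.-1.
by rewrite (ltn_predK r2) card_ord; apply.
Qed.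

Theorem extremal_complete : extremal R N K.
Proof.
have rK := rank_iso_complete; split=> //.
have [c cK] := nested_coords_exist R HN rK; exists c; split=> //.
split.
  exists 1%N, (fun=> map_mx intr c), (fun=> 1); split=> //.
  - by move=> _; exists K, c.
  - by rewrite big_ord1.
  - by rewrite big_ord1 scale1r.
(* By linearity the functional with these coefficients takes the value [penalized M] at the
   coordinates of any [M]. *)
exists (\row_j penalized (N j)) => x [m [p [w [pP w0 w1 xE]]]] xc.
have val M c' : nested_coords R N M c' ->
    \sum_j (\row_j penalized (N j)) 0 j * (map_mx intr c' : 'rV[R]__) 0 j = penalized M.
  move=> cM; rewrite (penalized_linear cM); apply: eq_bigr => j _.
  by rewrite !mxE mulrC.
have /choice[Mc McP] : forall i, exists Mc : matroid 'I_n * 'rV[int]_('C(n, r)),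
    [/\ rank Mc.1 = r, nested_coords R N Mc.1 Mc.2 & p i = map_mx intr Mc.2].
  by move=> i; have [M [c' H]] := pP i; exists (M, c').
have pen i : penalized (Mc i).1 <= penalized K.
  have [rM _ _] := McP i; have [le _] := penalized_le rM.
  by have := penalized_complete; lra.
have xval : \sum_j (\row_j penalized (N j)) 0 j * x 0 j =
    \sum_i w i * penalized (Mc i).1.
  rewrite xE; under eq_bigr => j _ do rewrite summxE big_distrr.
  rewrite exchange_big /=; apply: eq_bigr => i _.
  have [_ cM pE] := McP i; rewrite -(val _ _ cM) big_distrr /=; apply: eq_bigr => j _.
  by rewrite pE !mxE mulrCA.
rewrite xval (val _ _ cK) ltNge; apply/negP => ge.
have nonneg i : 0 <= w i * (penalized K - penalized (Mc i).1).
  by rewrite mulr_ge0 // subr_ge0.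
have sum0 : \sum_i w i * (penalized K - penalized (Mc i).1) = 0.
  apply/eqP; rewrite eq_le sumr_ge0 // andbT.
  under eq_bigr => i _ do rewrite mulrBr.
  by rewrite big_split /= sumrN -big_distrl /= w1 mul1r subr_le0.
(* A point of positive weight must attain the maximum, so its matroid is isomorphic to [K] and has
   the same coordinates; the combination then collapses to the single point [c]. *)
have wp i : w i *: p i = w i *: map_mx intr c.
  have [->|wi] := eqVneq (w i) 0; first by rewrite !scale0r.
  have : w i * (penalized K - penalized (Mc i).1) == 0.
    have := sum0; move/eqP; rewrite psumr_eq0 // => /allP/(_ i (mem_index_enum _)).
    by [].
  rewrite mulf_eq0 (negPf wi) subr_eq0 /= => /eqP E.
  have [rM cM ->] := McP i; congr (_ *: map_mx _ _).
  apply: (nested_coords_inj HN _ cM cK).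
  apply: isomorphic_join isoK.
  have [le] := penalized_le rM; apply; apply/eqP; rewrite eq_le le /= -E.
  exact: penalized_complete.
case/eqP: xc; rewrite xE; under eq_bigr => i _ do rewrite wp.
by rewrite -scaler_suml w1 scale1r.
Qed.

End Extremality.

Theorem theorem5p3 (R : realType) (r : nat) (hr : (2 <= r)%N) :
  (forall (T : finType) (M : matroid T),
     simple M -> rank M = r -> #|T| = 'C(r.+1, 2) ->
     (forall (i : nat) (F : {set T}), (1 <= i <= r.-1)%N ->
        flat M F -> rk M F = i ->
        #|F| = 'C(i.+1, 2) \/ (#|F| <= 'C(i, 2) + 1)%N) ->
     (#|large_flags M r| <= (r.+1)`! %/ 2)%N /\
     (#|large_flags M r| = (r.+1)`! %/ 2 -> isomorphic M (MK r.+1))) /\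
  (forall N : 'I_('C('C(r.+1, 2), r)) -> matroid 'I_('C(r.+1, 2)),
     nested_representatives N ->
     forall K : matroid 'I_('C(r.+1, 2)), isomorphic K (MK r.+1) ->
     extremal R N K).
Proof.
split=> [T M sM rM cT H|N HN K isoK]; last first.
  exact: (extremal_complete R hr erefl HN isoK).
have gM := good_of_middle_flats sM rM cT H.
case: r hr rM cT {H} => [|[|k]] // _ rM cT; split.
  by rewrite leq_divRL // card_large_flags_le.
move=> E; apply: (card_large_flags_eq sM rM cT gM).
by rewrite E divnK // dvdn_fact.
Qed.
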